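(* Let $\Bbbk$ be a field and let $\Sigma$ be a once-punctured disk with $n\geq 4$ marked points on the boundary. (1) If $n$ is odd, then the deep locus of $V(\mathcal{A}(\Sigma),\Bbbk)$ is a single component of dimension $2n-3$. (2) If $n$ is even, then the deep locus of $V(\mathcal{A}(\Sigma),\Bbbk)$ contains one component of dimension $2n-3$ and four distinct subsets isomorphic to $(\Bbbk^\times)^n$. The intersection of the closures of these five sets is an $(n-1)$-dimensional subvariety.
   Context: A marked surface is a compact oriented smooth surface with boundary $\Sigma$ together with a finite set of marked points; marked points in the interior are called punctures. An arc is a simple (no self-crossings, non-contractible) curve with endpoints at marked points and interior disjoint from the marked points, up to homotopy; boundary arcs are the arcs homotopic into $\partial\Sigma$. A tagged arc is an arc, not cutting out a once-punctured monogon, each of whose ends is tagged plain or notched, with ends on the boundary tagged plain and with both ends tagged the same way if they are at the same puncture. Two tagged arcs are compatible if the underlying arcs can be drawn without crossings; if the underlying arcs differ and share an endpoint, the ends there have the same tag; and if the underlying arcs coincide, at least one end has the same tag in both. A tagged triangulation is a maximal collection of pairwise compatible tagged arcs (boundary arcs included). $\mathcal{A}(\Sigma)$ is the Fomin--Shapiro--Thurston cluster algebra of $\Sigma$ over $\mathbb{Z}$: clusters are tagged triangulations, frozen variables are the boundary arcs (and they are inverted), mutable variables are the non-boundary tagged arcs, and mutations are flips. $V(\mathcal{A},\Bbbk)=\mathrm{Hom}_{\mathrm{Ring}}(\mathcal{A},\Bbbk)$ with the Zariski topology. A point $p$ is deep if every cluster contains a cluster variable $x$ with $p(x)=0$; the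 deep locus is the set of all deep points.
   Formalization: The claims on components, dimensions and closures are stated for infinite fields only: for a finite field V(A,k) is a finite discrete space, so every dimension is 0 and they fail; the four subsets isomorphic to (k^×)^n are given for every field. *)

(* Defs.v *)
From HB Require Import structures.
From mathcomp Require Import all_boot all_order all_algebra.
From mathcomp Require Import fraction.
From mathcomp Require Import boolp classical_sets functions cardinality topology.
From mathcomp Require Import mpoly.

Set Implicit Arguments.
Unset Strict Implicit.
Unset Printing Implicit Defensive.

Import GRing.Theory Num.Theory.

Local Open Scope ring_scope.
Local Open Scope classical_set_scope.

(** * Tagged arcs of the once-punctured disk

    The boundary marked points are the elements of ['I_n], in counterclockwise
    cyclic order.  Up to homotopy the arcs are:
    - for each ordered pair [(i, j)], the simple curve from [i] to [j] which
      has the puncture on its left, i.e. which is homotopic, once the puncture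
      is filled in, to the boundary path from [i] counterclockwise to [j] and
      cuts that path off from the puncture.  The pair [(i, i + 1)] is a boundary
      arc, and [(i, i)] is the loop at [i] around the puncture;
    - for each [i], the radius from [i] to the puncture.
    Only the end of a radius at the puncture can be notched, so a tag is only
    recorded for radii ([true] means notched).  No arc has both ends at the
    puncture. *)

Definition tarc (n : nat) : Type := ('I_n * 'I_n + 'I_n * bool)%type.
HB.instance Definition _ n := Finite.on (tarc n).

Definition chord n (i j : 'I_n) : tarc n := inl (i, j).
Definition radius n (i : 'I_n) (notched : bool) : tarc n := inr (i, notched).

(* The loop [chord i i] cuts out a once-punctured monogon. *)
Definition is_tagged_arc n (a : tarc n) : bool :=
  match a with inl (i, j) => i != j | inr _ => true end.

(* Number of boundary segments met going counterclockwise from [i] to [j]. *)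
Definition ccw n (i j : 'I_n) : nat := ((j + n - i) %% n)%N.

(* In the universal cover of the punctured disk, whose boundary points are
   indexed by the integers, the chord (i, j) lifts to the translates by [n] of
   [i, i + ccw i j]; two chords cross iff some of their lifts interleave. *)
Definition overtakes n (i j k l : 'I_n) : bool :=
  ((0 < ccw i k) && (ccw i k < ccw i j) && (ccw i j < ccw i k + ccw k l))%N.

Definition cross n (a b : tarc n) : bool :=
  match a, b with
  | inl (i, j), inl (k, l) => overtakes i j k l || overtakes k l i j
  | inl (i, j), inr (m, _) | inr (m, _), inl (i, j) =>
      ((0 < ccw i m) && (ccw i m < ccw i j))%N
  | inr _, inr _ => false
  end.

(* Two radii share the puncture: their tags there must agree if the underlying
   arcs differ; if the underlying arcs coincide, the two (plain) boundary ends
   already have the same tag. *)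
Definition tags_agree n (a b : tarc n) : bool :=
  match a, b with
  | inr (i, s), inr (j, t) => (i == j) || (s == t)
  | _, _ => true
  end.

Definition compatible n (a b : tarc n) : bool := ~~ cross a b && tags_agree a b.

Definition tagged_triangulation n (T : {set tarc n}) : bool :=
  maxset (fun S : {set tarc n} =>
    [forall a in S, is_tagged_arc a] &&
    [forall a in S, forall b in S, compatible a b]) T.

(** * Seeds and mutation

    Mutable directions are indexed by the left copy of ['I_n] and frozen ones by
    the right copy.  The arrows between frozen directions are carried along but
    play no role in mutation at the mutable ones. *)

Notation dir n := ('I_n + 'I_n)%type.

(* Rational functions in the variables of the initial cluster. *)
Notation ambient n := {fraction {mpoly int[n + n]}}.

Record seed (n : nat) := Seed {
  arc_of : dir n -> tarc n;
  exch : dir n -> dir n -> int;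
  var : dir n -> ambient n }.

Definition upd n (U : Type) (f : dir n -> U) (i : 'I_n) (u : U) : dir n -> U :=
  fun d => if d == inl i then u else f d.

Definition exch_mut n (b : dir n -> dir n -> int) (i : 'I_n) (c d : dir n) : int :=
  if (c == inl i) || (d == inl i) then - b c d
  else b c d + Num.max (b c (inl i)) 0 * Num.max (b (inl i) d) 0
             - Num.min (b c (inl i)) 0 * Num.min (b (inl i) d) 0.

(* [absz (Num.max z 0)] is the natural number [z]_+. *)
Definition var_mut n (S : seed n) (i : 'I_n) : ambient n :=
  (\prod_(d : dir n) var S d ^+ absz (Num.max (exch S d (inl i)) 0) +
   \prod_(d : dir n) var S d ^+ absz (Num.max (- exch S d (inl i)) 0))
  / var S (inl i).

Definition seed_arcs n (S : seed n) : {set tarc n} := [set arc_of S d | d : dir n].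

(** The initial tagged triangulation consists of the plain radii and the
    boundary arcs.  Its triangles are, for each [m], the ones with sides the
    boundary arc [m, m + 1] and the radii at [m] and [m + 1];
    [follows m c d] says that [d] follows [c] in clockwise order in this
    triangle, and [exch0] is the signed adjacency matrix. *)
Definition arc0 n (d : dir n) : tarc n :=
  match d with inl i => radius i false | inr i => chord i (ordS i) end.

Definition follows n (m : 'I_n) (c d : dir n) : bool :=
  [|| (c == inr m) && (d == inl m),
      (c == inl m) && (d == inl (ordS m))
    | (c == inl (ordS m)) && (d == inr m)].

Definition exch0 n (c d : dir n) : int :=
  \sum_(m < n) ((follows m c d)%:Z - (follows m d c)%:Z).

Definition var0 n (d : dir n) : ambient n :=
  tofrac 'X_(unsplit d).

(* The seeds of the cluster algebra of the once-punctured disk: those obtained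
   from the initial one by sequences of flips. *)
Inductive surface_seed n : seed n -> Prop :=
| surface_seed0 : surface_seed (Seed (@arc0 n) (@exch0 n) (@var0 n))
| surface_seed_flip (S : seed n) (i : 'I_n) (a : tarc n) :
    surface_seed S ->
    a != arc_of S (inl i) ->
    let S' := Seed (upd (arc_of S) i a) (exch_mut (exch S) i)
                   (upd (var S) i (var_mut S i)) in
    tagged_triangulation (seed_arcs S') ->
    surface_seed S'.

(** * The cluster algebra *)

Definition cluster_generator n (f : ambient n) : Prop :=
  exists2 S : seed n, surface_seed S &
    (exists d : dir n, f = var S d) \/ (exists i : 'I_n, f = (var S (inr i))^-1).

Definition in_cluster_algebra n (f : ambient n) : bool :=
  `[< forall R : {pred ambient n}, subring_closed R ->
        (forall g, cluster_generator g -> g \in R) -> f \in R >].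

Lemma in_cluster_algebra_subring n :
  subring_closed (in_cluster_algebra (n := n) : {pred ambient n}).
Proof.
split=> [|f g /asboolP Hf /asboolP Hg|f g /asboolP Hf /asboolP Hg];
  apply/asboolP=> R HR Hgen; have [R1 RB RM] := HR.
- exact: R1.
- by apply: RB; [apply: Hf | apply: Hg].
- by apply: RM; [apply: Hf | apply: Hg].
Qed.

HB.instance Definition _ n :=
  GRing.isSubringClosed.Build (ambient n) (@in_cluster_algebra n)
    (@in_cluster_algebra_subring n).

Record cluster_algebra (n : nat) := ClusterAlgebra {
  ca_val :> ambient n;
  _ : in_cluster_algebra ca_val }.

HB.instance Definition _ n := [isSub for @ca_val n].
HB.instance Definition _ n := [Choice of cluster_algebra n by <:].
HB.instance Definition _ n := [SubChoice_isSubComNzRing of cluster_algebra n by <:].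

(** * The space of points, with the Zariski topology *)

Definition points (n : nat) (k : fieldType) : Type :=
  {rmorphism cluster_algebra n -> k}.
HB.instance Definition _ n k := gen_eqMixin (points n k).
HB.instance Definition _ n k := gen_choiceMixin (points n k).

Definition pt_eval n (k : fieldType) (p : points n k) (a : cluster_algebra n) : k :=
  (p : {rmorphism cluster_algebra n -> k}) a.

(* Restrictions to the k-points of the elements of [k (x) A]. *)
Definition regular_function n (k : fieldType) : set (points n k -> k) :=
  [set f | exists s : seq (k * cluster_algebra n),
     forall p, f p = \sum_(ca <- s) ca.1 * pt_eval p ca.2].

Definition zariski_open n (k : fieldType) (U : set (points n k)) : Prop :=
  exists2 E : set (points n k -> k), E `<=` @regular_function n k &
    U = [set p | exists2 f, E f & f p != 0].

Lemma regular_functionM n k (f g : points n k -> k) :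
  regular_function f -> regular_function g ->
  regular_function (fun p => f p * g p).
Proof.
move=> [s Hs] [t Ht].
exists [seq (c.1 * d.1, c.2 * d.2) | c <- s, d <- t] => p.
rewrite Hs Ht big_allpairs_dep mulr_suml; apply: eq_bigr => c _.
rewrite mulr_sumr; apply: eq_bigr => d _ /=.
by rewrite /pt_eval rmorphM mulrACA.
Qed.

Lemma zariski_openT n k : zariski_open [set: points n k].
Proof.
exists [set fun=> 1]; last first.
  by apply/seteqP; split=> p // _; exists (fun=> 1) => //; exact: oner_neq0.
move=> _ ->; exists [:: (1, 1)] => p.
by rewrite big_seq1 /pt_eval /= rmorph1 mulr1.
Qed.

Lemma zariski_openI n k (U W : set (points n k)) :
  zariski_open U -> zariski_open W -> zariski_open (U `&` W).
Proof.
move=> [E HE ->] [G HG ->].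
exists [set h | exists f g, [/\ E f, G g & h = fun p => f p * g p]].
  by move=> _ [f [g [Ef Gg ->]]]; apply: regular_functionM; [exact: HE|exact: HG].
apply/seteqP; split=> p /=.
  move=> [[f Ef fp] [g Gg gp]]; exists (fun p => f p * g p); last by rewrite mulf_neq0.
  by exists f, g.
move=> [_ [f [g [Ef Gg ->]]]]; rewrite mulf_eq0 negb_or => /andP[fp gp].
by split; [exists f | exists g].
Qed.

Lemma zariski_openU n k (I : Type) (U : I -> set (points n k)) :
  (forall i, zariski_open (U i)) -> zariski_open (\bigcup_i U i).
Proof.
move=> HU.
exists [set f | @regular_function n k f /\
                exists i, forall p, f p != 0 -> U i p]; first by move=> f [].
apply/seteqP; split=> p /=.
  move=> [i _]; case: (HU i) => E HE Ui; rewrite Ui => -[f Ef fp].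
  exists f => //; split; first exact: HE.
  by exists i => q fq; rewrite Ui; exists f.
by move=> [f [_ [i Hi]] fp]; exists i => //; exact: Hi.
Qed.

HB.instance Definition _ n k :=
  isOpenTopological.Build (points n k)
    (@zariski_openT n k) (@zariski_openI n k) (@zariski_openU n k).

(* A point is deep if it kills some element of every cluster. *)
Definition deep_locus (n : nat) (k : fieldType) : set (points n k) :=
  [set p | forall S : seed n, surface_seed S ->
     exists (d : dir n) (x : cluster_algebra n), ca_val x = var S d /\ pt_eval p x = 0].

(** * Irreducibility, components and dimension *)

Definition irreducible_set (T : topologicalType) (X : set T) : Prop :=
  X !=set0 /\
  forall F G : set T, closed F -> closed G -> X `<=` F `|` G -> X `<=` F \/ X `<=` G.

Definition irreducible_component (T : topologicalType) (X C : set T) : Prop :=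
  [/\ C `<=` X, irreducible_set C &
      forall Z, Z `<=` X -> irreducible_set Z -> C `<=` Z -> Z = C].

Definition irreducible_chain (T : topologicalType) (X : set T) (d : nat) : Prop :=
  exists Z : 'I_d.+1 -> set T,
    (forall i, [/\ Z i `<=` X, irreducible_set (Z i) & closure (Z i) `&` X `<=` Z i]) /\
    (forall i j : 'I_d.+1, (i < j)%N -> Z i `<` Z j).

(* [X], with the induced topology, has Krull dimension [d]. *)
Definition has_dimension (T : topologicalType) (X : set T) (d : nat) : Prop :=
  irreducible_chain X d /\ ~ irreducible_chain X d.+1.

Definition locally_closed (T : topologicalType) (X : set T) : Prop :=
  exists U F : set T, [/\ open U, closed F & X = U `&` F].

(** * Isomorphisms of quasi-affine varieties

    An affine space of points [P] comes with the set [O] of its global regular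
    functions; a function is regular on a subset [X] if it is, locally on [X],
    a quotient of elements of [O]. *)

Definition regular_on (k : fieldType) (P : Type) (O : set (P -> k)) (X : set P)
    (f : P -> k) : Prop :=
  forall p, X p -> exists g h : P -> k,
    [/\ O g, O h, h p != 0 & forall q, X q -> h q != 0 -> f q = g q / h q].

Definition morphism_on (k : fieldType) (P Q : Type)
    (OP : set (P -> k)) (X : set P) (OQ : set (Q -> k)) (Y : set Q)
    (phi : P -> Q) : Prop :=
  (forall p, X p -> Y (phi p)) /\
  (forall f, OQ f -> regular_on OP X (fun p => f (phi p))).

Definition isomorphic_on (k : fieldType) (P Q : Type)
    (OP : set (P -> k)) (X : set P) (OQ : set (Q -> k)) (Y : set Q) : Prop :=
  exists (phi : P -> Q) (psi : Q -> P),
    [/\ morphism_on OP X OQ Y phi, morphism_on OQ Y OP X psi,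
        (forall p, X p -> psi (phi p) = p) & (forall q, Y q -> phi (psi q) = q)].

Definition polynomial_function (m : nat) (k : fieldType) : set (('I_m -> k) -> k) :=
  [set f | exists P : {mpoly k[m]}, forall t, f t = P.@[t]].

Definition torus (m : nat) (k : fieldType) : set ('I_m -> k) :=
  [set t | forall i, t i != 0].

(* The subset [X] of the variety of points is isomorphic to the m-th power of the
   multiplicative group of k. *)
Definition is_torus n (k : fieldType) (X : set (points n k)) (m : nat) : Prop :=
  locally_closed X /\
  isomorphic_on (@regular_function n k) X (@polynomial_function m k) (@torus m k).

(* Main.v *)
(* The cluster variables are lambda lengths: with [x i] the length of the plain radius
   at [i] and [D] the total horocyclic length at the puncture, the notched radius has
   length [x i * D], and the chord [(i, j)] has length [x i * x j] times the part of [D]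
   between [i] and [j]. All exchange relations are then Ptolemy relations in
   quadrilaterals and once-punctured digons, and a point is deep iff it vanishes on some
   arc of every tagged triangulation.

   Completing nonzero arcs to triangulations shows that at a deep point the radii of one
   of the two tags vanish; the chords are then determinants of [n] vectors in the plane.
   Either all radii vanish, which leaves the vectors free, up to SL_2, with nonzero
   consecutive determinants: dimension [2 n - 3].
   Or the nonzero radii are those of one tag at the vertices of one parity; then [n] is
   even, the chords [(i, i + 2)] vanish, the vectors alternate between two lines, and
   the only parameters are [n - 1] boundary chords and one scale for the radii. The two
   tags and two parities give the four tori, and the scale vanishes exactly where their
   closures meet the first component.

   Dimensions are computed on dense torus charts: a chain of [d + 1] irreducible closed
   subsets yields [d] algebraically independent regular functions, and counting
   monomials among Laurent polynomials in [N] variables forces [d <= N]. *)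

(* Cluster variables are given only through sequences of mutations, so the lambda lengths have to be
   identified on every seed; the invariant [seed_ok] does this and records that the exchange matrix
   is a sum over triangles. Reading the loop at a vertex as the sum of the two tagged radii there,
   and the puncture as a vertex beyond a full turn, leaves only two kinds of exchange: in a
   quadrilateral with possibly degenerate vertices, and in a once-punctured digon. Lambda lengths
   divide by the radii, while the points of interest have vanishing radii. Such points are produced
   by adding an indeterminate [X] to the radii, evaluating in rational functions of [X], and setting
   [X = 0]. Zeros of a deep point are forced by exhibiting triangulations on which it would not
   vanish: a region can be triangulated by nonzero chords once its long side is nonzero and some
   third vertex is joined to both of its ends by nonzero chords. The field is taken infinite so that
   a nonzero polynomial on a line has a non-root; irreducibility and closures are obtained from
   this. *)
Require Import Defs.
From HB Require Import structures.
From mathcomp Require Import all_boot all_order all_algebra.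
From mathcomp Require Import fraction mpoly.
From mathcomp Require Import zify ring lra.

Set Implicit Arguments.
Unset Strict Implicit.
Unset Printing Implicit Defensive.

(** * Crossings and regions *)

Section Combinatorics.
Variable n : nat.
Implicit Types (i j k l m : 'I_n) (T : {set tarc n}).

(* Instances of [inE] that match the way [{set tarc n}] is elaborated. *)
Lemma in_arcsU (a : tarc n) (A B : {set tarc n}) :
  (a \in A :|: B) = (a \in A) || (a \in B).
Proof. exact: in_setU. Qed.

Lemma in_arcs1 (a b : tarc n) : (a \in [set b]) = (a == b).
Proof. exact: in_set1. Qed.

Lemma in_arcsD (a : tarc n) (A B : {set tarc n}) :
  (a \in A :\: B) = (a \notin B) && (a \in A).
Proof. exact: in_setD. Qed.

Notation tarcs := (Defs_tarc__canonical__fintype_Finite n).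
Definition in_arcs := (in_arcsU, in_arcs1, in_arcsD,
  @in_setU tarcs, @in_set1 tarcs, @in_setD tarcs).

Lemma ccw_lt i j : ccw i j < n.
Proof. by rewrite ltn_mod; case: i => i /=; case: n. Qed.

Lemma ccwE i j : ccw i j = if i <= j then j - i else j + n - i.
Proof.
rewrite /ccw; case: leqP => ij; last by rewrite modn_small //; have := ltn_ord i; lia.
have -> : j + n - i = j - i + n by lia.
by rewrite modnDr modn_small //; have := ltn_ord j; lia.
Qed.

Lemma ccwii i : ccw i i = 0.
Proof. by rewrite ccwE leqnn subnn. Qed.

Lemma ccwP o i j : ccw o i < n /\ ccw o j < n /\
  (ccw o i <= ccw o j /\ ccw i j + ccw o i = ccw o j \/
   ccw o j < ccw o i /\ ccw i j + ccw o i = ccw o j + n).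
Proof.
split; [|split]; [exact: ccw_lt..|].
have hi := ltn_ord i; have hj := ltn_ord j; have ho := ltn_ord o; rewrite !ccwE.
by case: (leqP i j) => ?; case: (leqP o i) => ?; case: (leqP o j) => ?; lia.
Qed.

Lemma eq_ccw o i j : (i == j) = (ccw o i == ccw o j).
Proof.
apply/eqP/eqP => [-> //|].
have hi := ltn_ord i; have hj := ltn_ord j; have ho := ltn_ord o; rewrite !ccwE.
by case: (leqP o i) => ?; case: (leqP o j) => ? ?; apply: val_inj => /=; lia.
Qed.

Lemma ordS_ccw i j : 1 < n -> (j == ordS i) = (ccw i j == 1).
Proof.
move=> n1; rewrite -val_eqE /= ccwE; have hi := ltn_ord i; have hj := ltn_ord j.
case: (ltnP i.+1 n) => h; first by rewrite modn_small //; case: (leqP i j) => ?; lia.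
have -> : i.+1 = n by lia.
by rewrite modnn; case: (leqP i j) => ?; lia.
Qed.

Lemma ccw_ordS i : 1 < n -> ccw i (ordS i) = 1.
Proof. by move=> n1; apply/eqP; rewrite -ordS_ccw. Qed.

Lemma cross_sym (a b : tarc n) : cross a b = cross b a.
Proof. by case: a b => [[i j]|[i s]] [[k l]|[k t]] //=; rewrite orbC. Qed.

Lemma tags_agree_sym (a b : tarc n) : tags_agree a b = tags_agree b a.
Proof.
by case: a b => [[i j]|[i s]] [[k l]|[k t]] //=; rewrite (eq_sym k) (eq_sym t).
Qed.

Lemma compatible_sym (a b : tarc n) : compatible a b = compatible b a.
Proof. by rewrite /compatible cross_sym tags_agree_sym. Qed.

Lemma compatible_refl (a : tarc n) : compatible a a.
Proof.
by case: a => [[i j]|[i s]] //=; rewrite /compatible /= /overtakes ?ccwii ?eqxx //.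
Qed.

(* The pair [(i, i)] stands for the loop at [i], which is represented in a
   tagged triangulation by the two tagged versions of the radius at [i]. *)
Definition endpoint : Type := ('I_n + bool)%type.

Definition arc_to i (Q : endpoint) : tarc n :=
  match Q with inl j => chord i j | inr s => radius i s end.

(** Position of [Q] on a counterclockwise walk from [i]: the return to [i] is a full turn [n], and
    the puncture is put beyond it at [n.+1]. Thus [ccw i j < height i Q] treats vertices, loops and
    the puncture at once. *)
Definition height i (Q : endpoint) : nat :=
  match Q with inl j => if j == i then n else ccw i j | inr _ => n.+1 end.

Definition supp (a : tarc n) : {set tarc n} :=
  match a with
  | inl (i, j) => if i == j then [set radius i true; radius i false] else [set a]
  | inr _ => [set a]
  end.

Definition compatible_with (e a : tarc n) : bool :=
  [forall b in supp a, compatible e b].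

Lemma compatible_withE e a : compatible_with e a =
  match a with
  | inl (i, j) => if i == j
      then compatible e (radius i true) && compatible e (radius i false)
      else compatible e a
  | inr _ => compatible e a
  end.
Proof.
have H1 (b : tarc n) : [forall c in [set b], compatible e c] = compatible e b.
  apply/forall_inP/idP => [H|H c /set1P-> //]; exact/H/set11.
case: a => [[i j]|[i s]]; rewrite /compatible_with /supp //.
case: ifP => // _; apply/forall_inP/andP => [H|[H H' c /set2P[]->//]].
by split; apply: H; rewrite !in_arcs eqxx ?orbT.
Qed.

Lemma chord_eq o i j k l : (chord i j == chord k l) =
  (ccw o i == ccw o k) && (ccw o j == ccw o l).
Proof. by rewrite /chord -!eq_ccw. Qed.

Lemma radius_eq o i s k t : (radius i s == radius k t) =
  (ccw o i == ccw o k) && (s == t).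
Proof. by rewrite /radius -!eq_ccw. Qed.

(* The crossing relation for lifts of chords to the universal cover. *)
Definition interleave (a b x y : nat) : bool :=
  (a < x) && (x < b) && (b < y) || (x < a) && (a < y) && (y < b).

(** For [0 <= a < n], [b < a + n] and [0 <= x < y <= n], no translate other than those by 0 and [n]
    can interleave. *)
Definition crosses_lift (a b x y : nat) : bool :=
  interleave a b x y || interleave a b (x + n) (y + n).

Definition crosses_ray (a b x : nat) : bool :=
  (a < x < b) || (a < x + n < b).

Lemma cross_liftE o k l i j : ccw o i + ccw i j <= n ->
  cross (chord k l) (chord i j) =
  crosses_lift (ccw o k) (ccw o k + ccw k l) (ccw o i) (ccw o i + ccw i j).
Proof.
move=> le_n; rewrite /= /overtakes /crosses_lift /interleave.
have [h1 [h2 h3]] := ccwP o k i; have [_ [_ h4]] := ccwP o i k.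
have h5 := ccw_lt k l; have h6 := ccw_lt i j.
move: (ccw o i) (ccw o k) (ccw k l) (ccw i j) (ccw k i) (ccw i k) h1 h2 h3 h4 h5 h6 le_n.
by move=> x a b y ki ik h1 h2 [[]|[]] h3 h3' [[]|[]] *; lia.
Qed.

Lemma cross_rayE o k l i s :
  cross (chord k l) (radius i s) =
  crosses_ray (ccw o k) (ccw o k + ccw k l) (ccw o i).
Proof.
rewrite /= /crosses_ray; have [h1 [h2 h3]] := ccwP o k i.
have h5 := ccw_lt k l; lia.
Qed.

Lemma cross_chord_radiusE o k l i s : ccw o k + ccw k l <= n ->
  cross (chord k l) (radius i s) =
  (ccw o k < ccw o i) && (ccw o i < ccw o k + ccw k l).
Proof.
move=> le_n; rewrite /=.
have [h1 [h2 h3]] := ccwP o k i.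
have h5 := ccw_lt k l; lia.
Qed.

(** A chord that enters a quadrilateral without crossing a side does so at a vertex, and hence runs
    along a diagonal. *)
Lemma interleave_quad a b x y z t : x < y -> y < z -> z < t -> a < b ->
  ~~ interleave a b x y -> ~~ interleave a b y z -> ~~ interleave a b z t ->
  ~~ interleave a b x t -> interleave a b x z || interleave a b y t ->
  (a == x) && (b == z) || (a == y) && (b == t).
Proof. rewrite /interleave; lia. Qed.

(** The analogue with the puncture as fourth vertex: the two sides and the diagonal through it are
    rays, for which betweenness replaces interleaving. *)
Lemma interleave_star a b x y z : x < y -> y < z -> a < b ->
  ~~ interleave a b x y -> ~~ interleave a b y z -> ~~ ((a < x) && (x < b)) ->
  ~~ ((a < z) && (z < b)) -> interleave a b x z || (a < y) && (y < b) ->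
  (a == x) && (b == z).
Proof. rewrite /interleave; lia. Qed.

Lemma ccw_gt0 i j : (0 < ccw i j) = (i != j).
Proof. by rewrite lt0n (eq_ccw i i j) ccwii eq_sym. Qed.

Lemma ccwD i m j : ccw i m <= ccw i j -> ccw m j = ccw i j - ccw i m.
Proof. by have := ccwP i m j; lia. Qed.

Lemma height_loop i : height i (inl i) = n.
Proof. by rewrite /= eqxx. Qed.

Lemma height_le i q : height i (inl q) <= n.
Proof. by rewrite /=; case: eqP => // _; apply/ltnW/ccw_lt. Qed.

Lemma compatible_chord_chord (k l i j : 'I_n) :
  compatible (chord k l) (chord i j) = ~~ cross (chord k l) (chord i j).
Proof. by rewrite /compatible /= andbT. Qed.

Lemma compatible_chord_radius (k l i : 'I_n) s :
  compatible (chord k l) (radius i s) = ~~ cross (chord k l) (radius i s).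
Proof. by rewrite /compatible /= andbT. Qed.

Lemma compatible_radius_chord (k l i : 'I_n) s :
  compatible (radius i s) (chord k l) = ~~ cross (chord k l) (radius i s).
Proof. by rewrite /compatible /= andbT. Qed.

Lemma crosses_lift_quad a b y z t :
  0 < y -> y < z -> z < t -> a < n -> a < b ->
  ~~ crosses_lift a b 0 y -> ~~ crosses_lift a b y z -> ~~ crosses_lift a b z t ->
  ~~ crosses_lift a b 0 t -> ~~ ((a == 0) && (b == z)) ->
  ~~ ((a == y) && (b == t)) ->
  ~~ crosses_lift a b 0 z /\ ~~ crosses_lift a b y t.
Proof.
rewrite /crosses_lift => y0 yz zt an ab.
move=> /norP[A1 B1] /norP[A2 B2] /norP[A3 B3] /norP[A4 B4] C D.
have EA := interleave_quad y0 yz zt ab A1 A2 A3 A4.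
have EB : interleave a b (0 + n) (z + n) || interleave a b (y + n) (t + n) ->
    (a == 0 + n) && (b == z + n) || (a == y + n) && (b == t + n).
  by apply: interleave_quad => //; rewrite ltn_add2r.
clear A1 A2 A3 A4 B1 B2 B3 B4.
(* A diagonal of the translated quadrilateral starts at [n] or later, whereas [a < n]. *)
have {}EB : ~~ (interleave a b (0 + n) (z + n) || interleave a b (y + n) (t + n)).
  by apply/negP => /EB; clear -an; lia.
have {}EA : ~~ (interleave a b 0 z || interleave a b y t).
  by apply/negP => /EA; rewrite (negbTE C) (negbTE D).
by case/norP: EA EB => EA1 EA2 /norP[EB1 EB2]; split; apply/norP.
Qed.

Lemma crosses_lift_star a b y z :
  0 < y -> y < z -> a < n -> a < b ->
  ~~ crosses_lift a b 0 y -> ~~ crosses_lift a b y z -> ~~ crosses_ray a b z ->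
  ~~ crosses_ray a b 0 -> ~~ ((a == 0) && (b == z)) ->
  ~~ crosses_lift a b 0 z /\ ~~ crosses_ray a b y.
Proof.
rewrite /crosses_lift /crosses_ray => y0 yz an ab.
move=> /norP[A1 B1] /norP[A2 B2] /norP[A3 B3] /norP[A4 B4] C.
have EA := interleave_star y0 yz ab A1 A2 A4 A3.
have EB : interleave a b (0 + n) (z + n) || (a < y + n < b) ->
    (a == 0 + n) && (b == z + n).
  by apply: (@interleave_star a b _ (y + n)); rewrite ?ltn_add2r.
clear A1 A2 A3 A4 B1 B2 B3 B4.
have {}EB : ~~ (interleave a b (0 + n) (z + n) || (a < y + n < b)).
  by apply/negP => /EB; clear -an; lia.
have {}EA : ~~ (interleave a b 0 z || (a < y < b)).
  by apply/negP => /EA; rewrite (negbTE C).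
by case/norP: EA EB => EA1 EA2 /norP[EB1 EB2]; split; apply/norP.
Qed.

(** The loop at the base vertex lifts to a whole turn. Crossing it amounts to enclosing the base
    vertex, that is, to crossing the radii which the loop stands for. *)
Lemma crosses_lift_loop a b : a < n -> b < a + n ->
  crosses_lift a b 0 n = crosses_ray a b 0.
Proof. by rewrite /crosses_lift /crosses_ray /interleave; lia. Qed.

Lemma ccw_add i j k : ccw i j <= ccw i k -> ccw i j + ccw j k = ccw i k.
Proof. by move=> /[dup] h /ccwD ->; lia. Qed.

Lemma ccw_add_back i j : i != j -> ccw i j + ccw j i = n.
Proof. by rewrite -ccw_gt0; have := ccwP i j i; rewrite ccwii; lia. Qed.

(** When [Q] is [i] itself, its end is placed at the full turn [n]; this covers both the chord from
    [j] back to [i] and, for [j = i], the loop. *)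
Lemma compatible_with_lift i j Q k l : ccw i j < height i Q -> k != l ->
  compatible_with (chord k l) (arc_to j Q) =
  match Q with
  | inl q => ~~ crosses_lift (ccw i k) (ccw i k + ccw k l) (ccw i j) (height i Q)
  | inr s => ~~ crosses_ray (ccw i k) (ccw i k + ccw k l) (ccw i j)
  end.
Proof.
rewrite compatible_withE; case: Q => [q|s] /= ltjQ kl.
- have [qi|qi] := eqVneq q i.
  + subst q; have [ji|ji] := eqVneq j i.
      subst j; rewrite !compatible_chord_radius !(cross_rayE i) andbb ccwii.
      rewrite crosses_lift_loop //; first exact: ccw_lt.
      by rewrite ltn_add2l; apply: ccw_lt.
    have E : ccw i j + ccw j i = n by rewrite ccw_add_back // eq_sym.
    by rewrite compatible_chord_chord (cross_liftE (o := i)) E.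
  + rewrite (negbTE qi) in ltjQ; have -> : (j == q) = false.
      by rewrite (eq_ccw i); lia.
    have E : ccw i j + ccw j q = ccw i q by apply/ccw_add/ltnW.
    by rewrite compatible_chord_chord (cross_liftE (o := i)) E // ltnW // ccw_lt.
- by rewrite compatible_chord_radius (cross_rayE i).
Qed.

Lemma compatible_withN (e : tarc n) i j : i != j ->
  compatible_with e (chord i j) = compatible e (chord i j).
Proof. by move=> ij; rewrite compatible_withE /= (negbTE ij). Qed.

Lemma height_chord i j : i != j -> height i (inl j) = ccw i j.
Proof. by rewrite /= eq_sym => /negbTE ->. Qed.

Lemma quad_compatible_chord i m j Q k l :
  0 < ccw i m -> ccw i m < ccw i j -> ccw i j < height i Q -> k != l ->
  compatible_with (chord k l) (chord i m) -> compatible_with (chord k l) (chord m j) ->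
  compatible_with (chord k l) (arc_to j Q) -> compatible_with (chord k l) (arc_to i Q) ->
  chord k l != chord i j -> chord k l != arc_to m Q ->
  compatible (chord k l) (chord i j) /\ compatible_with (chord k l) (arc_to m Q).
Proof.
move=> h1 h2 h3 kl.
have im : i != m by rewrite -ccw_gt0.
have ij : i != j by rewrite -ccw_gt0; lia.
have mj : m != j by rewrite (eq_ccw i); lia.
have himE := height_chord im; have hijE := height_chord ij.
rewrite (@compatible_with_lift i i (inl m)) ?himE ?ccwii //.
rewrite (@compatible_with_lift i m (inl j)) ?hijE //.
rewrite (compatible_with_lift h3 kl) (@compatible_with_lift i i Q) ?ccwii //; last by lia.
rewrite (@compatible_with_lift i m Q) //; last by lia.
rewrite -(compatible_withN _ ij) (@compatible_with_lift i i (inl j)) ?hijE ?ccwii //; last by lia.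
have ab : ccw i k < ccw i k + ccw k l by rewrite -ccw_gt0 in kl; lia.
have an := ccw_lt i k; have kln := ccw_lt k l.
rewrite [chord k l == chord i j](chord_eq i) ccwii.
have N1 : ~~ ((ccw i k == 0) && (ccw i l == ccw i j)) ->
   ~~ ((ccw i k == 0) && (ccw i k + ccw k l == ccw i j)).
  by move: (ccwP i k l) (ccw_lt i j); clear; lia.
case: Q h3 => [q|s] h3 A B C D /N1 E F.
- apply: crosses_lift_quad => //; apply: contra F => /andP[/eqP ekm /eqP elq].
  apply/eqP; have -> : k = m by apply/eqP; rewrite (eq_ccw i); apply/eqP.
  congr chord; apply/eqP; rewrite (eq_ccw i).
  move: elq (ccwP i k l) (ccw_lt i q) (ccwii i) => /=.
  by case: eqP => [->|_]; clear; lia.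
- exact: crosses_lift_star.
Qed.

Lemma compatible_with_radius i j Q k t : ccw i j < height i Q ->
  compatible_with (radius k t) (arc_to j Q) =
  match Q with
  | inl q => ~~ (ccw i j < ccw i k < height i Q)
  | inr s => (k == j) || (t == s)
  end.
Proof.
rewrite compatible_withE; case: Q => [q|s] //= ltjQ.
have [qi|qi] := eqVneq q i.
  subst q; have [ji|ji] := eqVneq j i.
    subst j; rewrite ccwii ccw_lt andbT ccw_gt0 /compatible /=.
    by case: t; rewrite eq_sym ?orbT ?orbF ?andbT negbK.
  rewrite compatible_radius_chord (cross_chord_radiusE (o := i)) ccw_add_back 1?eq_sym //.
rewrite (negbTE qi) in ltjQ; have -> : (j == q) = false.
  by rewrite (eq_ccw i); lia.
have E : ccw i j + ccw j q = ccw i q by apply/ccw_add/ltnW.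
rewrite compatible_radius_chord (cross_chord_radiusE (o := i)) E //.
exact/ltnW/ccw_lt.
Qed.

Lemma quad_compatible_radius i m j Q k t :
  0 < ccw i m -> ccw i m < ccw i j -> ccw i j < height i Q ->
  compatible_with (radius k t) (chord i m) -> compatible_with (radius k t) (chord m j) ->
  compatible_with (radius k t) (arc_to j Q) ->
  compatible_with (radius k t) (arc_to i Q) ->
  radius k t != arc_to m Q ->
  compatible (radius k t) (chord i j) /\ compatible_with (radius k t) (arc_to m Q).
Proof.
move=> h1 h2 h3.
have im : i != m by rewrite -ccw_gt0.
have ij : i != j by rewrite -ccw_gt0; lia.
have himE := height_chord im; have hijE := height_chord ij.
rewrite (@compatible_with_radius i i (inl m)) ?himE ?ccwii //.
rewrite (@compatible_with_radius i m (inl j)) ?hijE //.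
rewrite (@compatible_with_radius i j Q) // (@compatible_with_radius i i Q) ?ccwii //; last by lia.
rewrite (@compatible_with_radius i m Q) //; last by lia.
rewrite -(compatible_withN _ ij) (@compatible_with_radius i i (inl j)) ?hijE ?ccwii //; last by lia.
case: Q h3 => [q|s]; rewrite /arc_to.
  by move: (height i (inl q)) => h h3 A B C D _; move: A B C D; clear -h1 h2 h3; lia.
rewrite [radius k t == _](radius_eq i) !(eq_ccw i) ccwii => _.
have := ccw_lt i k; clear -h1 h2.
case: eqP => [->|/eqP kj] /=; case: (eqVneq t s) => //= _; rewrite ?andbT ?orbF; lia.
Qed.

Lemma arc_to_tagged i m Q : i != m -> ccw i m < height i Q -> is_tagged_arc (arc_to m Q).
Proof.
case: Q => [q|s] //= im; have [-> _|_ h] := eqVneq q i; first by rewrite eq_sym.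
by rewrite (eq_ccw i); lia.
Qed.

Lemma supp_tagged a : is_tagged_arc a -> supp a = [set a].
Proof. by case: a => [[i j]|[i s]] //= /negbTE ->. Qed.

Lemma compatible_with_tagged e a : is_tagged_arc a -> compatible_with e a = compatible e a.
Proof. by case: a => [[i j]|[i s]]; rewrite compatible_withE //= => /negbTE ->. Qed.

Definition quad_core i m j Q : {set tarc n} :=
  supp (chord i m) :|: supp (chord m j) :|: supp (arc_to j Q) :|: supp (arc_to i Q).

Definition digon_core i j s : {set tarc n} := [set chord i j; chord j i; radius j s].

(** The local data of a flip: among the tagged arcs compatible with all of [core], only [a] and [b]
    can conflict with [a] or [b]. Existence and uniqueness of the flip in any triangulation
    containing [core] follow from this alone. *)
Record flip_region (core : {set tarc n}) (a b : tarc n) : Prop := FlipRegion {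
  flip_tagged1 : is_tagged_arc a;
  flip_tagged2 : is_tagged_arc b;
  flip_cross : ~~ compatible a b;
  flip_notin1 : a \notin core;
  flip_notin2 : b \notin core;
  flip_region_compat : forall e, is_tagged_arc e ->
    (forall c, c \in core -> compatible e c) -> e != a -> e != b ->
    compatible e a && compatible e b }.

Lemma compatible_with_sub e a (core : {set tarc n}) : supp a \subset core ->
  (forall c, c \in core -> compatible e c) -> compatible_with e a.
Proof. by move=> /subsetP sub H; apply/forall_inP => c /sub/H. Qed.

Lemma quad_diag_cross i m j Q :
  0 < ccw i m -> ccw i m < ccw i j -> ccw i j < height i Q ->
  ~~ compatible (chord i j) (arc_to m Q).
Proof.
move=> h1 h2 h3; have jn := ccw_lt i j.
have im : i != m by rewrite -ccw_gt0.
have ij : i != j by rewrite -ccw_gt0; lia.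
rewrite -compatible_with_tagged; last by apply: (@arc_to_tagged i) => //; lia.
rewrite (@compatible_with_lift i) //; last by lia.
rewrite ccwii add0n; case: Q h3 => [q|s] h3; apply/negPn.
  by rewrite /crosses_lift /interleave h1 h2 h3.
by rewrite /crosses_ray h1 h2.
Qed.

Lemma quad_region i m j Q :
  0 < ccw i m -> ccw i m < ccw i j -> ccw i j < height i Q ->
  flip_region (quad_core i m j Q) (chord i j) (arc_to m Q).
Proof.
move=> h1 h2 h3.
have im : i != m by rewrite -ccw_gt0.
have ij : i != j by rewrite -ccw_gt0; lia.
have mj : m != j by rewrite (eq_ccw i); lia.
have bt : is_tagged_arc (arc_to m Q) by apply: (@arc_to_tagged i) => //; lia.
split=> //.
- exact: quad_diag_cross.
- have ct : is_tagged_arc (arc_to j Q) by apply: (@arc_to_tagged i).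
  rewrite /quad_core (supp_tagged ct) (@supp_tagged (chord i m)) //.
  rewrite (@supp_tagged (chord m j)) // !in_arcs !negb_or.
  rewrite !(chord_eq i) ccwii /=.
  have -> : (ccw i j == ccw i m) = false by lia.
  have -> : (0 == ccw i m) = false by lia.
  case: Q h3 {bt ct} => [q|s] h3 //=; rewrite ?in_arcs.
    rewrite (chord_eq i) ccwii; have [qi|qi] := eqVneq i q; rewrite !in_arcs.
      by rewrite /chord /radius /=; lia.
    rewrite (chord_eq i) ccwii /=; move: h3; rewrite /= (eq_sym q) (negbTE qi).
    by have := ccw_lt i q; lia.
  by rewrite /chord /radius.
- have ct : is_tagged_arc (arc_to j Q) by apply: (@arc_to_tagged i).
  rewrite /quad_core (supp_tagged ct) (@supp_tagged (chord i m)) //.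
  rewrite (@supp_tagged (chord m j)) // !in_arcs !negb_or.
  have mi0 : (m == i) = false by rewrite eq_sym; apply/negbTE.
  case: Q h3 {bt ct} => [q|s] h3 //=; last first.
    rewrite !in_arcs !(radius_eq m) eqxx !andbT -!(eq_ccw m) (negbTE mj) mi0.
    by rewrite /chord /radius.
  have qj : q != j by apply: contraTneq h3 => ->; rewrite (height_chord ij) ltnn.
  rewrite !(chord_eq m) -!(eq_ccw m) mi0 (negbTE mj) (negbTE qj) /= andbF /=.
  case: ifP => _; rewrite ?in_arcs; first by rewrite /chord /radius.
  by rewrite !(chord_eq m) -!(eq_ccw m) mi0.
- move=> e te H ea eb.
  have S x : supp x \subset quad_core i m j Q -> compatible_with e x.
    by move/compatible_with_sub; exact.
  have A : compatible_with e (chord i m) by apply: S; rewrite /quad_core -!setUA subsetUl.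
  have B : compatible_with e (chord m j).
    by apply: S; rewrite /quad_core -!setUA; apply/subsetU/orP; right; rewrite subsetUl.
  have C : compatible_with e (arc_to j Q).
    by apply: S; rewrite /quad_core; apply/subsetU/orP; left; rewrite subsetUr.
  have D : compatible_with e (arc_to i Q) by apply: S; rewrite /quad_core subsetUr.
  rewrite -[compatible e (arc_to m Q)]compatible_with_tagged //; apply/andP.
  case: e te ea eb A B C D {H S} => [[k l]|[k t]] te ea eb *.
    exact: quad_compatible_chord.
  exact: quad_compatible_radius.
Qed.

Lemma flip_region_sym core a b : flip_region core a b -> flip_region core b a.
Proof.
case=> ta tb ab aC bC reg; split=> //; first by rewrite compatible_sym.
by move=> e te H ea eb; rewrite andbC reg.
Qed.

(** Cut along the radius at [j] with tag [s], the digon leaves room for exactly two further tagged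
    arcs: the radius at [i] with the same tag and the radius at [j] with the other tag. *)
Lemma digon_region i j s : i != j ->
  flip_region (digon_core i j s) (radius i s) (radius j (~~ s)).
Proof.
move=> ij; have ji : (j == i) = false by rewrite eq_sym; apply/negbTE.
split=> //.
- by rewrite /compatible /= (negbTE ij) /=; case: s.
- by rewrite /digon_core !in_arcs negb_or (radius_eq i) ccwii; move: ij; rewrite (eq_ccw i) ccwii => /negbTE ->.
- by rewrite /digon_core !in_arcs negb_or (radius_eq i) eqxx; case: (s).
- move=> e te H ea eb.
  have {}H : [/\ compatible e (chord i j), compatible e (chord j i) & compatible e (radius j s)].
    by split; apply: H; rewrite /digon_core !in_arcs eqxx ?orbT.
  case: e te ea eb H => [[k l]|[k t]] te ea eb [A B C].
    move: A B C; rewrite !compatible_chord_chord !compatible_chord_radius.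
    rewrite (cross_liftE (o := i)) ?ccwii ?add0n; last exact/ltnW/ccw_lt.
    have E : ccw i j + ccw j i = n by rewrite ccw_add_back.
    rewrite (cross_liftE (o := i)) E // !(cross_rayE i).
    have := ccw_lt i k; have := ccw_lt i j; move: te; rewrite /= -ccw_gt0.
    move: ij; rewrite -ccw_gt0 ccwii; have := ccw_lt k l; clear.
    by rewrite /crosses_lift /crosses_ray /interleave; lia.
  move: A B C ea eb; rewrite !compatible_radius_chord /compatible /=.
  rewrite !(radius_eq i) !(eq_ccw i) ccwii.
  have := ccwP i j k; have := ccw_add_back ij.
  move: ij; rewrite (eq_ccw i) ccwii.
  have -> : (t == ~~ s) = ~~ (t == s) by case: (t) (s) => [] [].
  by have := ccw_lt j k; have := ccw_lt j i; clear; lia.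
Qed.

End Combinatorics.

(** * Triangulations and flips *)

Section Triangulations.
Variable n : nat.
Implicit Types (i j k l m : 'I_n) (T : {set tarc n}).

Lemma triangulationP T : tagged_triangulation T <->
  [/\ forall a, a \in T -> is_tagged_arc a,
      forall a b, a \in T -> b \in T -> compatible a b &
      forall e, is_tagged_arc e -> (forall a, a \in T -> compatible e a) -> e \in T].
Proof.
split=> [/maxsetP[/andP[/forall_inP tag /forall_inP comp] max]|[tag comp max]].
  have cc a b : a \in T -> b \in T -> compatible a b by move/comp/forall_inP; apply.
  split=> // e te ce; apply: contraT => eT.
  have E : e |: T = T; last by move: eT; rewrite -E setU11.
  apply: max; last exact: subsetU1.
  apply/andP; split; first by apply/forall_inP => a /setU1P[->|/tag].
  apply/forall_inP => a /setU1P[->|aT]; apply/forall_inP => b /setU1P[->|bT].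
  - exact: compatible_refl.
  - exact: ce.
  - by rewrite compatible_sym; apply: ce.
  - exact: cc.
apply/maxsetP; split.
  apply/andP; split; first exact/forall_inP.
  by apply/forall_inP => a aT; apply/forall_inP => b; apply: comp.
move=> B /andP[/forall_inP tB /forall_inP cB] TB; apply/eqP; rewrite eqEsubset TB andbT.
apply/subsetP => e eB; apply: max; first exact: tB.
by move=> a aT; move/cB/forall_inP: eB; apply; apply: (subsetP TB).
Qed.

Lemma flip_exists (core : {set tarc n}) a b T : flip_region core a b ->
  tagged_triangulation T -> core \subset T -> a \in T ->
  tagged_triangulation (b |: (T :\ a)).
Proof.
case=> ta tb ab aC _ reg /triangulationP[tag comp max] /subsetP sub aT.
have bT : b \notin T by apply: contra ab => bT; apply: comp.
have cb e : e \in T -> e != a -> compatible e b.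
  move=> eT ea; have eb : e != b by apply: contraNneq bT => <-.
  have := reg e (tag _ eT) _ ea eb => /(_ _)/andP[]// c /sub cT; exact: comp.
apply/triangulationP; split.
- by move=> e /setU1P[->//|/setD1P[_ /tag]].
- move=> e f /setU1P[->|/setD1P[ea eT]] /setU1P[->|/setD1P[fa fT]].
  + exact: compatible_refl.
  + by rewrite compatible_sym cb.
  + exact: cb.
  + exact: comp.
- move=> e te ce; apply/setU1P; have [|eb] := eqVneq e b; first by left.
  right; have ea : e != a.
    by apply: contraNneq ab => <-; apply: ce; rewrite setU11.
  apply/setD1P; split=> //; apply: max => // f fT.
  have [->|fa] := eqVneq f a; last by apply: ce; apply/setU1P; right; apply/setD1P.
  have := reg e te _ ea eb => /(_ _)/andP[]// c cC.
  apply: ce; apply/setU1P; right; apply/setD1P; split; last exact: sub.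
  by apply: contraNneq aC => <-.
Qed.

(** An arc [c] other than [a] and [b] that fits into the region would be compatible with [a], and
    [a] could be added back, against maximality. *)
Lemma flip_unique (core : {set tarc n}) a b c T : flip_region core a b ->
  tagged_triangulation T -> core \subset T -> a \in T -> c != a ->
  tagged_triangulation (c |: (T :\ a)) -> c = b.
Proof.
case=> ta tb ab aC _ reg /triangulationP[tag comp max] /subsetP sub aT ca.
move=> /triangulationP[tag' comp' max']; apply/eqP; apply: contraNT ab => cb.
have inT' e : e \in T -> e != a -> e \in c |: (T :\ a).
  by move=> eT ea; apply/setU1P; right; apply/setD1P.
have cT' : c \in c |: (T :\ a) by rewrite setU11.
have /andP[cca _] : compatible c a && compatible c b.
  apply: reg => //; first exact: tag'.
  move=> f fC.
  apply: comp' => //.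
  by apply: inT'; [exact: sub | apply: contraNneq aC => <-].
have : a \in c |: (T :\ a).
  apply: max' => // e /setU1P[->|/setD1P[_ eT]]; first by rewrite compatible_sym.
  exact: comp.
by case/setU1P => [ac|/setD1P[]]; [rewrite ac eqxx in ca | rewrite eqxx].
Qed.

Lemma ordS_neq (n_gt1 : 1 < n) i : i != ordS i.
Proof. by rewrite -ccw_gt0 ccw_ordS. Qed.

Lemma boundary_compatible (n_gt1 : 1 < n) i e : is_tagged_arc e -> compatible e (chord i (ordS i)).
Proof.
move=> te; have E := ccw_ordS i n_gt1.
case: e te => [[k l]|[k t]] te; last by rewrite compatible_radius_chord /= E; lia.
rewrite compatible_chord_chord /= /overtakes E.
have := ccwP k i l; have := ccwP i k k; have := ccwP k k i; rewrite !ccwii.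
by have := ccwP i i k; rewrite !ccwii; clear; lia.
Qed.

Section Structure.
Variable T : {set tarc n}.
Hypothesis n_gt1 : 1 < n.
Hypothesis triT : tagged_triangulation T.

Lemma tri_tagged a : a \in T -> is_tagged_arc a.
Proof. by case/triangulationP: triT => H _ _; apply: H. Qed.

Lemma tri_compatible a b : a \in T -> b \in T -> compatible a b.
Proof. by case/triangulationP: triT => _ H _; apply: H. Qed.

Lemma tri_max e : is_tagged_arc e -> (forall a, a \in T -> compatible e a) -> e \in T.
Proof. by case/triangulationP: triT => _ _ H; apply: H. Qed.

Lemma tri_compatible_with a b : a \in T -> supp b \subset T -> compatible_with a b.
Proof.
by move=> aT bT; apply: (compatible_with_sub bT) => c; apply: tri_compatible.
Qed.

Lemma chord_in_supp i j : chord i j \in T -> supp (chord i j) \subset T.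
Proof. by move=> ijT; rewrite supp_tagged ?sub1set //; apply: tri_tagged. Qed.

Lemma chord_neq i j : chord i j \in T -> i != j.
Proof. by move/tri_tagged. Qed.

Lemma boundary_in i : chord i (ordS i) \in T.
Proof.
apply: tri_max => [|a aT]; first exact: ordS_neq.
by rewrite compatible_sym boundary_compatible // tri_tagged.
Qed.

(** The triangle on the side away from the puncture. Its third vertex is the farthest [m] with a
    chord from [i] inside the region: an arc crossing (m, q) but neither (i, m) nor (i, q) would
    start at [i] and reach beyond [m]. *)
Lemma split_region i q : supp (chord i q) \subset T -> 1 < height i (inl q) ->
  exists m, [/\ 0 < ccw i m, ccw i m < height i (inl q), chord i m \in T & chord m q \in T].
Proof.
move=> qT h1.
pose P m := (0 < ccw i m < height i (inl q)) && (chord i m \in T).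
have P0 : P (ordS i) by rewrite /P ccw_ordS // h1 boundary_in.
have [m /andP[/andP[m0 mh] imT] mmax] := arg_maxnP (fun m => ccw i m) P0.
exists m; split=> //; have im : i != m by rewrite -ccw_gt0.
have tag : is_tagged_arc (chord m q) by apply: (@arc_to_tagged n i m (inl q)).
apply: tri_max => // e eT; rewrite compatible_sym -compatible_with_tagged //.
have A := tri_compatible_with eT qT.
have B := tri_compatible_with eT (chord_in_supp imT).
case: e eT A B => [[k l]|[k t]] eT.
  have kl := chord_neq eT.
  rewrite (@compatible_with_lift _ i i (inl q)) ?ccwii //; last by lia.
  rewrite (@compatible_with_lift _ i i (inl m)) ?(height_chord im) ?ccwii //.
    rewrite (@compatible_with_lift _ i m (inl q)) //.
  have M : ~~ ((ccw i k == 0) && (ccw i m < ccw i l < height i (inl q))).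
    apply/negP => /andP[k0 /andP[l1 l2]].
    have ik : i = k by apply/eqP; rewrite (eq_ccw i) ccwii eq_sym.
    subst k; have Pl : P l by rewrite /P (leq_ltn_trans (leq0n _) l1) l2.
    by have := mmax l Pl; rewrite /= leqNgt l1.
  have := ccw_lt i k; have := ccw_lt k l; have := ccwP i k l; move: M.
  have hn : height i (inl q) <= n by rewrite /=; case: eqP => // _; apply/ltnW/ccw_lt.
  move: (height i (inl q)) h1 m0 mh hn => h; rewrite -ccw_gt0 in kl.
  move: (ccw i m) (ccw i k) (ccw i l) (ccw k l) kl; clear.
  rewrite /crosses_lift /interleave; lia.
rewrite (@compatible_with_radius _ i i (inl q)) ?ccwii //; last by lia.
by move=> A _; rewrite (@compatible_with_radius _ i m (inl q)) //; move: A; clear; lia.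
Qed.

(** Without radii, the radius at the start of a longest chord could be added: a chord enclosing that
    vertex ends before the longest chord does, and so crosses it. *)
Lemma radius_exists : exists i s, radius i s \in T.
Proof.
have i0 : 'I_n by exists 0; lia.
pose P (e : 'I_n * 'I_n) := chord e.1 e.2 \in T.
have P0 : P (i0, ordS i0) by rewrite /P boundary_in.
have [[i j] ijT mmax] := arg_maxnP (fun e => ccw e.1 e.2) P0.
have [|N] := boolP [exists k, exists s, radius k s \in T].
  by case/existsP => k /existsP[s]; exists k, s.
exists i, true; apply: tri_max => // e eT.
case: e eT => [[k l]|[k t]] eT; last first.
  by case/existsP: N; exists k; apply/existsP; exists t.
rewrite compatible_radius_chord /=.
have := tri_compatible eT ijT; rewrite compatible_chord_chord /= /overtakes.
have := mmax (k, l) eT; have := chord_neq ijT; rewrite -ccw_gt0 /=; clear; lia.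
Qed.

(** The triangle on the side facing the puncture, with third vertex beyond [j] or before [i]. It is
    the triangle just inside a smallest chord or loop enclosing (i, j); if nothing encloses (i, j),
    the third vertex is the puncture. *)
Lemma outer_triangle i j : chord i j \in T ->
  (exists Q, [/\ ccw i j < height i Q, supp (arc_to i Q) \subset T
                 & supp (arc_to j Q) \subset T]) \/
  (exists h, [/\ 0 < ccw h i, ccw h i < height h (inl j), chord h i \in T
                 & supp (chord h j) \subset T]).
Proof.
move=> ijT; have ij := chord_neq ijT.
pose P (e : 'I_n * 'I_n) := [&& supp (chord e.1 e.2) \subset T,
  ccw e.1 i + ccw i j <= height e.1 (inl e.2) & ccw i j < height e.1 (inl e.2)].
have [[e0 Pe0]|N] := altP (existsP (P := P)).
  have [[h l] /and3P[hlT le1 lt1] mmin] := arg_minnP (fun e => height e.1 (inl e.2)) Pe0.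
  have {}hlT : supp (chord h l) \subset T := hlT.
  have {}le1 : ccw h i + ccw i j <= height h (inl l) := le1.
  have {}lt1 : ccw i j < height h (inl l) := lt1.
  have {}mmin a b : supp (chord a b) \subset T ->
      ccw a i + ccw i j <= height a (inl b) -> ccw i j < height a (inl b) ->
      height h (inl l) <= height a (inl b).
    by move=> A B C; apply: (mmin (a, b)); apply/and3P.
  have h1 : 1 < height h (inl l) by rewrite -ccw_gt0 in ij; lia.
  have [m [m0 mh hmT mlT]] := split_region hlT h1.
  have hm : h != m by rewrite -ccw_gt0.
  have A := tri_compatible_with ijT (chord_in_supp hmT).
  have B := tri_compatible_with ijT (chord_in_supp mlT).
  have hn : height h (inl l) <= n by rewrite /=; case: eqP => // _; apply/ltnW/ccw_lt.
  have S : ccw h m <= ccw h i \/ ccw h i + ccw i j <= ccw h m.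
    move: A B; rewrite (@compatible_with_lift _ h h (inl m)) ?(height_chord hm) ?ccwii //.
    rewrite (@compatible_with_lift _ h m (inl l)) //.
    move: (height h (inl l)) le1 lt1 m0 mh hn => H.
    move: (ccw h m) (ccw h i) (ccw i j); clear.
    by rewrite /crosses_lift /interleave; lia.
  have mlE : ccw m l = height h (inl l) - ccw h m /\ height m (inl l) = ccw m l.
    have ml := chord_neq mlT; split; last exact: height_chord.
    move: mh => /=; case: eqP => [->|_] mh; last exact/ccwD/ltnW.
    by rewrite -[X in X - _](ccw_add_back hm) addKn.
  have [mlE1 mlE2] := mlE; clear mlE.
  case: S => S; last first.
    left; exists (inl l); have E : ccw h m <= ccw i j.
      rewrite leqNgt; apply/negP => E.
      have := mmin h m (chord_in_supp hmT); rewrite (height_chord hm) => /(_ S E).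
      by rewrite leqNgt mh.
    have hi : h = i by apply/eqP; rewrite (eq_ccw h) ccwii; move: S E; clear; lia.
    subst i; rewrite ccwii add0n in S.
    have mj : m = j by apply/eqP; rewrite (eq_ccw h) eqn_leq S E.
    by subst m; rewrite (chord_in_supp mlT).
  right; exists h.
  have mi : ccw m i = ccw h i - ccw h m by apply: ccwD.
  have E : ccw m l <= ccw i j.
    rewrite leqNgt; apply/negP => E.
    have := mmin m l (chord_in_supp mlT); rewrite mlE2 => H.
    have {}H : height h (inl l) <= ccw m l.
      by apply: H => //; rewrite mi mlE1; move: le1 S;
        move: (height h (inl l)) (ccw h m) (ccw h i) (ccw i j); clear; lia.
    by move: H m0 mh; rewrite mlE1; move: (height h (inl l)) (ccw h m); clear; lia.
  have mi' : m = i.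
    by apply/eqP; rewrite (eq_ccw h); move: E S le1 mh; rewrite mlE1;
    move: (height h (inl l)) (ccw h m) (ccw h i) (ccw i j); clear; lia.
  subst m; have jl : j = l.
    by apply/eqP; rewrite (eq_ccw i); move: E le1 mh; rewrite mlE1;
    move: (height h (inl l)) (ccw i l) (ccw h i) (ccw i j); clear; lia.
  by subst l; split.
(* Nothing encloses (i, j) from here on: so [T] has no loop, all its radii carry one tag, and no
   chord separates [i] or [j] from the puncture. *)
have N' e : supp (chord e.1 e.2) \subset T -> ccw i j < height e.1 (inl e.2) ->
    height e.1 (inl e.2) < ccw e.1 i + ccw i j.
  move=> eT lt1; rewrite ltnNge; apply: contraNN N => le1.
  by apply/existsP; exists e; rewrite /P eT le1 lt1.
have noloop h : ~~ (supp (chord h h) \subset T).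
  apply/negP => hT; have := N' (h, h) hT; rewrite height_loop ccw_lt => /(_ isT).
  move: hT; rewrite /= eqxx => hT.
  have : radius h true \in T by apply: (subsetP hT); rewrite !inE eqxx.
  move/(tri_compatible ijT); rewrite compatible_chord_radius (cross_rayE h) ccwii.
  rewrite /crosses_ray; have := ccw_lt h i; clear; lia.
have [k [s ksT]] := radius_exists.
have tags k' s' : radius k' s' \in T -> s' = s.
  move=> k'T; apply/eqP; have := tri_compatible k'T ksT.
  rewrite /compatible /= => /orP[/eqP kk|//]; subst k'.
  apply: contraNT (noloop k) => ss; rewrite /= eqxx.
  by case: s s' ss ksT k'T => [] [] // _ A B; apply/subsetP => x /set2P[]->.
have N2 k' l : chord k' l \in T -> ccw i j < ccw k' l -> ccw k' l < ccw k' i + ccw i j.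
  by move=> klT; have := N' (k', l) (chord_in_supp klT); rewrite [(k',l).1]/= [(k',l).2]/= height_chord // chord_neq.
have ijr x : x = i \/ x = j -> radius x s \in T.
  move=> xE; apply: tri_max => // e eT.
  case: e eT => [[k' l]|[k' t]] eT; last by rewrite (tags _ _ eT) /compatible /= eqxx orbT.
  rewrite compatible_radius_chord /=.
  have := tri_compatible eT ijT; rewrite compatible_chord_chord /= /overtakes.
  have := N2 _ _ eT; move: ij; rewrite -ccw_gt0.
  have := ccwP k' i j; have := ccwP k' i k'; rewrite ccwii.
  by case: xE => ->; clear; lia.
left; exists (inr s); split; first by rewrite /=; have := ccw_lt i j; lia.
  by rewrite /= sub1set ijr //; left.
by rewrite /= sub1set ijr //; right.
Qed.


(** The triangle beyond the longest chord leaving [i] has its third vertex at the puncture, unless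
    it closes up to the loop at [i], which provides the radius with the other tag. *)
Lemma next_radius i s : radius i s \in T ->
  radius i (~~ s) \in T \/ exists j, [/\ i != j, chord i j \in T & radius j s \in T].
Proof.
move=> isT.
pose P m := chord i m \in T.
have P0 : P (ordS i) by exact: boundary_in.
have [m imT mmax] := arg_maxnP (fun m => ccw i m) P0.
have im := chord_neq imT.
have loopi s' : radius i s' \in T -> s' != s -> radius i (~~ s) \in T.
  by case: s s' {isT} => [] [].
case: (outer_triangle imT) => [[Q [hQ iQ mQ]]|[h [h0 hh hiT hmT]]].
  case: Q hQ iQ mQ => [l|s'] hQ iQ mQ.
    move: hQ iQ => /=; have [_ _ /subsetP H|li hQ] := eqVneq l i.
      left.
      by apply: H; rewrite !inE; case: (s); rewrite ?eqxx ?orbT.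
    rewrite sub1set => ilT.
    by have := mmax l ilT; rewrite /= leqNgt hQ.
  rewrite /= !sub1set in iQ mQ.
  have [ss|ss] := eqVneq s' s; last by left; apply: (loopi s').
  by right; exists m; rewrite -ss.
have : radius i s \in T by [].
move/tri_compatible_with => /(_ _ hmT).
rewrite (@compatible_with_radius n h h (inl m)) ?ccwii; last exact: ltn_trans h0 hh.
by rewrite h0 hh.
Qed.

Lemma previous_radius i s : radius i s \in T ->
  radius i (~~ s) \in T \/ exists h, [/\ h != i, chord h i \in T & radius h s \in T].
Proof.
move=> isT.
have [g gS] : exists g, i = ordS g by exists (ord_pred i); rewrite ord_predK.
pose P h := chord h i \in T.
have gP : P g by rewrite /P gS boundary_in.
have [h hiT hmax] := arg_maxnP (fun h => ccw h i) gP.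
have hi := chord_neq hiT.
have loopi s' : radius i s' \in T -> s' != s -> radius i (~~ s) \in T.
  by case: s s' {isT} => [] [].
case: (outer_triangle hiT) => [[Q [hQ iQ mQ]]|[k [k0 kh khT kiT]]].
  case: Q hQ iQ mQ => [l|s'] hQ iQ mQ.
    have := tri_compatible_with isT iQ.
    rewrite (@compatible_with_radius n h h (inl l)) ?ccwii; last exact: leq_ltn_trans hQ.
    by rewrite hQ ccw_gt0 hi.
  rewrite /= !sub1set in iQ mQ.
  have [ss|ss] := eqVneq s' s; last by left; apply: (loopi s').
  by right; exists h; rewrite -ss.
move: kh kiT => /=; have [ik _ /subsetP H|ik kh] := eqVneq i k.
  left.
  by rewrite ik; apply: H; rewrite !inE; case: (s); rewrite ?eqxx ?orbT.
rewrite sub1set => kiT.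
have := hmax k kiT; rewrite /=; have := ccw_add (ltnW kh); move: k0; clear; lia.
Qed.

End Structure.

(** Exchanges in a quadrilateral and in a once-punctured digon, each in both directions. The vertex
    [Q] of the quadrilateral may be the puncture, or [i] again. *)
Inductive flip_move (T : {set tarc n}) : tarc n -> tarc n -> Prop :=
| FlipChord i m j Q of 0 < ccw i m & ccw i m < ccw i j & ccw i j < height i Q
    & quad_core i m j Q \subset T : flip_move T (chord i j) (arc_to m Q)
| FlipArc i m j Q of 0 < ccw i m & ccw i m < ccw i j & ccw i j < height i Q
    & quad_core i m j Q \subset T : flip_move T (arc_to m Q) (chord i j)
| FlipRadius i j s of i != j & digon_core i j s \subset T :
    flip_move T (radius i s) (radius j (~~ s))
| FlipLoop i j s of i != j & digon_core i j s \subset T :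
    flip_move T (radius j (~~ s)) (radius i s).

Lemma flip_move_region T a b : flip_move T a b ->
  exists2 core : {set tarc n}, flip_region core a b & core \subset T.
Proof.
case=> [i m j Q h1 h2 h3 sub|i m j Q h1 h2 h3 sub|i j s ij sub|i j s ij sub].
- by exists (quad_core i m j Q) => //; apply: quad_region.
- by exists (quad_core i m j Q) => //; apply/flip_region_sym/quad_region.
- by exists (digon_core i j s) => //; apply: digon_region.
- by exists (digon_core i j s) => //; apply/flip_region_sym/digon_region.
Qed.

Lemma flip_move_sym T a b : flip_move T a b -> a \in T ->
  flip_move (b |: (T :\ a)) b a.
Proof.
move=> mv aT.
have sub' core : flip_region core a b -> core \subset T -> core \subset b |: (T :\ a).
  case=> _ _ _ aC _ _ /subsetP sub; apply/subsetP => c cC.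
  apply/setU1P; right; apply/setD1P; split; last exact: sub.
  by apply: contraNneq aC => <-.
case: mv aT sub' => [i m j Q h1 h2 h3 sub|i m j Q h1 h2 h3 sub|i j s ij sub|i j s ij sub] aT sub'.
- by apply: FlipArc => //; apply: sub' => //; apply: quad_region.
- by apply: FlipChord => //; apply: sub' => //; apply/flip_region_sym/quad_region.
- by apply: FlipLoop => //; apply: sub' => //; apply: digon_region.
- by apply: FlipRadius => //; apply: sub' => //; apply/flip_region_sym/digon_region.
Qed.

Lemma flip_move_triangulation T a b : flip_move T a b -> tagged_triangulation T ->
  a \in T -> tagged_triangulation (b |: (T :\ a)).
Proof.
by case/flip_move_region => core reg sub triT aT; apply: (flip_exists reg).
Qed.

Lemma flip_move_unique T a b c : flip_move T a b -> tagged_triangulation T ->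
  a \in T -> c != a -> tagged_triangulation (c |: (T :\ a)) -> c = b.
Proof.
by case/flip_move_region => core reg sub triT aT; apply: (flip_unique reg).
Qed.

Lemma quad_coreP T i m j Q : i != m -> m != j -> quad_core i m j Q \subset T =
  [&& chord i m \in T, chord m j \in T, supp (arc_to j Q) \subset T &
      supp (arc_to i Q) \subset T].
Proof.
move=> im mj; rewrite /quad_core !subUset (@supp_tagged n (chord i m)) //.
by rewrite (@supp_tagged n (chord m j)) // !sub1set -!andbA.
Qed.

(** The two triangles at the arc form the quadrilateral. If a radius occurs with both tags, its
    region is the digon inside the loop they represent, whose second vertex comes from the triangle
    in that loop. If the two neighbours of a radius coincide, the region is a digon again. *)
Lemma flip_move_exists T a : 1 < n -> tagged_triangulation T -> a \in T ->
  (forall i, a != chord i (ordS i)) -> exists b, flip_move T a b.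
Proof.
move=> n1 triT aT mut; case: a aT mut => [[i j]|[i s]] aT mut.
  have ij := chord_neq triT aT.
  have h2 : 1 < height i (inl j).
    rewrite (height_chord ij) ltn_neqAle eq_sym -ordS_ccw // ccw_gt0 ij andbT.
    by apply: contra (mut i) => /eqP ->.
  have ijT := chord_in_supp triT aT.
  have [m [m0 mh imT mjT]] := split_region n1 triT ijT h2.
  rewrite (height_chord ij) in mh.
  have im := chord_neq triT imT; have mj := chord_neq triT mjT.
  case: (outer_triangle n1 triT aT) => [[Q [hQ iQ jQ]]|[h [h0 hh hiT hjT]]].
    exists (arc_to m Q); apply: FlipChord => //.
    by rewrite quad_coreP // imT mjT iQ jQ.
  have hi := chord_neq triT hiT.
  have A := tri_compatible_with triT aT hjT.
  have hm : ccw h m = ccw h i + ccw i m /\ ccw h i + ccw i m < height h (inl j).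
    move: hh; rewrite /=; case: eqP => [jh hn|jh hn].
      subst j; have := ccwP h i m; have := ccw_add_back hi; move: mh h0; clear; lia.
    have jE : ccw i j = ccw h j - ccw h i by apply: ccwD; apply: ltnW.
    have := ccwP h i m; have := ccw_lt h j; have := ccw_lt h i.
    by move: mh h0 hn; rewrite jE; clear; lia.
  have [hmE hmlt] := hm.
  exists (chord h m); apply: (@FlipArc T h i m (inl j)) => //; last first.
  - by rewrite quad_coreP // hiT imT /= hjT andbT; apply: (chord_in_supp triT).
  - by rewrite hmE.
  - by rewrite hmE -[X in X < _]addn0 ltn_add2l.
have [nT|nT] := boolP (radius i (~~ s) \in T).
  have loopT : supp (chord i i) \subset T.
    by rewrite /= eqxx; apply/subsetP => x /set2P[]->; case: s aT nT {mut}.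
  have [|m [m0 mh imT miT]] := split_region n1 triT loopT; first by rewrite height_loop.
  exists (radius m (~~ s)); have := @FlipLoop T m i (~~ s).
  rewrite negbK; apply; first exact: (chord_neq triT miT).
  by rewrite /digon_core !subUset !sub1set miT imT nT.
have [H|[j [ij ijT jT]]] := next_radius n1 triT aT; first by rewrite H in nT.
have [H|[h [hi hiT hT]]] := previous_radius n1 triT aT; first by rewrite H in nT.
have [hj|hj] := eqVneq h j.
  subst h; exists (radius j (~~ s)); apply: FlipRadius => //.
  by rewrite /digon_core !subUset !sub1set hiT ijT jT.
exists (chord h j); apply: (@FlipArc T h i j (inr s)).
- by rewrite ccw_gt0.
- have := tri_compatible triT jT hiT; rewrite compatible_radius_chord /=.
  move: hj ij; rewrite -ccw_gt0 (eq_ccw h); move: (ccw h j) (ccw h i); clear; lia.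
- by rewrite /=; have := ccw_lt h j; lia.
- by rewrite quad_coreP // hiT ijT /= !sub1set jT hT.
Qed.

End Triangulations.

Import GRing.Theory Num.Theory.
Local Open Scope ring_scope.

(** * Lambda lengths and exchange relations *)

Section LambdaLength.
Variables (n : nat) (F : fieldType) (x b : 'I_n -> F).
Implicit Types (i j k l m : 'I_n).

Definition partial_length (m : nat) : F :=
  \sum_(j < n | (j < m)%N) b j / (x j * x (ordS j)).

Definition total_length : F := partial_length n.

(* The horocyclic length at the puncture of the sector from [i] to [j]. *)
Definition sector i j : F :=
  partial_length j - partial_length i + (if (j <= i)%N then total_length else 0).

Definition lam (a : tarc n) : F :=
  match a with
  | inl (i, j) => x i * x j * sector i j
  | inr (i, notched) => if notched then x i * total_length else x i
  end.

Lemma sectorD i m q : (0 < ccw i m)%N -> (ccw i m < height i (inl q))%N ->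
  sector i q = sector i m + sector m q.
Proof.
move=> h1 h2.
(* The flag [q <= i] tells whether the path from [i] to [q] passes from [n - 1] to 0; it does so as
   often as its two halves together. *)
have K : (q <= i = (m <= i) + (q <= m) :> nat)%N.
  have hi := ltn_ord i; have hm := ltn_ord m; have hq := ltn_ord q.
  move: h1 h2; rewrite /= !ccwE -val_eqE /=.
  case: eqP => E; case: (leqP i m) => A; case: (leqP i q) => B; lia.
by rewrite /sector -!mulrb K mulrnDr; ring.
Qed.

Lemma sector_loop i : sector i i = total_length.
Proof. by rewrite /sector leqnn subrr add0r. Qed.

Lemma lam_loop i : lam (chord i i) = lam (radius i true) * lam (radius i false).
Proof. by rewrite /= sector_loop; ring. Qed.

Lemma lam_quad i m j Q :
  (0 < ccw i m)%N -> (ccw i m < ccw i j)%N -> (ccw i j < height i Q)%N ->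
  lam (chord i j) * lam (arc_to m Q) =
  lam (chord i m) * lam (arc_to j Q) + lam (chord m j) * lam (arc_to i Q).
Proof.
move=> h1 h2 h3.
have ij : i != j by rewrite -ccw_gt0; lia.
have sij : sector i j = sector i m + sector m j.
  by apply: sectorD => //; rewrite height_chord.
case: Q h3 => [q|s] /= h3; last by case: s {h3}; rewrite sij; ring.
have siq : sector i q = sector i m + sector m q.
  by apply: sectorD => //; apply: ltn_trans h3.
have siq' : sector i q = sector i j + sector j q.
  by apply: sectorD => //; apply: ltn_trans h2.
have sjq : sector j q = sector i q - sector i j by rewrite siq' addrC addKr.
have smq : sector m q = sector i q - sector i m by rewrite siq addrC addKr.
have smj : sector m j = sector i j - sector i m by rewrite sij addrC addKr.
by rewrite sjq smq smj; ring.
Qed.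

Lemma lam_digon i j s : i != j ->
  lam (radius i s) * lam (radius j (~~ s)) = lam (chord i j) + lam (chord j i).
Proof.
move=> ij; have E : total_length = sector i j + sector j i.
  by rewrite -(sector_loop i) -sectorD // ?ccw_gt0 // height_loop ccw_lt.
by case: s; rewrite /= E; ring.
Qed.

Lemma lam_radii i j s : lam (radius i s) * lam (radius j (~~ s)) =
  lam (radius j s) * lam (radius i (~~ s)).
Proof. by case: s => /=; ring. Qed.

Lemma partial_lengthS i :
  partial_length i.+1 = partial_length i + b i / (x i * x (ordS i)).
Proof.
rewrite /partial_length (bigD1 i) /= ?leqnn // addrC; congr (_ + _).
by apply: eq_bigl => j; rewrite -val_eqE /=; lia.
Qed.

Lemma partial_length0 : partial_length 0 = 0.
Proof. by rewrite /partial_length big_pred0. Qed.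

Lemma lam_boundary i : (1 < n)%N -> (forall j, x j != 0) -> lam (chord i (ordS i)) = b i.
Proof.
move=> n1 x0; rewrite /=.
suff -> : sector i (ordS i) = b i / (x i * x (ordS i)).
  by rewrite mulrCA divff ?mulr1 // mulf_neq0.
rewrite /sector /=.
have := ltn_ord i; rewrite leq_eqVlt => /predU1P[E1|lt].
  rewrite E1 modnn leq0n /total_length -{2}E1 partial_lengthS.
  by rewrite partial_length0 sub0r addKr.
by rewrite modn_small // ltnn addr0 partial_lengthS addrC addKr.
Qed.

End LambdaLength.

(** * Signed adjacency of a tagged triangulation and its change under flips *)

Section Adjacency.
Variable n : nat.
Hypothesis n_gt1 : (1 < n)%N.
Implicit Types (i j k l m : 'I_n) (T : {set tarc n}) (a b c d : tarc n).

Definition ind a c : int := (c \in supp a)%:Z.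

Definition wedge (f g : tarc n -> int) c d : int := f c * g d - g c * f d.

Notation triangle := ('I_n * 'I_n * ('I_n + bool))%type.

Definition tri_valid (t : triangle) : bool :=
  let: (i, m, Q) := t in (0 < ccw i m < height i Q)%N.

Definition tri_supp (t : triangle) : {set tarc n} :=
  let: (i, m, Q) := t in
  supp (chord i m) :|: supp (arc_to m Q) :|: supp (arc_to i Q).

(** The alternating form of a triangle: wedges of sides consecutive in clockwise order. A loop
    enters through [ind] as the sum of the two tagged radii at its vertex, so the triangle inside a
    loop gives both radii the same entries. *)
Definition tri_form (t : triangle) c d : int :=
  let: (i, m, Q) := t in
  wedge (ind (chord i m)) (ind (arc_to i Q)) c d +
  wedge (ind (arc_to i Q)) (ind (arc_to m Q)) c d +
  wedge (ind (arc_to m Q)) (ind (chord i m)) c d.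

Definition adjacency T c d : int :=
  \sum_(t | tri_valid t && (tri_supp t \subset T)) tri_form t c d.

Lemma tri_form0 t c d : (c \notin tri_supp t) || (d \notin tri_supp t) ->
  tri_form t c d = 0.
Proof.
case: t => [[i m] Q]; rewrite /= !in_arcs !negb_or /wedge /ind.
by case/orP => /andP[/andP[/negbTE-> /negbTE->] /negbTE->]; rewrite !(mul0r, mulr0, subr0, addr0).
Qed.

Section Uniqueness.
Variable T : {set tarc n}.
Hypothesis triT : tagged_triangulation T.

Let tri_sub t := tri_valid t && (tri_supp t \subset T).

Lemma tri_subP i m Q : tri_sub (i, m, Q) =
  [&& (0 < ccw i m)%N, (ccw i m < height i Q)%N, chord i m \in T,
      supp (arc_to m Q) \subset T & supp (arc_to i Q) \subset T].
Proof.
rewrite /tri_sub /tri_valid /tri_supp !subUset -!andbA.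
case: (ltnP 0 (ccw i m)) => // h.
by rewrite (@supp_tagged n (chord i m)) ?sub1set //= -ccw_gt0.
Qed.

Lemma no_quad i m j Q : (0 < ccw i m)%N -> (ccw i m < ccw i j)%N ->
  (ccw i j < height i Q)%N -> chord i j \in T -> supp (arc_to m Q) \subset T -> False.
Proof.
move=> h1 h2 h3 ijT mT; have := quad_diag_cross h1 h2 h3.
have tag : is_tagged_arc (arc_to m Q).
  by apply: (@arc_to_tagged _ i); rewrite -?ccw_gt0 //; apply: ltn_trans h3.
by rewrite -compatible_with_tagged // (tri_compatible_with triT).
Qed.

(** If one third vertex lay beyond the other, the arc from [m] to the farther one would be
    incompatible with the arc from [i] to the nearer one. This and the next lemmas show that an arc
    has at most one triangle on each side, so that the triangles touched by a flip can be listed. *)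
Lemma tri_unique_third i m Q Q' : tri_sub (i, m, Q) -> tri_sub (i, m, Q') -> Q = Q'.
Proof.
rewrite !tri_subP => /and5P[h1 h2 imT mQ iQ] /and5P[_ h2' _ mQ' iQ'].
have im : i != m by rewrite -ccw_gt0.
have key R R' : (ccw i m < height i R)%N -> supp (arc_to i R) \subset T ->
    supp (arc_to m R') \subset T -> (height i R < height i R')%N -> False.
  case: R => [q|s] hR iR mR' lt; last first.
    by case: R' lt {mR'} => [q'|s']; rewrite ?ltnn // ltnNge (leq_trans (height_le i q')).
  have [qi|qi] := eqVneq q i; last first.
    rewrite height_chord 1?eq_sym // in hR lt.
    by apply: (no_quad h1 hR lt) => //; move: iR; rewrite supp_tagged /= ?sub1set // eq_sym.
  subst q; rewrite height_loop in lt.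
  case: R' lt mR' => [q'|s'] lt mR'; first by rewrite ltnNge height_le in lt.
  move: iR mR'; rewrite /= eqxx sub1set => /subsetP iR mR'.
  have := tri_compatible triT (iR (radius i (~~ s')) _) mR'.
  rewrite /compatible /= (negbTE im) /=; case: (s'); rewrite !inE eqxx ?orbT; by move=> /(_ isT).
case: (ltngtP (height i Q) (height i Q')) => [lt|lt|E].
- by case: (key Q Q').
- by case: (key Q' Q).
case: Q Q' E iQ mQ iQ' mQ' {h2 h2' key} => [q|s] [q'|s'] E iQ mQ iQ' mQ'.
- congr inl; apply/eqP; rewrite (eq_ccw i); move: E => /=.
  by case: eqP => [->|_]; case: eqP => [->|_] //; rewrite ?eqxx //; [have := ccw_lt i q'|have := ccw_lt i q|]; lia.
- by have := height_le i q; rewrite E ltnn.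
- by have := height_le i q'; rewrite -E ltnn.
- rewrite /= !sub1set in iQ mQ'.
  by have := tri_compatible triT iQ mQ'; rewrite /compatible /= (negbTE im) => /eqP ->.
Qed.

Lemma tri_unique_second i m m' Q : tri_sub (i, m, Q) -> tri_sub (i, m', Q) -> m = m'.
Proof.
rewrite !tri_subP => /and5P[h1 h2 imT mQ iQ] /and5P[h1' h2' imT' mQ' _].
case: (ltngtP (ccw i m) (ccw i m')) => [lt|lt|E].
- by case: (no_quad h1 lt h2').
- by case: (no_quad h1' lt h2).
- by apply/eqP; rewrite (eq_ccw i) E.
Qed.

Lemma tri_unique_first i i' m Q : tri_sub (i, m, Q) -> tri_sub (i', m, Q) -> i = i'.
Proof.
rewrite !tri_subP => /and5P[h1 h2 imT mQ iQ] /and5P[h1' h2' imT' _ iQ'].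
apply/eqP; apply: contraT => ii.
have : ((0 < ccw i i') && (ccw i i' < ccw i m) || (0 < ccw i' i) && (ccw i' i < ccw i' m))%N.
  have ii' : i' != i by rewrite eq_sym.
  move: ii ii' h1 h1'; rewrite -!ccw_gt0; have := ccwP i i' m; have := ccwP i i' i.
  by rewrite ccwii; clear; lia.
case/orP => /andP[lt0 lt]; first by case: (no_quad lt0 lt h2).
by case: (no_quad lt0 lt h2').
Qed.

(** Both triangles would lie on the puncture side of (i, j): the arc from [i] to [Q] then conflicts
    with the side from [h] to [j], which encloses [i]. *)
Lemma tri_one_side h i j Q : tri_sub (i, j, Q) -> tri_sub (h, i, inl j) -> False.
Proof.
rewrite !tri_subP => /and5P[h1 h2 ijT jQ iQ] /and5P[h0 hi hiT ijT' hj].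
have hpos : (0 < height h (inl j))%N by apply: leq_ltn_trans hi.
have ij := chord_neq triT ijT; have nhi := chord_neq triT hiT.
have H : height h (inl j) = (ccw h i + ccw i j)%N.
  have [jh|jh] := eqVneq h j.
    by subst j; rewrite height_loop ccw_add_back.
  by move: hi; rewrite height_chord // => /ltnW /ccw_add ->.
case: Q h2 jQ iQ => [q|s] h2 jQ iQ.
  have [qi|qi] := eqVneq q i.
    subst q; move: iQ => /=; rewrite eqxx => /subsetP iQ.
    have := tri_compatible_with triT (iQ (radius i true) _) hj.
    rewrite (@compatible_with_radius n h h (inl j)) ?ccwii ?hpos // h0 hi.
    by rewrite !inE eqxx => /(_ isT).
  have iqT : chord i q \in T by move: iQ; rewrite supp_tagged /= ?sub1set // eq_sym.
  have := tri_compatible_with triT iqT hj.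
  rewrite (@compatible_with_lift n h h (inl j)) ?ccwii ?hpos //; last by rewrite eq_sym.
  rewrite /crosses_lift /interleave H; rewrite height_chord 1?eq_sym // in h2.
  by move: h0 h1 h2; clear; lia.
rewrite /= sub1set in iQ.
have := tri_compatible_with triT iQ hj.
by rewrite (@compatible_with_radius n h h (inl j)) ?ccwii ?hpos // h0 hi.
Qed.


Definition star a t := tri_sub t && (a \in tri_supp t).

Lemma in_supp_tagged a c : is_tagged_arc c -> (a \in supp c) = (a == c).
Proof. by move/supp_tagged ->; rewrite in_arcs. Qed.

Lemma in_tri_supp a i m Q : tri_sub (i, m, Q) ->
  (a \in tri_supp (i, m, Q)) = [|| a == chord i m, a == arc_to m Q | a \in supp (arc_to i Q)].
Proof.
rewrite tri_subP => /and5P[h1 h2 _ _ _]; rewrite /tri_supp !in_arcs.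
have im : i != m by rewrite -ccw_gt0.
rewrite (@in_supp_tagged a (chord i m)) // (@in_supp_tagged a (arc_to m Q)) ?orbA //.
exact: (@arc_to_tagged _ i).
Qed.

Lemma in_supp_chord i j k (Q : endpoint n) : i != j ->
  (chord i j \in supp (arc_to k Q)) = (chord i j == arc_to k Q).
Proof.
move=> ij; case: Q => [q|s] /=; last by rewrite in_arcs.
case: eqP => [<-|_]; rewrite !in_arcs //=.
by apply/esym/eqP => -[ik jk]; rewrite ik jk eqxx in ij.
Qed.

Lemma chord_inj i j k l : chord i j = chord k l -> i = k /\ j = l.
Proof. by case. Qed.

Lemma chord_arc_to i j k (Q : endpoint n) : chord i j = arc_to k Q -> i = k /\ Q = inl j.
Proof. by case: Q => [q|s] // []-> ->. Qed.

Lemma radius_arc_to i s k (Q : endpoint n) : radius i s = arc_to k Q -> i = k /\ Q = inr s.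
Proof. by case: Q => [q|t] // []-> ->. Qed.

Lemma star_chord_in i j Q m : tri_sub (i, j, Q) -> tri_sub (i, m, inl j) ->
  star (chord i j) =1 pred2 (i, m, inl j) (i, j, Q).
Proof.
move=> tQ tm t; have ij : i != j by move: tQ; rewrite tri_subP -ccw_gt0 => /and5P[].
rewrite /star /=; apply/andP/orP => [[]|[/eqP->|/eqP->]].
- case: t => [[i' m'] Q'] st; rewrite in_tri_supp // in_supp_chord //.
  case/or3P => [/eqP/chord_inj[? ?]|/eqP/chord_arc_to[? ?]|/eqP/chord_arc_to[? ?]]; subst.
  + by right; rewrite (tri_unique_third st tQ).
  + by case: (tri_one_side tQ st).
  + by left; rewrite (tri_unique_second st tm).
- by split=> //; rewrite in_tri_supp // in_supp_chord // eqxx !orbT.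
- by split=> //; rewrite in_tri_supp // eqxx.
Qed.

Lemma star_chord_out h i j m : tri_sub (h, i, inl j) -> tri_sub (i, m, inl j) ->
  i != j -> star (chord i j) =1 pred2 (i, m, inl j) (h, i, inl j).
Proof.
move=> th tm ij t; rewrite /star /=; apply/andP/orP => [[]|[/eqP->|/eqP->]].
- case: t => [[i' m'] Q'] st; rewrite in_tri_supp // in_supp_chord //.
  case/or3P => [/eqP/chord_inj[? ?]|/eqP/chord_arc_to[? ?]|/eqP/chord_arc_to[? ?]]; subst.
  + by case: (tri_one_side st th).
  + by right; rewrite (tri_unique_first st th).
  + by left; rewrite (tri_unique_second st tm).
- by split=> //; rewrite in_tri_supp // in_supp_chord // eqxx !orbT.
- by split=> //; rewrite in_tri_supp // eqxx orbT.
Qed.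

Lemma in_supp_radius i s k (Q : endpoint n) : (radius i s \in supp (arc_to k Q)) =
  (radius i s == arc_to k Q) || (k == i) && (Q == inl i).
Proof.
case: Q => [q|t] /=; last by rewrite in_arcs andbF orbF.
have -> : (inl q == inl i :> 'I_n + bool) = (q == i) by [].
case: eqP => [<-|kq]; rewrite !in_arcs /=; last first.
  by apply/esym/negbTE/negP => /andP[/eqP A /eqP B]; rewrite A B in kq.
by rewrite andbb !(radius_eq k) -andb_orr -!(eq_ccw k) eq_sym; case: (s); rewrite ?andbT.
Qed.

Lemma star_radius i m j s : tri_sub (i, m, inr s) -> tri_sub (m, j, inr s) ->
  star (radius m s) =1 pred2 (m, j, inr s) (i, m, inr s).
Proof.
move=> ti tj t; rewrite /star /=; apply/andP/orP => [[]|[/eqP->|/eqP->]].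
- case: t => [[i' m'] Q'] st; rewrite in_tri_supp // in_supp_radius //.
  case/or4P; [by []|move/eqP/radius_arc_to => [? ?]..|]; subst.
  + by right; rewrite (tri_unique_first st ti).
  + by left; rewrite (tri_unique_second st tj).
  + case/andP => /eqP ? /eqP ?; subst; move: st ti; rewrite !tri_subP /=.
    rewrite eqxx => /and5P[_ _ _ _ /subsetP mT] /and5P[im _ _ _].
    rewrite sub1set => iT; have := tri_compatible triT (mT (radius m (~~ s)) _) iT.
    rewrite /compatible /=; rewrite ccw_gt0 eq_sym in im; rewrite (negbTE im) /=.
    by case: (s); rewrite !inE eqxx ?orbT; move=> /(_ isT).
- by split=> //; rewrite in_tri_supp // in_supp_radius //; apply/or4P/Or43/eqP.
- by split=> //; rewrite in_tri_supp // in_supp_radius //; apply/or4P/Or42/eqP.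
Qed.

(** When both tags occur at [i], these are the only radii of [T], so no triangle has the puncture as
    a vertex and only the one inside the loop remains. *)
Lemma star_loop i j s : radius i s \in T -> tri_sub (i, j, inl i) ->
  star (radius i s) =1 pred1 (i, j, inl i).
Proof.
move=> iT tj t; rewrite /star /=; apply/andP/eqP => [[]|->].
- have jT s' : radius i s' \in T.
    move: tj; rewrite tri_subP /= eqxx => /and5P[_ _ _ _ /subsetP]; apply.
    by case: (s'); rewrite !inE eqxx ?orbT.
  have other k s' : radius k s' \in T -> k = i.
    move=> kT; have := tri_compatible triT kT (jT (~~ s')).
    by rewrite /compatible /=; case: eqP => //; case: (s').
  case: t => [[i' m'] Q'] st; rewrite in_tri_supp // in_supp_radius //.
  have ne : i' != m' by move: st; rewrite tri_subP -ccw_gt0 => /and5P[].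
  case/or4P; [by []|move/eqP/radius_arc_to => [? ?]..|]; subst.
  + by move: st; rewrite tri_subP /= !sub1set => /and5P[_ _ _ _ /other A]; rewrite A eqxx in ne.
  + by move: st; rewrite tri_subP /= !sub1set => /and5P[_ _ _ /other A _]; rewrite A eqxx in ne.
  + by case/andP => /eqP ? /eqP ?; subst; rewrite (tri_unique_second st tj).
- by split=> //; rewrite in_tri_supp // in_supp_radius //; apply/or4P/Or44; rewrite !eqxx.
Qed.

Lemma adjacency_split a c d : adjacency T c d =
  \sum_(t | tri_valid t && (tri_supp t \subset T :\ a)) tri_form t c d +
  \sum_(t | star a t) tri_form t c d.
Proof.
rewrite /adjacency (bigID (fun t => a \in tri_supp t)) /= addrC; congr (_ + _).
by apply: eq_bigl => t; rewrite subsetD1 andbA.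
Qed.
End Uniqueness.

Lemma ind_supp0 a c : c \notin supp a -> ind a c = 0.
Proof. by rewrite /ind => /negbTE ->. Qed.

Lemma ind_tagged a c : is_tagged_arc a -> ind a c = (c == a)%:Z.
Proof. by move=> ta; rewrite /ind in_supp_tagged. Qed.

Variables (F : fieldType) (x b : 'I_n -> F).
Local Notation lam := (lam x b).

(** A flip in terms of alternating forms: [R + a /\ (P - N)] becomes [R - a' /\ (P - N) - P /\ N],
    which is matrix mutation at [a], and [lam a * lam a'] is the sum of the monomials with exponents
    [P] and [N]. The form [R] involves neither [a] nor [a']. *)
Record exchange_data T (a : tarc n) T' (a' : tarc n) (P N : tarc n -> int)
    (R : tarc n -> tarc n -> int) : Prop := ExchangeData {
  exch_before : forall c d, adjacency T c d =
    R c d + wedge (ind a) (fun e => P e - N e) c d;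
  exch_after : forall c d, adjacency T' c d =
    R c d - wedge (ind a') (fun e => P e - N e) c d - wedge P N c d;
  exch_rest : forall c d, [|| c == a, c == a', d == a | d == a'] -> R c d = 0;
  exch_disjoint : forall c, P c * N c = 0;
  exch_ge0 : forall c, 0 <= P c /\ 0 <= N c;
  exch_sub : forall c, (P c != 0) || (N c != 0) -> (c \in T :\ a) && (c \in T' :\ a');
  exch_lam : lam a * lam a' =
    \prod_c lam c ^+ absz (P c) + \prod_c lam c ^+ absz (N c) }.

(** Mutation is an involution: going back exchanges [P] with [N] and moves [P /\ N] into the
    rest. *)
Lemma exchange_data_sym T a T' a' P N R :
  exchange_data T a T' a' P N R ->
  exchange_data T' a' T a N P (fun c d => R c d - wedge P N c d).
Proof.
case=> bef aft rest disj ge0 sub lamE.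
have out c : (c == a) || (c == a') -> P c = 0 /\ N c = 0.
  move=> ca; have [|] := boolP ((P c != 0) || (N c != 0)).
    by move/sub => /andP[/setD1P[A _] /setD1P[B _]]; rewrite (negbTE A) (negbTE B) in ca.
  by rewrite negb_or !negbK => /andP[/eqP -> /eqP ->].
split.
- by move=> c d; rewrite aft /wedge; ring.
- by move=> c d; rewrite bef /wedge; ring.
- move=> c d E; have {}E : [|| c == a, c == a', d == a | d == a'].
    by case/or4P: E => ->; rewrite ?orbT.
  rewrite rest // /wedge; move: E; rewrite orbA => /orP[] /out[-> ->];
    by rewrite !(mul0r, mulr0) !subr0.
- by move=> c; rewrite mulrC.
- by move=> c; have [] := ge0 c.
- by move=> c; rewrite orbC andbC => /sub; rewrite andbC.
- by rewrite mulrC lamE addrC.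
Qed.

Lemma prod_ind a : \prod_c lam c ^+ absz (ind a c) = lam a.
Proof.
have [ta|nta] := boolP (is_tagged_arc a).
  rewrite (bigD1 a) // ind_tagged // eqxx expr1 big1 ?Monoid.mulm1 // => c ca.
  by rewrite ind_tagged // (negbTE ca) expr0.
case: a nta => [[i j]|//]; rewrite [is_tagged_arc _]/= negbK => /eqP <-.
have ne : radius i true != radius i false by rewrite (radius_eq i) andbF.
have in2 c : ind (inl (i, i)) c = ((c == radius i true) || (c == radius i false))%:Z.
  by rewrite /ind /= eqxx !in_arcs.
rewrite (bigD1 (radius i true)) // (bigD1 (radius i false)) 1?eq_sym //.
rewrite !in2 !eqxx orbT !expr1 big1 ?Monoid.mulm1 ?[RHS]lam_loop // => c /andP[A B].
by rewrite in2 (negbTE A) (negbTE B) expr0.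
Qed.

Lemma prod_indD a a' : \prod_c lam c ^+ absz (ind a c + ind a' c) = lam a * lam a'.
Proof.
rewrite -!prod_ind -big_split /=; apply: eq_bigr => c _.
by rewrite -exprD /ind; congr (_ ^+ _); lia.
Qed.


Lemma height_shift i m j (Q : endpoint n) : (0 < ccw i m)%N -> (ccw i m < ccw i j)%N ->
  (ccw i j < height i Q)%N -> (0 < ccw m j)%N /\ (ccw m j < height m Q)%N.
Proof.
move=> h1 h2 h3; have mj := ccwD (ltnW h2); rewrite mj subn_gt0; split=> //.
case: Q h3 => [q|s] /= h3; last by have := ccw_lt i j; lia.
have [_|qm] := eqVneq q m; first by have := ccw_lt i j; lia.
move: h3; have [qi|qi] := eqVneq q i => h3.
  subst q; have im : i != m by rewrite -ccw_gt0.
  by have := ccw_add_back im; have := ccw_lt i j; lia.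
have E : ccw m q = (ccw i q - ccw i m)%N by apply: ccwD; lia.
by rewrite E; lia.
Qed.

Lemma big_pred2 (V : zmodType) (I : finType) (P : pred I) (u v : I) (f : I -> V) :
  u != v -> P =1 pred2 u v -> \sum_(t | P t) f t = f u + f v.
Proof.
move=> uv PE; rewrite (bigD1 u) ?PE /= ?eqxx // (bigD1 v) ?PE /= ?eqxx ?orbT 1?eq_sym //=.
rewrite big1 ?addr0 // => t; rewrite PE /=.
by case: eqP => //= _; case: eqP.
Qed.

Definition tail (a : tarc n) : 'I_n := match a with inl (i, _) => i | inr (i, _) => i end.

Lemma tail_supp a c : c \in supp a -> tail c = tail a.
Proof.
case: a => [[i j]|[i s]] /=; last by rewrite in_arcs => /eqP ->.
by case: ifP => _; rewrite !in_arcs; [case/orP|]; move=> /eqP ->.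
Qed.

Lemma setU1D1 T a a' : a' \notin T -> (a' |: (T :\ a)) :\ a' = T :\ a.
Proof.
move=> a'T; apply/setP => c; rewrite !inE.
by case: (eqVneq c a') => //= ->; rewrite (negbTE a'T) andbF.
Qed.

Lemma flip_notin core T a a' : flip_region core a a' -> tagged_triangulation T ->
  a \in T -> a' \notin T.
Proof.
case=> _ _ aa' _ _ _ triT aT; apply: contra aa' => a'T; exact: (tri_compatible triT).
Qed.

Lemma sum_rest0 T (a a' c d : tarc n) : a' \notin T -> [|| c == a, c == a', d == a | d == a'] ->
  \sum_(t | tri_valid t && (tri_supp t \subset T :\ a)) tri_form t c d = 0.
Proof.
move=> a'T E; apply: big1 => t /andP[_ /subsetP sub]; apply: tri_form0.
have out e : (e == a) || (e == a') -> e \notin tri_supp t.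
  move=> ee; apply/negP => /sub; rewrite !inE => /andP[ea eT].
  by move: ee; rewrite (negbTE ea) /= => /eqP ee; rewrite -ee eT in a'T.
move: E; rewrite orbA => /orP[] /out ->; by rewrite ?orbT.
Qed.

Lemma quad_exchange T i m j (Q : endpoint n) : tagged_triangulation T ->
  (0 < ccw i m)%N -> (ccw i m < ccw i j)%N -> (ccw i j < height i Q)%N ->
  quad_core i m j Q \subset T -> chord i j \in T ->
  exists P N R, exchange_data T (chord i j) (arc_to m Q |: (T :\ chord i j))
    (arc_to m Q) P N R.
Proof.
move=> triT h1 h2 h3 sub ijT.
have reg := quad_region h1 h2 h3.
have triT' := flip_exists reg triT sub ijT.
have bT := flip_notin reg triT ijT.
have im : i != m by rewrite -ccw_gt0.
have ij : i != j by rewrite -ccw_gt0; lia.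
have [h4 h5] := height_shift h1 h2 h3.
have mj : m != j by rewrite -ccw_gt0.
have out g c : supp g \subset quad_core i m j Q -> (c == chord i j) || (c == arc_to m Q) ->
    ind g c = 0.
  case: reg => _ _ _ A B _ /subsetP gs cc; apply: ind_supp0; apply/negP => /gs.
  by case/orP: cc => /eqP ->; apply/negP.
have imS : supp (chord i m) \subset quad_core i m j Q by rewrite /quad_core -!setUA subsetUl.
have mjS : supp (chord m j) \subset quad_core i m j Q.
  by rewrite /quad_core -!setUA; apply/subsetU/orP; right; rewrite subsetUl.
have jQS : supp (arc_to j Q) \subset quad_core i m j Q.
  by rewrite /quad_core; apply/subsetU/orP; left; rewrite subsetUr.
have iQS : supp (arc_to i Q) \subset quad_core i m j Q by rewrite /quad_core subsetUr.
(* The two monomials of the Ptolemy relation are the pairs of opposite sides. What the two triangles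
   contribute apart from the diagonal, the wedges of (m, j) with (i, m) and of (i, Q) with (j, Q),
   goes into the rest. *)
set P := fun c => ind (chord m j) c + ind (arc_to i Q) c.
set N := fun c => ind (chord i m) c + ind (arc_to j Q) c.
exists P, N, (fun c d =>
  \sum_(t | tri_valid t && (tri_supp t \subset T :\ chord i j)) tri_form t c d
  + wedge (ind (chord m j)) (ind (chord i m)) c d
  + wedge (ind (arc_to i Q)) (ind (arc_to j Q)) c d).
have := sub; rewrite quad_coreP // => /and4P[imT mjT jQT iQT].
have T'P g : supp g \subset quad_core i m j Q -> supp g \subset arc_to m Q |: (T :\ chord i j).
  case: reg => _ _ _ A _ _ /subsetP gs; apply/subsetP => c /gs cC; apply/setU1P; right.
  by apply/setD1P; split; [apply: contraNneq A => <-|apply: (subsetP sub)].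
have bT' : supp (arc_to m Q) \subset arc_to m Q |: (T :\ chord i j).
  by rewrite supp_tagged ?sub1set ?setU11 //; apply: flip_tagged2 reg.
split.
- move=> c d; rewrite (adjacency_split T (chord i j)).
  have t1 : tri_valid (i, m, inl j) && (tri_supp (i, m, inl j) \subset T).
    rewrite tri_subP h1 height_chord // h2 imT.
    by rewrite (chord_in_supp triT mjT) (chord_in_supp triT ijT).
  have t2 : tri_valid (i, j, Q) && (tri_supp (i, j, Q) \subset T).
    by rewrite tri_subP h3 (ltn_trans h1 h2) ijT jQT iQT.
  rewrite (big_pred2 _ _ (star_chord_in triT t2 t1)); last first.
    by rewrite !xpair_eqE (negbTE mj) andbF /=.
  by rewrite /tri_form /P /N /wedge /=; ring.
- move=> c d; rewrite (adjacency_split _ (arc_to m Q)) setU1D1 //.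
  have t1 : tri_valid (m, j, Q) && (tri_supp (m, j, Q) \subset arc_to m Q |: (T :\ chord i j)).
    rewrite tri_subP; apply/and5P; split=> //; last exact: T'P.
    by have := T'P _ mjS; rewrite supp_tagged // sub1set.
  have t2 : tri_valid (i, m, Q) && (tri_supp (i, m, Q) \subset arc_to m Q |: (T :\ chord i j)).
    rewrite tri_subP; apply/and5P; split=> //; [exact: ltn_trans h3| |exact: T'P].
    by have := T'P _ imS; rewrite supp_tagged // sub1set.
  have st : star (arc_to m Q |: (T :\ chord i j)) (arc_to m Q) =1 pred2 (m, j, Q) (i, m, Q).
    case: (Q) (flip_tagged2 reg) triT' t1 t2 => [q|s] tag triQ t1 t2.
      exact: (star_chord_out triQ t2 t1 tag).
    exact: (star_radius triQ t2 t1).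
  rewrite (big_pred2 _ _ st); last by rewrite !xpair_eqE (eq_sym m) (negbTE im).
  by rewrite /tri_form /P /N /wedge /=; ring.
- move=> c d E; rewrite (sum_rest0 bT E) /wedge.
  move: E; rewrite orbA => /orP[] E; rewrite !(out _ _ _ E) //; ring.
(* Arcs with different tails are distinct. The only opposite-sign sides with a common tail are (i,
   m) and (i, Q), which differ because [Q] lies beyond [j]. *)
- move=> c; rewrite /P /N /ind.
  have tl g : c \in supp g -> tail c = tail g by apply: tail_supp.
  have tQ k : tail (arc_to k Q) = k by case: (Q).
  have A : ~~ ((c \in supp (chord m j)) && (c \in supp (chord i m))).
    by apply/negP => /andP[/tl E /tl]; rewrite E /= => mi; rewrite mi eqxx in im.
  have B : ~~ ((c \in supp (chord m j)) && (c \in supp (arc_to j Q))).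
    by apply/negP => /andP[/tl E /tl]; rewrite E tQ /= => jm; rewrite jm eqxx in mj.
  have C : ~~ ((c \in supp (arc_to i Q)) && (c \in supp (arc_to j Q))).
    by apply/negP => /andP[/tl E /tl]; rewrite E !tQ /= => jm; rewrite jm eqxx in ij.
  have D : ~~ ((c \in supp (arc_to i Q)) && (c \in supp (chord i m))).
    apply/negP => /andP[A1 A2]; move: A2 A1; rewrite in_supp_tagged // => /eqP ->.
    rewrite in_supp_chord // => /eqP /chord_arc_to[_ QE]; move: h3; rewrite QE height_chord //.
    by rewrite ltnNge (ltnW h2).
  move: A B C D; case: (c \in _); case: (c \in _) => //; case: (c \in _) => //;
    case: (c \in _) => //.
- by move=> c; rewrite /P /N /ind; split; apply: addr_ge0.
- move=> c E; rewrite setU1D1 //; rewrite andbb.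
  have : c \in quad_core i m j Q.
    apply: contraT => cC; move: E; rewrite /P /N.
    have out' g : supp g \subset quad_core i m j Q -> ind g c = 0.
      by move=> /subsetP gs; apply: ind_supp0; apply: contra cC => /gs.
    by rewrite !out' // addr0 eqxx.
  move=> cC; apply/setD1P; split; last exact: (subsetP sub).
  by apply: contraNneq (flip_notin1 reg) => <-.
- by rewrite !prod_indD (lam_quad _ _ h1 h2 h3) addrC.
Qed.

Lemma ind_loop j s c : ind (chord j j) c = ind (radius j s) c + ind (radius j (~~ s)) c.
Proof.
rewrite /ind /= eqxx !in_arcs !(eq_sym c).
have : ~~ ((radius j true == c) && (radius j false == c)).
  by apply/negP => /andP[/eqP <- /eqP []].
by case: s => /=; case: eqP; case: eqP.
Qed.

(** Before the flip the two triangles of the digon meet at the puncture; afterwards there is only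
    the triangle inside the loop at [j]. The forms match because the loop counts as the sum of its
    two radii. *)
Lemma digon_exchange T i j s : tagged_triangulation T -> i != j ->
  digon_core i j s \subset T -> radius i s \in T ->
  exists P N R, exchange_data T (radius i s) (radius j (~~ s) |: (T :\ radius i s))
    (radius j (~~ s)) P N R.
Proof.
move=> triT ij sub iT.
have reg := digon_region s ij.
have triT' := flip_exists reg triT sub iT.
have bT := flip_notin reg triT iT.
have ji : j != i by rewrite eq_sym.
set T' := _ |: _ in triT' *.
have out g c : g \in digon_core i j s -> is_tagged_arc g ->
    (c == radius i s) || (c == radius j (~~ s)) -> ind g c = 0.
  case: reg => _ _ _ A B _ gs gt cc; apply: ind_supp0; rewrite in_supp_tagged //.
  by case/orP: cc => /eqP ->; [apply: contraNneq A|apply: contraNneq B] => ->.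
have ijC : chord i j \in digon_core i j s by rewrite /digon_core !inE eqxx.
have jiC : chord j i \in digon_core i j s by rewrite /digon_core !inE eqxx ?orbT.
have jC : radius j s \in digon_core i j s by rewrite /digon_core !inE eqxx ?orbT.
have subT' g : g \in digon_core i j s -> g \in T'.
  case: reg => _ _ _ A _ _ gC; apply/setU1P; right.
  by apply/setD1P; split; [apply: contraNneq A => <-|apply: (subsetP sub)].
have bT' : radius j (~~ s) \in T' by rewrite setU11.
exists (ind (chord j i)), (ind (chord i j)), (fun c d =>
  \sum_(t | tri_valid t && (tri_supp t \subset T :\ radius i s)) tri_form t c d
  + wedge (ind (radius j s)) (ind (chord i j)) c d
  + wedge (ind (chord j i)) (ind (radius j s)) c d).
have h k l : (ccw k l < height k (inr s : endpoint n))%N by rewrite /=; have := ccw_lt k l; lia.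
split.
- move=> c d; rewrite (adjacency_split T (radius i s)).
  have t1 : tri_valid (i, j, inr s) && (tri_supp (i, j, inr s) \subset T).
    by rewrite tri_subP h ccw_gt0 ij /= !sub1set iT !(subsetP sub).
  have t2 : tri_valid (j, i, inr s) && (tri_supp (j, i, inr s) \subset T).
    by rewrite tri_subP h ccw_gt0 ji /= !sub1set iT !(subsetP sub).
  rewrite (big_pred2 _ _ (star_radius triT t2 t1)) ?xpair_eqE ?(negbTE ij) //.
  by rewrite /tri_form /wedge /=; ring.
- move=> c d; rewrite (adjacency_split _ (radius j (~~ s))) setU1D1 //.
  have t1 : tri_valid (j, i, inl j) && (tri_supp (j, i, inl j) \subset T').
    rewrite tri_subP height_loop ccw_lt ccw_gt0 ji subT' //=.
    rewrite (negbTE ij) eqxx sub1set subT' //=.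
    have jT' := subT' _ jC.
    by apply/subsetP => y /set2P[]->; case: (s) jT' bT'.
  rewrite (eq_bigl _ _ (star_loop triT' bT' t1)) big_pred1_eq.
  have -> : tri_form (j, i, inl j) c d = wedge (ind (chord j i)) (ind (chord j j)) c d
    + wedge (ind (chord j j)) (ind (chord i j)) c d
    + wedge (ind (chord i j)) (ind (chord j i)) c d by [].
  by rewrite /wedge !(ind_loop j s); ring.
- move=> c d E; rewrite (sum_rest0 bT E) /wedge.
  move: E; rewrite orbA => /orP[] E; rewrite !(out _ _ _ _ E) //; ring.
- move=> c; rewrite !ind_tagged //; have [->|_] := eqVneq c (chord j i); last by rewrite mul0r.
  by rewrite (chord_eq i) ccwii eq_sym -{1}(ccwii i) -eq_ccw (negbTE ij).
- by move=> c; rewrite /ind.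
- move=> c E; rewrite setU1D1 // andbb.
  have cC : c \in digon_core i j s.
    move: E; rewrite !ind_tagged //; have [->//|_] := eqVneq c (chord j i).
    by have [->|] := eqVneq c (chord i j).
  apply/setD1P; split; last exact: (subsetP sub).
  by apply: contraNneq (flip_notin1 reg) => <-.
- by rewrite !prod_ind lam_digon // addrC.
Qed.

Lemma setU1D1K T a a' : a \in T -> a' \notin T -> a |: ((a' |: (T :\ a)) :\ a') = T.
Proof. by move=> aT a'T; rewrite setU1D1 // setD1K. Qed.

Lemma flip_exchange T a a' : flip_move T a a' -> tagged_triangulation T -> a \in T ->
  exists P N R, exchange_data T a (a' |: (T :\ a)) a' P N R.
Proof.
move=> mv triT aT; have triT' := flip_move_triangulation mv triT aT.
have mv' := flip_move_sym mv aT; have a'T' : a' \in a' |: (T :\ a) by rewrite setU11.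
have a'T : a' \notin T by have [core reg _] := flip_move_region mv; apply: flip_notin reg triT aT.
case: mv aT triT' mv' a'T' a'T => [i m j Q h1 h2 h3 sub|i m j Q h1 h2 h3 sub|i j s ij sub|i j s ij sub] aT triT' mv' a'T' a'T.
- exact: quad_exchange.
- have sub' : quad_core i m j Q \subset chord i j |: (T :\ arc_to m Q).
    apply/subsetP => c cC; apply/setU1P; right; apply/setD1P; split; last exact: (subsetP sub).
    by apply: contraNneq (flip_notin2 (quad_region h1 h2 h3)) => <-.
  have [P [N [R ex]]] := quad_exchange triT' h1 h2 h3 sub' a'T'.
  by rewrite setU1D1K // in ex; do 3 eexists; apply: exchange_data_sym ex.
- exact: digon_exchange.
- have sub' : digon_core i j s \subset radius i s |: (T :\ radius j (~~ s)).
    apply/subsetP => c cC; apply/setU1P; right; apply/setD1P; split; last exact: (subsetP sub).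
    by apply: contraNneq (flip_notin2 (digon_region s ij)) => <-.
  have [P [N [R ex]]] := digon_exchange triT' ij sub' a'T'.
  by rewrite setU1D1K // in ex; do 3 eexists; apply: exchange_data_sym ex.
Qed.

End Adjacency.

Import Order.TTheory.

(** * Seeds *)

Section Specialization.
Variables (A : idomainType) (K : fieldType) (h : {rmorphism A -> K}).
Implicit Types (f g : {fraction A}) (u v : K).

(** Evaluation of a fraction is partial, being defined when some denominator survives under [h];
    hence a relation rather than a function. *)
Definition specializes f v : Prop :=
  exists P Q : A, [/\ h Q != 0, f * tofrac Q = tofrac P & v * h Q = h P].

Lemma specializes_uniq f u v : specializes f u -> specializes f v -> u = v.
Proof.
move=> [P [Q [Q0 fQ uQ]]] [P' [Q' [Q0' fQ' vQ]]].
have E : P * Q' = P' * Q.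
  by apply/eqP; rewrite -tofrac_eq !rmorphM /= -fQ -fQ'; apply/eqP; ring.
apply: (mulIf Q0); apply: (mulIf Q0'); rewrite uQ [RHS]mulrAC vQ -!rmorphM.
by rewrite E.
Qed.

Lemma specializes_tofrac (a : A) : specializes (tofrac a) (h a).
Proof. by exists a, 1; rewrite !rmorph1 !mulr1 oner_neq0. Qed.

Lemma specializes1 : specializes 1 1.
Proof. by have := specializes_tofrac 1; rewrite !rmorph1. Qed.

Lemma specializes0 : specializes 0 0.
Proof. by have := specializes_tofrac 0; rewrite !rmorph0. Qed.

Lemma specializesD f g u v : specializes f u -> specializes g v -> specializes (f + g) (u + v).
Proof.
move=> [P [Q [Q0 fQ uQ]]] [P' [Q' [Q0' fQ' vQ]]].
exists (P * Q' + P' * Q), (Q * Q'); split; first by rewrite rmorphM mulf_neq0.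
  by rewrite rmorphD !rmorphM /= -fQ -fQ'; ring.
by rewrite rmorphD !rmorphM /= -uQ -vQ; ring.
Qed.

Lemma specializesN f u : specializes f u -> specializes (- f) (- u).
Proof.
move=> [P [Q [Q0 fQ uQ]]]; exists (- P), Q; rewrite !rmorphN Q0.
by rewrite !mulNr fQ uQ.
Qed.

Lemma specializesB f g u v : specializes f u -> specializes g v -> specializes (f - g) (u - v).
Proof. by move=> fu /specializesN; apply: specializesD. Qed.

Lemma specializesM f g u v : specializes f u -> specializes g v -> specializes (f * g) (u * v).
Proof.
move=> [P [Q [Q0 fQ uQ]]] [P' [Q' [Q0' fQ' vQ]]].
exists (P * P'), (Q * Q'); split; first by rewrite rmorphM mulf_neq0.
  by rewrite !rmorphM /= -fQ -fQ'; ring.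
by rewrite !rmorphM /= -uQ -vQ; ring.
Qed.

Lemma specializesV f u : u != 0 -> specializes f u -> specializes f^-1 u^-1.
Proof.
move=> u0 [P [Q [Q0 fQ uQ]]].
have P0 : h P != 0 by rewrite -uQ mulf_neq0.
have f0 : f != 0.
  apply: contraNneq P0 => f0; move: fQ; rewrite f0 mul0r => /esym/eqP.
  by rewrite tofrac_eq0 => /eqP ->; rewrite rmorph0.
exists Q, P; split=> //; first by rewrite -fQ mulrA mulVf ?mul1r.
by rewrite -uQ mulrA mulVf ?mul1r.
Qed.

Lemma specializes_sum (I : finType) (D : pred I) (F : I -> {fraction A}) (G : I -> K) :
  (forall i, specializes (F i) (G i)) ->
  specializes (\sum_(i | D i) F i) (\sum_(i | D i) G i).
Proof.
move=> FG; elim/big_rec2: _ => [|i u f _ H]; first exact: specializes0.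
exact: specializesD.
Qed.

Lemma specializes_lam n (x b : 'I_n -> {fraction A}) (x' b' : 'I_n -> K) (a : tarc n) :
  (forall i, specializes (x i) (x' i)) -> (forall i, specializes (b i) (b' i)) ->
  (forall i, x' i != 0) -> specializes (lam x b a) (lam x' b' a).
Proof.
move=> xx bb x0.
have part m : specializes (partial_length x b m) (partial_length x' b' m).
  apply: specializes_sum => i; apply: specializesM => //; apply: specializesV.
    by rewrite mulf_neq0.
  exact: specializesM.
case: a => [[i j]|[i []]] //=; last by apply: specializesM => //; apply: part.
apply: specializesM; first exact: specializesM.
apply: specializesD; first exact: specializesB.
by case: ifP => _; [exact: part | exact: specializes0].
Qed.

End Specialization.

Lemma mpoly_mmap_spec (R : comNzRingType) m (v : 'I_m -> R) :
  exists h : {rmorphism {mpoly int[m]} -> R}, forall i, h 'X_i = v i.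
Proof.
exists (mmap (intr : int -> R) v : {rmorphism _ -> _}) => i /=.
by rewrite mmapX mmap1U.
Qed.

(** * Seeds carry the lambda lengths and the adjacency form of their triangulation *)

Section Seeds.
Definition is_inl (A B : Type) (x : A + B) : bool := if x is inl _ then true else false.
Variable n : nat.
Hypothesis n_gt2 : (2 < n)%N.
Implicit Types (i j k l m : 'I_n) (T : {set tarc n}) (S : seed n).

Let n_gt1 : (1 < n)%N. Proof. exact: ltnW. Qed.

Definition xvar i : ambient n := var0 (inl i).
Definition bvar i : ambient n := var0 (inr i).

Definition lamvar : tarc n -> ambient n := lam xvar bvar.

(** Setting all initial variables to 1 makes chord lengths count boundary segments, which is how
    lambda lengths are seen to be nonzero. *)
Lemma lam1 i j : i != j ->
  lam (fun=> 1 : rat) (fun=> 1) (chord i j) = (ccw i j)%:R.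
Proof.
have part (m : nat) : (m <= n)%N -> partial_length (n := n) (fun=> 1 : rat) (fun=> 1) m = m%:R.
  move=> mn; rewrite /partial_length.
  rewrite -(big_ord_widen n (fun=> 1 / (1 * 1) : rat)) // big_const_ord iter_addr_0.
  by rewrite (_ : 1 / (1 * 1) = 1 :> rat).
move=> ij; rewrite /= !mul1r /sector /total_length !part ?(ltnW (ltn_ord _)) //.
have := ltn_ord i; have := ltn_ord j; rewrite ccwE => hj hi.
have [le|lt] := leqP i j.
  have -> : (j <= i)%N = false by case: ltngtP le ij => // /val_inj ->; rewrite eqxx.
  by rewrite addr0 natrB.
by rewrite (ltnW lt) natrB ?natrD; [ring | lia].
Qed.

Lemma lamvar_neq0 a : is_tagged_arc a -> lamvar a != 0.
Proof.
move=> ta; have [h hX] := mpoly_mmap_spec (fun=> 1 : rat) (m := n + n).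
have sp d : specializes h (var0 (d : dir n)) 1.
  by have := specializes_tofrac h 'X_(unsplit d); rewrite hX.
have := specializes_lam a (fun i => sp (inl i)) (fun i => sp (inr i)) (fun=> oner_neq0 _).
move=> H; apply/eqP => E; rewrite -/xvar -/bvar -/lamvar E in H.
have {H}E := specializes_uniq (specializes0 h) H.
have [i0 j0] : 'I_n * 'I_n by split; exists 0%N; lia.
(* By the digon relation the total length is a sum of two natural numbers, one of which is 1. *)
have tot : lam (fun=> 1 : rat) (fun=> 1) (radius i0 true) != 0.
  rewrite -[lam _ _ _]mulr1 -[X in _ * X]/(lam (fun=> 1 : rat) (fun=> 1) (radius (ordS i0) (~~ true))).
  rewrite lam_digon ?ordS_neq // !lam1 ?ordS_neq ?(eq_sym _ i0) ?ordS_neq //.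
  by rewrite -natrD pnatr_eq0 -lt0n addn_gt0 ccw_ordS.
case: a ta E => [[i j]|[i [] ]] ta.
- have ij : i != j := ta.
  by rewrite lam1 // => /esym/eqP; rewrite pnatr_eq0 -leqn0 leqNgt ccw_gt0 ij.
- by move=> E; move: tot; rewrite /= E /= eqxx.
- by move=> /= /esym/eqP; rewrite oner_eq0.
Qed.

Definition initial_arcs : {set tarc n} := [set arc0 d | d : dir n].

Lemma arc0_inj : injective (@arc0 n).
Proof. by case=> i [] j //= [->]. Qed.

Lemma initial_arcsP a : reflect
  (match a with inl (i, j) => j = ordS i | inr (i, notched) => notched = false end)
  (a \in initial_arcs).
Proof.
apply: (iffP imsetP) => [[[i|i] _ ->] //|]; case: a => [[i j]|[i s]] ->.
  by exists (inr i).
by exists (inl i).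
Qed.

Definition star_arcs (s : bool) : {set tarc n} :=
  [set a | match a with inl (i, j) => j == ordS i | inr (i, t) => t == s end].

Lemma star_triangulation s : tagged_triangulation (star_arcs s).
Proof.
have rT j : radius j s \in star_arcs s by rewrite inE /= eqxx.
apply/triangulationP; split.
- by move=> a; rewrite inE; case: a => [[i j]|[i t]] //= /eqP ->; apply: ordS_neq.
- move=> a c; rewrite !inE.
  case: a c => [[i j]|[i t]] [[k l]|[k t']] /eqP -> /eqP ->.
  + by apply: (boundary_compatible n_gt1); rewrite /= ordS_neq.
  + by rewrite compatible_sym; apply: (boundary_compatible n_gt1).
  + exact: (boundary_compatible n_gt1).
  + by rewrite /compatible /= eqxx orbT.
- move=> e te ce; rewrite inE; case: e te ce => [[i j]|[i t]] te ce.
    have ij : i != j := te.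
    rewrite ordS_ccw // eqn_leq ccw_gt0 ij andbT leqNgt.
    apply/negP => lt; have := ce _ (rT (ordS i)).
    by rewrite compatible_chord_radius /= ccw_ordS // lt.
  have := ce _ (rT (ordS i)).
  by rewrite /compatible /= (negbTE (ordS_neq _ _)).
Qed.

Lemma initial_arcsE : initial_arcs = star_arcs false.
Proof.
apply/setP => a; rewrite inE; apply/initial_arcsP/idP; case: a => [[i j]|[i s]];
  by [move=> -> | move/eqP].
Qed.

Lemma initial_triangulation : tagged_triangulation initial_arcs.
Proof. by rewrite initial_arcsE; apply: star_triangulation. Qed.

Lemma initial_adjacency (c d : dir n) :
  adjacency initial_arcs (arc0 c) (arc0 d) = exch0 c d.
Proof.
have n1 := n_gt1.
(* Every triangle of the initial triangulation joins two consecutive vertices to the puncture; a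
   third vertex on the boundary would require a loop or a chord longer than an edge. *)
rewrite /adjacency (reindex_onto (fun m => (m, ordS m, inr false)) (fun t => t.1.1)) /=; last first.
  move=> [[i m] Q]; rewrite -/(tri_valid (i, m, Q)) -/(tri_supp (i, m, Q)) tri_subP.
  case/and5P => h1 h2 /initial_arcsP -> _ /subsetP; rewrite /arc_to.
  case: Q h2 => [q|s] h2 sub; last first.
    by have /initial_arcsP -> := sub (radius i s) (set11 _).
  have [qi|qi] := eqVneq i q.
    by have := sub (radius i true); rewrite /= qi eqxx !inE eqxx => /(_ isT)/initial_arcsP.
  have := sub (chord i q); rewrite /= (negbTE qi) inE eqxx => /(_ isT)/initial_arcsP E.
  move: h2 h1; rewrite height_chord // E ccw_ordS //; case: (ccw i m) => //.
apply: eq_big => m.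
  rewrite eqxx andbT ccw_ordS // ltnS; apply/andP; split; first by have := n_gt1; lia.
  rewrite !subUset (negbTE (ordS_neq n1 m)) !sub1set.
  by apply/andP; split; [apply/andP; split|]; apply/initial_arcsP.
move=> _; rewrite /wedge /ind !in_supp_tagged //; try exact: ordS_neq.
rewrite -[chord m (ordS m)]/(arc0 (inr m)) -[radius m false]/(arc0 (inl m)).
rewrite -[radius (ordS m) false]/(arc0 (inl (ordS m))) !(inj_eq arc0_inj) /follows.
have excl e : [&& ~~ ((e == inr m) && (e == inl m)), ~~ ((e == inr m) && (e == inl (ordS m)))
    & ~~ ((e == inl m) && (e == inl (ordS m)))].
  apply/and3P; split; apply/negP => /andP[/eqP -> /eqP] // [E].
  by have := ordS_neq n1 m; rewrite -E eqxx.
have := excl c; have := excl d.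
by do 6![case: (_ == _)].
Qed.

(** The invariant of mutation: variables and exchange entries are determined by the arcs of the
    seed, whatever the path of flips that led to it. *)
Record seed_ok S : Prop := SeedOk {
  ok_tri : tagged_triangulation (seed_arcs S);
  ok_inj : injective (arc_of S);
  ok_frozen : forall i, arc_of S (inr i) = chord i (ordS i);
  ok_var : forall d, var S d = lamvar (arc_of S d);
  ok_exch : forall c d, is_inl c || is_inl d ->
    exch S c d = adjacency (seed_arcs S) (arc_of S c) (arc_of S d) }.

Lemma initial_ok : seed_ok (Seed (@arc0 n) (@exch0 n) (@var0 n)).
Proof.
split=> //.
- exact: initial_triangulation.
- exact: arc0_inj.
- move=> [i|i] //; apply/esym/lam_boundary => // j.
  by apply: (@lamvar_neq0 (radius j false)).
- by move=> c d _; apply/esym/initial_adjacency.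
Qed.

Lemma arc_of_in S d : arc_of S d \in seed_arcs S.
Proof. by apply/imsetP; exists d. Qed.

Lemma upd_other (U : Type) (f : dir n -> U) i u d : d != inl i -> upd f i u d = f d.
Proof. by rewrite /upd => /negbTE ->. Qed.

Lemma upd_same (U : Type) (f : dir n -> U) i u : upd f i u (inl i) = u.
Proof. by rewrite /upd eqxx. Qed.

Lemma seed_arcs_upd S i a e v : injective (arc_of S) ->
  seed_arcs (Seed (upd (arc_of S) i a) e v) =
  a |: (seed_arcs S :\ arc_of S (inl i)).
Proof.
move=> inj; apply/setP => c; apply/imsetP/setU1P => [[d _ ->] /=|[->|/setD1P[ca /imsetP[d _ cd]]]].
- have [->|di] := eqVneq d (inl i); first by left; rewrite upd_same.
  right; rewrite upd_other //; apply/setD1P; split; last exact: arc_of_in.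
  by rewrite (inj_eq inj).
- by exists (inl i) => //=; rewrite upd_same.
- exists d => //=; rewrite upd_other //; apply: contraNneq ca => dE.
  by rewrite cd dE.
Qed.

Lemma posneg_part (p q : int) : 0 <= p -> 0 <= q -> p * q = 0 ->
  Num.max (p - q) 0 = p /\ Num.min (p - q) 0 = - q.
Proof.
move=> p0 q0 /eqP; rewrite mulf_eq0 => /orP[] /eqP ->.
  by rewrite sub0r; split; [apply/max_idPr|apply/min_idPl]; rewrite oppr_le0.
by rewrite subr0 oppr0; split; [apply/max_idPl|apply/min_idPr].
Qed.

Lemma seed_flip_ok S i a : seed_ok S -> a != arc_of S (inl i) ->
  let S' := Seed (upd (arc_of S) i a) (exch_mut (exch S) i)
                 (upd (var S) i (var_mut S i)) in
  tagged_triangulation (seed_arcs S') -> seed_ok S'.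
Proof.
move=> ok aNE S'; have [triT inj frozen varE exE] := ok.
set T := seed_arcs S in triT exE *; set al := arc_of S (inl i) in aNE *.
have TE' : seed_arcs S' = a |: (T :\ al) by apply: seed_arcs_upd.
move=> triT'; rewrite TE' in triT'.
have alT : al \in T by apply: arc_of_in.
have mut k : al != chord k (ordS k) by rewrite -frozen (inj_eq inj).
have [b mv] := flip_move_exists n_gt1 triT alT mut.
(* A seed may be flipped to any new arc that yields a triangulation; uniqueness of flips identifies
   this arc with that of the flip move. *)
have ab := flip_move_unique mv triT alT aNE triT'.
rewrite -{b}ab in mv.
have [P [N [R ex]]] := flip_exchange n_gt1 xvar bvar mv triT alT.
rewrite -TE' in ex triT'; set T' := seed_arcs S' in ex triT'.
have aT : a \notin T by have [core reg _] := flip_move_region mv; apply: flip_notin reg triT alT.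
have tal : is_tagged_arc al by apply: tri_tagged alT.
have ta : is_tagged_arc a by apply: (tri_tagged triT'); rewrite /T' TE' setU11.
have [bef aft rest disj ge0 sub lamE] := ex.
have out c : (c == al) || (c == a) -> P c = 0 /\ N c = 0.
  move=> ca; have [|] := boolP ((P c != 0) || (N c != 0)).
    by move/sub => /andP[/setD1P[A _] /setD1P[B _]]; rewrite (negbTE A) (negbTE B) in ca.
  by rewrite negb_or !negbK => /andP[/eqP -> /eqP ->].
have [Pal Nal] : P al = 0 /\ N al = 0 by apply: out; rewrite eqxx.
have [Pa Na] : P a = 0 /\ N a = 0 by apply: out; rewrite eqxx orbT.
(* [P] and [N] are nonnegative with product 0, so they are the positive and negative parts of their
   difference. *)
have pn c : [/\ Num.max (P c - N c) 0 = P c, Num.min (P c - N c) 0 = - N c,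
    Num.max (N c - P c) 0 = N c & Num.min (N c - P c) 0 = - P c].
  have [p0 q0] := ge0 c; have [-> ->] := posneg_part p0 q0 (disj c).
  by have [|-> ->] := posneg_part q0 p0 _; rewrite 1?mulrC ?disj.
have eNal d : d != inl i -> arc_of S d == al = false by move=> di; rewrite (inj_eq inj); apply/negbTE.
have eNa d : arc_of S d == a = false.
  by apply/negbTE; apply: contraNneq aT => <-; apply: arc_of_in.
have exl d : d != inl i -> exch S d (inl i) = N (arc_of S d) - P (arc_of S d).
  move=> di; rewrite exE ?orbT // -/al bef rest ?eqxx ?orbT // /wedge.
  by rewrite !ind_tagged // eNal // eqxx Pal Nal /=; ring.
have exr d : d != inl i -> exch S (inl i) d = P (arc_of S d) - N (arc_of S d).
  move=> di; rewrite exE // -/al bef rest ?eqxx ?orbT // /wedge.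
  by rewrite !ind_tagged // eNal // eqxx Pal Nal /=; ring.
have exii : exch S (inl i) (inl i) = 0.
  rewrite exE // -/al bef rest ?eqxx // /wedge Pal Nal /=; ring.
(* Mutation multiplies over the directions of the seed, the exchange relation over all arcs; the
   products agree because the exponents vanish off [T] and at the flipped arc. *)
have prodE (G : tarc n -> int) (f : dir n -> int) :
    (forall d, d != inl i -> f d = G (arc_of S d)) -> f (inl i) = 0 -> G al = 0 ->
    (forall c, G c != 0 -> c \in T) ->
    \prod_d var S d ^+ absz (f d) = \prod_c lamvar c ^+ absz (G c).
  move=> fG f0 G0 GT; rewrite [RHS](bigID (mem T)) /=.
  rewrite [X in _ * X]big1 ?mulr1; last first.
    move=> c cT; have -> : G c = 0 by apply/eqP; apply: contraNT cT => /GT.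
    by rewrite expr0.
  rewrite big_imset /=; last by move=> c d _ _; apply: inj.
  apply: eq_big => // d _; rewrite varE.
  by have [->|di] := eqVneq d (inl i); rewrite ?f0 ?G0 // fG.
have subT c : (P c != 0) || (N c != 0) -> c \in T.
  by move/sub => /andP[/setD1P[]].
have varmutE : var_mut S i = lamvar a.
  rewrite /var_mut varE -/al.
  rewrite (prodE N) ?(prodE P) //.
  - by rewrite addrC -lamE mulrC mulKf // lamvar_neq0.
  - by move=> d di; rewrite exl // opprB; have [-> _ _ _] := pn (arc_of S d).
  - by rewrite exii oppr0; apply/max_idPl.
  - by move=> c c0; apply: subT; rewrite c0.
  - by move=> d di; rewrite exl //; have [_ _ -> _] := pn (arc_of S d).
  - by rewrite exii; apply/max_idPl.
  - by move=> c c0; apply: subT; rewrite c0 orbT.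
have updE d : arc_of S' d = if d == inl i then a else arc_of S d by [].
split.
- exact: triT'.
- move=> c d; rewrite !updE; case: eqP => [->|_]; case: eqP => [->|_] //.
  + by move/esym/eqP; rewrite eNa.
  + by move/eqP; rewrite eNa.
  + exact: inj.
- by move=> k; rewrite updE /= frozen.
- move=> d; rewrite updE /= /upd; case: eqP => _; first exact: varmutE.
  exact: varE.
- move=> c d cd; rewrite -/T' aft !updE /= /exch_mut.
  have [ci|ci] := eqVneq c (inl i); have [di|di] := eqVneq d (inl i).
  + by subst; rewrite exii rest ?eqxx ?orbT // /wedge Pa Na /=; ring.
  + subst c; rewrite /= exr // rest ?eqxx ?orbT // /wedge !ind_tagged // eqxx eNa Pa Na /=; ring.
  + subst d; rewrite /= exl // rest ?eqxx ?orbT // /wedge !ind_tagged // eqxx eNa Pa Na /=; ring.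
  + rewrite /= exl // exr //; have [_ _ -> ->] := pn (arc_of S c).
    have [-> -> _ _] := pn (arc_of S d).
    rewrite exE // bef /wedge !ind_tagged // !eNa !eNal //=; ring.
Qed.

Lemma surface_seed_ok S : surface_seed S -> seed_ok S.
Proof.
elim=> [|S0 i a _ ok aN S' triT']; first exact: initial_ok.
exact: seed_flip_ok.
Qed.

End Seeds.

(** * Every tagged triangulation is reached by flips *)

Section Reachability.
Variable n : nat.
Hypothesis n_gt2 : (2 < n)%N.
Implicit Types (i j k l m : 'I_n) (T : {set tarc n}) (S : seed n).

Let n_gt1 : (1 < n)%N. Proof. exact: ltnW. Qed.

Definition reachable T : Prop := exists2 S, surface_seed S & seed_arcs S = T.

Lemma reachable_flip T a b : tagged_triangulation T -> a \in T -> flip_move T a b ->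
  reachable T -> reachable (b |: (T :\ a)).
Proof.
move=> triT aT mv [S seedS TE]; have ok := surface_seed_ok n_gt2 seedS.
have [core reg sub] := flip_move_region mv; have [ta tb ab _ _ _] := reg.
have triT' := flip_move_triangulation mv triT aT.
have [[i|i] aE] : exists d, a = arc_of S d.
- by move: aT; rewrite -TE => /imsetP[d _ ->]; exists d.
- have baN : b != arc_of S (inl i).
    by rewrite -aE; apply: contraNneq ab => ->; apply: compatible_refl.
  exists (Seed (upd (arc_of S) i b) (exch_mut (exch S) i) (upd (var S) i (var_mut S i))).
    by apply: surface_seed_flip => //; rewrite seed_arcs_upd ?TE -?aE //; apply: ok_inj.
  by rewrite seed_arcs_upd ?TE -?aE //; apply: ok_inj.
- by move: ab; rewrite aE (ok_frozen ok) compatible_sym (boundary_compatible n_gt1).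
Qed.

(** Flips are reversible, so it suffices to lead a triangulation towards the initial one. *)
Lemma reachable_unflip T a b : tagged_triangulation T -> a \in T -> flip_move T a b ->
  reachable (b |: (T :\ a)) -> reachable T.
Proof.
move=> triT aT mv reach.
have bT : b \notin T by have [core reg _] := flip_move_region mv; apply: flip_notin reg triT aT.
rewrite -(setU1D1K aT bT); apply: reachable_flip => //.
- exact: flip_move_triangulation mv triT aT.
- exact: setU11.
- exact: flip_move_sym.
Qed.

Definition plain T : {set 'I_n} := [set i | radius i false \in T].
Definition unnotched T : {set 'I_n} := [set i | radius i true \notin T].

Lemma flip_radius_tag T i s b k : flip_move T (radius i s) b -> b != radius k s.
Proof.
move E : (radius i s) => a mv; case: mv E => {a b} [i' m j Q _ _ _ _|i' m j Q _ _ _ _|i' j t _ _|i' j t _ _] //.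
- by case=> _ ->; apply/eqP => -[_]; case: t.
- by case=> _ ->; apply/eqP => -[_]; case: t.
Qed.

Lemma all_plain T i0 : radius i0 false \in T ->
  (forall i, radius i false \in T -> radius (ordS i) false \in T) ->
  forall j, radius j false \in T.
Proof.
move=> i0T step j; move E : (ccw i0 j) => d; elim: d j E => [|d IH] j E.
  have /eqP <- // : i0 == j by rewrite (eq_ccw i0) ccwii E.
rewrite -(ord_predK j); apply/step/IH.
have : ccw (ord_pred j) j = 1%N by apply/eqP; rewrite -ordS_ccw // ord_predK.
have := ccwP i0 (ord_pred j) j; rewrite E; clear -n_gt1; lia.
Qed.

(** Flipping a notched radius never creates another notched one. Once all radii are plain, a chord
    between the ends of two consecutive radii at non-adjacent vertices can be traded for a plain
    radius. Either way the count of plain radii and of vertices without a notched radius grows. *)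
Lemma progress T : tagged_triangulation T -> T <> initial_arcs n ->
  exists a b, [/\ a \in T, flip_move T a b &
    (#|plain T| + #|unnotched T| <
     #|plain (b |: (T :\ a))| + #|unnotched (b |: (T :\ a))|)%N].
Proof.
move=> triT T0.
have sub1 a b : (forall i, a != radius i false) -> plain T \subset plain (b |: (T :\ a)).
  move=> aN; apply/subsetP => i; rewrite !inE => ->.
  by rewrite (eq_sym _ a) aN orbT.
have sub2 a b : (forall i, b != radius i true) -> unnotched T \subset unnotched (b |: (T :\ a)).
  by move=> bN; apply/subsetP => i; rewrite !inE => /negbTE ->; rewrite (eq_sym _ b) (negbTE (bN i)) andbF.
have [/existsP[i iT]|/existsPn N] := boolP [exists i, radius i true \in T].
  have [b mv] := flip_move_exists n_gt1 triT iT (fun _ => isT).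
  exists (radius i true), b; split=> //.
  rewrite -addnS; apply: leq_add.
    by apply/subset_leq_card/sub1 => k; rewrite (radius_eq k) andbF.
  apply/proper_card/properP; split; first by apply: sub2 => k; apply: flip_radius_tag mv.
  exists i; rewrite !inE ?iT //.
  by rewrite eqxx eq_sym (negbTE (flip_radius_tag i mv)).
have [i0 [s i0T]] := radius_exists n_gt1 triT.
have s0 : s = false by case: s i0T => // i0T; have := N i0; rewrite i0T.
subst s.
have [/forall_inP all|] := boolP [forall i in plain T, ordS i \in plain T].
  case: T0; have allT : forall j, radius j false \in T.
    by apply: (all_plain i0T) => i iT; have := all i; rewrite !inE iT; apply.
  apply/eqP; rewrite eq_sym eqEsubset.
  have sub : initial_arcs n \subset T.
    by apply/subsetP => _ /imsetP[[j|j] _ ->]; [apply: allT | apply: boundary_in].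
  rewrite sub; apply/subsetP => e eT.
  case/triangulationP: (initial_triangulation n_gt2) => _ _; apply.
    exact: tri_tagged eT.
  by move=> a /(subsetP sub) aT; apply: (tri_compatible triT).
case/forall_inPn => i; rewrite !inE => iT SiT.
have [|[j [ij ijT jT]]] := next_radius n_gt1 triT iT; first by rewrite (negbTE (N i)).
have h2 : (1 < height i (inl j))%N.
  rewrite height_chord // ltn_neqAle ccw_gt0 ij andbT eq_sym -ordS_ccw //.
  by apply: contraNneq SiT => <-.
have [m [m0 mh imT mjT]] := split_region n_gt1 triT (chord_in_supp triT ijT) h2.
rewrite height_chord // in mh.
have mv : flip_move T (chord i j) (radius m false).
  apply: (@FlipChord n T i m j (inr false)) => //=; first by have := ccw_lt i j; lia.
  rewrite quad_coreP ?(chord_neq triT) // imT mjT /= !sub1set jT iT //.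
exists (chord i j), (radius m false); split=> //.
have mT : radius m false \notin T.
  by have [core reg _] := flip_move_region mv; apply: flip_notin reg triT ijT.
rewrite -addSn; apply: leq_add; last first.
  by apply/subset_leq_card/sub2 => k; rewrite (radius_eq k) andbF.
apply/proper_card/properP; split; first exact: sub1.
by exists m; rewrite !inE ?eqxx // (negbTE mT).
Qed.

Lemma reachable_all T : tagged_triangulation T -> reachable T.
Proof.
move: {2}(_ - _)%N (erefl (n + n - (#|plain T| + #|unnotched T|))%N) => d.
elim/ltn_ind: d T => d IH T dE triT.
have [->|/eqP TN] := eqVneq T (initial_arcs n).
  by exists (Seed (@arc0 n) (@exch0 n) (@var0 n)) => //; apply: surface_seed0.
have [a [b [aT mv lt]]] := progress triT TN.
apply: (reachable_unflip triT aT mv); apply: (IH _ _ _ erefl).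
  have bnd (A : {set 'I_n}) : (#|A| <= n)%N by rewrite -[n in X in (_ <= X)%N]card_ord max_card.
  have := bnd (plain (b |: (T :\ a))); have := bnd (unnotched (b |: (T :\ a))).
  by move: lt; rewrite -dE; lia.
exact: flip_move_triangulation mv triT aT.
Qed.

Lemma triangulation_extend (E : {set tarc n}) :
  (forall a, a \in E -> is_tagged_arc a) ->
  (forall a b, a \in E -> b \in E -> compatible a b) ->
  exists2 T, tagged_triangulation T & E \subset T.
Proof.
move=> tE cE.
have [|T maxT subT] := @maxset_exists _ (fun A : {set tarc n} =>
    [forall a in A, is_tagged_arc a] && [forall a in A, forall b in A, compatible a b]) E.
  apply/andP; split; first exact/forall_inP.
  by apply/forall_inP => a aE; apply/forall_inP => b; apply: cE.
by exists T.
Qed.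

Lemma seed_with_arcs T : tagged_triangulation T ->
  exists S, [/\ surface_seed S, seed_arcs S = T & forall d, var S d = lamvar (arc_of S d)].
Proof.
by case/reachable_all => S seedS TE; exists S; split=> //; apply/ok_var/surface_seed_ok.
Qed.

Lemma seed_with_arc a : is_tagged_arc a ->
  exists S d, surface_seed S /\ var S d = lamvar a.
Proof.
move=> ta; have [||T triT sub] := @triangulation_extend [set a].
- by move=> b /set1P ->.
- by move=> b c /set1P -> /set1P ->; apply: compatible_refl.
have [S [seedS TE varE]] := seed_with_arcs triT.
have : a \in seed_arcs S by rewrite TE (subsetP sub) // set11.
by case/imsetP => d _ ->; exists S, d.
Qed.

End Reachability.

(** * Triangulations glued from regions away from the puncture *)

Section PolygonTriangulation.
Variable n : nat.
Implicit Types (i j k l m q : 'I_n) (A B : {set tarc n}).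

Definition within i q k l : bool := (ccw i k + ccw k l <= height i (inl q))%N.

(* [A] triangulates the region cut out by the chord, or loop, from [i] to [q],
   on the side away from the puncture. *)
Record triangulates i q A : Prop := Triangulates {
  poly_chords : forall e, e \in A -> exists k l, [/\ e = chord k l, k != l & within i q k l];
  poly_compat : forall a b, a \in A -> b \in A -> compatible a b;
  poly_max : forall k l, k != l -> within i q k l ->
    (forall a, a \in A -> compatible (chord k l) a) -> chord k l \in A;
  poly_side : i != q -> chord i q \in A }.

Lemma triangulates_edge i : (1 < n)%N -> triangulates i (ordS i) [set chord i (ordS i)].
Proof.
move=> n1; have h : height i (inl (ordS i)) = 1%N by rewrite height_chord ?ordS_neq ?ccw_ordS.
split.
- by move=> e /set1P ->; exists i, (ordS i); rewrite ordS_neq // /within h ccwii ccw_ordS.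
- by move=> a b /set1P -> /set1P ->; apply: compatible_refl.
- move=> k l; rewrite /within h -ccw_gt0 => kl le1 _; apply/set1P.
  have ik : i = k by apply/eqP; rewrite (eq_ccw i) ccwii; lia.
  subst k; congr chord; apply/eqP; rewrite ordS_ccw //; move: le1 kl; rewrite ccwii; lia.
- by rewrite set11.
Qed.

Lemma within_compatible i m q k l k' l' : (0 < ccw i m)%N -> (ccw i m < height i (inl q))%N ->
  k != l -> k' != l' -> within i m k l -> within m q k' l' ->
  compatible (chord k l) (chord k' l').
Proof.
move=> h1 h2 kl kl'; have im : i != m by rewrite -ccw_gt0.
have hn := height_le i q.
rewrite /within height_chord // => w1 w2.
have E : (ccw i m + height m (inl q) = height i (inl q))%N.
  have [qm|qm] := eqVneq m q.
    by subst q; rewrite height_chord // ltnn in h2.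
  rewrite height_chord //; have [iq|iq] := eqVneq i q.
    by subst q; rewrite height_loop ccw_add_back.
  by rewrite !height_chord // in h2 *; apply/ccw_add/ltnW.
have k'E : (ccw i k' = ccw i m + ccw m k')%N \/ (ccw i m + ccw m k' = n + ccw i k')%N.
  by have := ccwP i m k'; clear; lia.
have {}k'E : (ccw i k' = ccw i m + ccw m k')%N.
  case: k'E => // k'E; rewrite -ccw_gt0 in kl'; move: k'E w2 E hn kl'; clear; lia.
rewrite compatible_chord_chord (cross_liftE (o := i)); last by rewrite k'E; lia.
rewrite k'E /crosses_lift /interleave.
move: w1 w2 E hn; have := ccw_lt i k; have := ccw_lt k l.
by move: (height i (inl q)) (height m (inl q)) => H H'; clear; lia.
Qed.

Lemma within_side i q k l : i != q -> k != l -> within i q k l ->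
  compatible (chord k l) (chord i q).
Proof.
move=> iq kl; rewrite /within height_chord // => w.
rewrite compatible_chord_chord (cross_liftE (o := i)); last first.
  by rewrite ccwii; apply/ltnW/ccw_lt.
rewrite ccwii add0n /crosses_lift /interleave; have := ccw_lt i q.
by move: w; clear; lia.
Qed.

Lemma within_split i m q k l : (0 < ccw i m)%N -> (ccw i m < height i (inl q))%N ->
  k != l -> within i q k l -> compatible (chord k l) (chord i m) ->
  compatible (chord k l) (chord m q) ->
  [\/ within i m k l, within m q k l | i != q /\ chord k l = chord i q].
Proof.
move=> h1 h2 kl w; have im : i != m by rewrite -ccw_gt0.
have mq : m != q by apply: contraTneq h2 => <-; rewrite height_chord // ltnn.
have hn := height_le i q.
have E : (ccw i m + ccw m q = height i (inl q))%N.
  have [iq|iq] := eqVneq i q; first by subst q; rewrite height_loop ccw_add_back.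
  by rewrite !height_chord // in h2 *; apply/ccw_add/ltnW.
rewrite !compatible_chord_chord !(cross_liftE (o := i)) ?E ?ccwii ?add0n //; last first.
  exact/ltnW/ccw_lt.
move=> c1 c2; rewrite /within in w.
have S : (ccw i k + ccw k l <= ccw i m)%N \/ (ccw i m <= ccw i k)%N \/
    (ccw i k = 0%N /\ ccw k l = height i (inl q)).
  move: c1 c2 h1 h2 w hn; rewrite /crosses_lift /interleave.
  by move: (height i (inl q)) (ccw i m) (ccw i k) (ccw k l); clear; lia.
case: S => [S|[S|[S1 S2]]].
- by apply: Or31; rewrite /within height_chord.
- apply: Or32; rewrite /within height_chord // (ccwD S).
  by move: S w E; move: (height i (inl q)) (ccw i m) (ccw i k) (ccw k l) (ccw m q); clear; lia.
- apply: Or33; have ik : i = k by apply/eqP; rewrite (eq_ccw i) ccwii S1.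
  subst k; have iq : i != q.
    by apply/eqP => iq; move: S2; rewrite -iq height_loop; have := ccw_lt i l; clear; lia.
  by split=> //; congr chord; apply/eqP; rewrite (eq_ccw i) S2 height_chord.
Qed.

Lemma withinW i m q k l : (0 < ccw i m)%N -> (ccw i m < height i (inl q))%N ->
  k != l -> within i m k l || within m q k l -> within i q k l.
Proof.
move=> h1 h2 kl; have im : i != m by rewrite -ccw_gt0.
have mq : m != q by apply: contraTneq h2 => <-; rewrite height_chord // ltnn.
have hn := height_le i q.
have E : (ccw i m + ccw m q = height i (inl q))%N.
  have [iq|iq] := eqVneq i q; first by subst q; rewrite height_loop ccw_add_back.
  by rewrite !height_chord // in h2 *; apply/ccw_add/ltnW.
rewrite -ccw_gt0 in kl; rewrite /within (height_chord im) (height_chord mq).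
have := ccwP i m k; move: h2 E hn kl.
by move: (height i (inl q)) (ccw i m) (ccw i k) (ccw k l) (ccw m k) (ccw m q); clear; lia.
Qed.

Definition join_regions i q A B : {set tarc n} :=
  A :|: B :|: (if i == q then set0 else [set chord i q]).

Lemma join_regionsP i q A B e : reflect
  [\/ e \in A, e \in B | i != q /\ e = chord i q] (e \in join_regions i q A B).
Proof.
rewrite /join_regions !inE; case: (eqVneq i q) => [iq|iq]; rewrite !inE ?orbF.
  apply: (iffP orP) => [[eA|eB]|[eA|eB|[/negP]]] //; try by [left|right].
    by constructor 1.
  by constructor 2.
apply: (iffP orP) => [[/orP[eA|eB]|/eqP eiq]|[eA|eB|[_ ->]]].
- by constructor 1.
- by constructor 2.
- by constructor 3.
- by left; rewrite eA.
- by left; rewrite eB orbT.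
- by right.
Qed.

Lemma triangulates_join i m q A B :
  (0 < ccw i m)%N -> (ccw i m < height i (inl q))%N ->
  triangulates i m A -> triangulates m q B -> triangulates i q (join_regions i q A B).
Proof.
move=> h1 h2 tA tB; have im : i != m by rewrite -ccw_gt0.
have mq : m != q by apply: contraTneq h2 => <-; rewrite height_chord // ltnn.
have chA e : e \in A -> exists k l, [/\ e = chord k l, k != l & within i m k l] by apply: poly_chords.
have chB e : e \in B -> exists k l, [/\ e = chord k l, k != l & within m q k l] by apply: poly_chords.
have AB a b : a \in A -> b \in B -> compatible a b.
  move=> /chA[k [l [-> kl w]]] /chB[k' [l' [-> kl' w']]].
  exact: (within_compatible h1 h2).
have sideA a : i != q -> a \in A -> compatible a (chord i q).
  move=> iq /chA[k [l [-> kl w]]]; apply: within_side => //.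
  by apply: (withinW h1 h2) => //; rewrite w.
have sideB a : i != q -> a \in B -> compatible a (chord i q).
  move=> iq /chB[k [l [-> kl w]]]; apply: within_side => //.
  by apply: (withinW h1 h2) => //; rewrite w orbT.
split.
- move=> e /join_regionsP[/chA[k [l [-> kl w]]]|/chB[k [l [-> kl w]]]|[iq ->]].
  + by exists k, l; split=> //; apply: (withinW h1 h2) => //; rewrite w.
  + by exists k, l; split=> //; apply: (withinW h1 h2) => //; rewrite w orbT.
  + by exists i, q; split=> //; rewrite /within ccwii height_chord.
- move=> a b /join_regionsP[aA|aB|[iq ->]] /join_regionsP[bA|bB|[iq' ->]].
  + exact: (poly_compat tA).
  + exact: AB.
  + exact: sideA.
  + by rewrite compatible_sym; apply: AB.
  + exact: (poly_compat tB).
  + exact: sideB.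
  + by rewrite compatible_sym; apply: sideA.
  + by rewrite compatible_sym; apply: sideB.
  + exact: compatible_refl.
- move=> k l kl w H.
  have HA a : a \in A -> compatible (chord k l) a by move=> aA; apply: H; apply/join_regionsP; constructor 1.
  have HB a : a \in B -> compatible (chord k l) a by move=> aB; apply: H; apply/join_regionsP; constructor 2.
  have [w'|w'|[iq ->]] := within_split h1 h2 kl w (HA _ (poly_side tA im)) (HB _ (poly_side tB mq)).
  + by apply/join_regionsP; constructor 1; apply: (poly_max tA).
  + by apply/join_regionsP; constructor 2; apply: (poly_max tB).
  + by apply/join_regionsP; constructor 3.
- by move=> iq; apply/join_regionsP; constructor 3.
Qed.

Lemma within_loop i k l s : k != l -> compatible (chord k l) (radius i s) = within i i k l.
Proof.
rewrite -ccw_gt0 => kl; rewrite compatible_chord_radius (cross_rayE i) ccwii.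
by rewrite /within height_loop /crosses_ray; have := ccw_lt i k; clear -kl; lia.
Qed.

Lemma loop_triangulation i A : triangulates i i A ->
  tagged_triangulation (radius i true |: (radius i false |: A)).
Proof.
move=> tA; have chA e : e \in A -> exists k l, [/\ e = chord k l, k != l & within i i k l].
  exact: poly_chords.
have rA s e : e \in A -> compatible (radius i s) e.
  by move=> /chA[k [l [-> kl w]]]; rewrite compatible_sym within_loop.
have rr s t : compatible (radius i s) (radius i t) by rewrite /compatible /= eqxx.
apply/triangulationP; split.
- by move=> a /setU1P[->//|/setU1P[->//|/chA[k [l [->]]]]].
- move=> a b /setU1P[->|/setU1P[->|aA]] /setU1P[->|/setU1P[->|bA]] //;
    try exact: rA; try by rewrite compatible_sym; apply: rA.
  exact: (poly_compat tA).
- move=> e te H.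
  have H1 : compatible e (radius i true) by apply: H; rewrite setU11.
  have H2 : compatible e (radius i false) by apply: H; rewrite !inE eqxx orbT.
  case: e te H H1 H2 => [[k l]|[k t]] te H H1 H2.
    apply/setU1P; right; apply/setU1P; right; apply: (poly_max tA) => //.
      by rewrite -(within_loop i true).
    by move=> a aA; apply: H; apply/setU1P; right; apply/setU1P; right.
  have ki : k = i by apply/eqP; move: H1 H2; rewrite /compatible /=; case: eqP => //; case: (t).
  by subst k; case: (t); apply/setU1P; [left|right; apply/setU1P; left].
Qed.

(** The digon between (i, j) and (j, i) contains the puncture and is cut into triangles by the two
    radii; a radius at any other vertex would cross one of the two chords. *)
Lemma two_radii_triangulation i j s A B : i != j ->
  triangulates i j A -> triangulates j i B ->
  tagged_triangulation (radius i s |: (radius j s |: (A :|: B))).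
Proof.
move=> ij tA tB; have ji : j != i by rewrite eq_sym.
have h1 : (0 < ccw i j)%N by rewrite ccw_gt0.
have h2 : (ccw i j < height i (inl i))%N by rewrite height_loop ccw_lt.
have tG := triangulates_join h1 h2 tA tB; rewrite /join_regions eqxx setU0 in tG.
set G := A :|: B in tG *.
have chG e : e \in G -> exists k l, [/\ e = chord k l, k != l & within i i k l].
  exact: (poly_chords tG).
have riG e : e \in G -> compatible (radius i s) e.
  by move=> /chG[k [l [-> kl w]]]; rewrite compatible_sym within_loop.
have rjG e : e \in G -> compatible (radius j s) e.
  case/setUP => [/(poly_chords tA)|/(poly_chords tB)] [k [l [-> kl w]]].
    rewrite compatible_sym compatible_chord_radius (cross_rayE i).
    move: w; rewrite /within height_chord // /crosses_ray.
    by have := ccw_lt i j; clear; lia.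
  rewrite compatible_sym within_loop //.
  move: w; rewrite /within height_chord // height_loop => w.
  by apply: leq_trans w _; apply/ltnW/ccw_lt.
have rr a b : compatible (radius a s) (radius b s) by rewrite /compatible /= eqxx orbT.
apply/triangulationP; split.
- by move=> a /setU1P[->//|/setU1P[->//|/chG[k [l [->]]]]].
- move=> a b /setU1P[->|/setU1P[->|aA]] /setU1P[->|/setU1P[->|bA]] //;
    try exact: riG; try exact: rjG;
    try by rewrite compatible_sym; apply: riG.
    by rewrite compatible_sym; apply: rjG.
  exact: (poly_compat tG).
- move=> e te H.
  have HG a : a \in G -> compatible e a.
    by move=> aA; apply: H; apply/setU1P; right; apply/setU1P; right.
  have H1 : compatible e (radius i s) by apply: H; rewrite setU11.
  have H2 : compatible e (radius j s) by apply: H; rewrite !inE eqxx orbT.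
  have ijG : chord i j \in G by rewrite inE (poly_side tA ij).
  have jiG : chord j i \in G by rewrite inE (poly_side tB ji) orbT.
  case: e te H HG H1 H2 => [[k l]|[k t]] te H HG H1 H2.
    apply/setU1P; right; apply/setU1P; right; apply: (poly_max tG) => //.
    by rewrite -(within_loop i s).
  have ts : t = s.
    apply/eqP; move: H1 H2; rewrite /compatible /=.
    by case: eqP => [->|_] //=; rewrite (negbTE ij).
  subst t; apply/setU1P; have [->|ki] := eqVneq k i; [by left|right].
  apply/setU1P; have [->|kj] := eqVneq k j; [by left|].
  have := HG _ ijG; have := HG _ jiG; rewrite !compatible_radius_chord /=.
  have := ccw_add_back ij; have := ccwP i j k; have := ccw_lt i k.
  have : ccw i k != ccw i j by rewrite -eq_ccw.
  by move: ki; rewrite eq_sym -ccw_gt0; clear; lia.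
Qed.

End PolygonTriangulation.

From mathcomp Require Import boolp classical_sets functions cardinality topology.

(** * Points *)

Lemma rmorphism_of (A B : nzRingType) (f : A -> B) :
  (forall x y, f (x - y) = f x - f y) -> f 1 = 1 -> (forall x y, f (x * y) = f x * f y) ->
  exists g : {rmorphism A -> B}, forall x, g x = f x.
Proof.
move=> fB f1 fM.
pose add := GRing.isZmodMorphism.Build _ _ f fB.
pose mul := GRing.isMonoidMorphism.Build _ _ f (conj f1 fM).
pose g : {rmorphism A -> B} := HB.pack f add mul.
by exists g.
Qed.

Section ClusterAlgebra.
Variable n : nat.
Hypothesis n_gt2 : (2 < n)%N.
Implicit Types (i j k l m : 'I_n) (a : tarc n).

Let n_gt1 : (1 < n)%N. Proof. exact: ltnW. Qed.

Lemma generator_in (f : ambient n) : cluster_generator f -> in_cluster_algebra f.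
Proof. by move=> gf; apply/asboolP => R _; apply. Qed.

Lemma lamvar_in a : in_cluster_algebra (lamvar a).
Proof.
have tagged_in (e : tarc n) : is_tagged_arc e -> in_cluster_algebra (lamvar e).
  move=> te; have [S [d [seedS <-]]] := seed_with_arc n_gt2 te.
  by apply: generator_in; exists S => //; left; exists d.
have [ta|] := boolP (is_tagged_arc a); first exact: tagged_in.
case: a => [[i j]|//]; rewrite [is_tagged_arc _]/= negbK => /eqP <-.
have -> : lamvar (inl (i, i)) = lamvar (radius i true) * lamvar (radius i false).
  exact: lam_loop.
have [_ _ M] := in_cluster_algebra_subring n.
by apply: M; apply: tagged_in.
Qed.

Lemma bvarV_in i : in_cluster_algebra (bvar i)^-1.
Proof.
apply: generator_in; exists (Seed (@arc0 n) (@exch0 n) (@var0 n)); first exact: surface_seed0.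
by right; exists i.
Qed.

Definition cav a : cluster_algebra n := ClusterAlgebra (lamvar_in a).
Definition binv i : cluster_algebra n := ClusterAlgebra (bvarV_in i).

Lemma lamvar_boundary i : lamvar (chord i (ordS i)) = bvar i.
Proof.
apply: lam_boundary => // j.
exact: (@lamvar_neq0 n n_gt2 (radius j false)).
Qed.

(** By [seed_ok] every generator is the lambda length of a tagged arc or the inverse of a boundary
    one. *)
Lemma cluster_algebra_ind (P : cluster_algebra n -> Prop) :
  P 1 -> (forall f g, P f -> P g -> P (f - g)) -> (forall f g, P f -> P g -> P (f * g)) ->
  (forall a, is_tagged_arc a -> P (cav a)) -> (forall i, P (binv i)) -> forall f, P f.
Proof.
move=> P1 PB PM Pa Pb [f f_in].
pose R : {pred ambient n} := [pred g | `[< exists2 u : cluster_algebra n, ca_val u = g & P u >]].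
have : f \in R.
  have /asboolP := f_in; apply.
    split=> [|g h /asboolP[u <- Pu] /asboolP[v <- Pv]|g h /asboolP[u <- Pu] /asboolP[v <- Pv]].
    - by apply/asboolP; exists 1.
    - by apply/asboolP; exists (u - v) => //; apply: PB.
    - by apply/asboolP; exists (u * v) => //; apply: PM.
  move=> g [S seedS [[d ->]|[i ->]]]; apply/asboolP; have ok := surface_seed_ok n_gt2 seedS.
    exists (cav (arc_of S d)); first by rewrite (ok_var ok).
    by apply/Pa/(tri_tagged (ok_tri ok)); apply: arc_of_in.
  exists (binv i) => //=.
  by rewrite (ok_var ok) (ok_frozen ok) lamvar_boundary.
case/asboolP => u uf Pu; suff <- : u = ClusterAlgebra f_in by [].
exact: val_inj.
Qed.

Lemma cav_eq (f g : cluster_algebra n) : ca_val f = ca_val g -> f = g.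
Proof. by move=> fg; apply: val_inj. Qed.

Variable K : fieldType.
Implicit Types p q : points n K.

Definition value p a : K := pt_eval p (cav a).

Lemma pt_evalM p (f g : cluster_algebra n) : pt_eval p (f * g) = pt_eval p f * pt_eval p g.
Proof. exact: rmorphM. Qed.

Lemma pt_evalD p (f g : cluster_algebra n) : pt_eval p (f + g) = pt_eval p f + pt_eval p g.
Proof. exact: rmorphD. Qed.

Lemma pt_evalB p (f g : cluster_algebra n) : pt_eval p (f - g) = pt_eval p f - pt_eval p g.
Proof. exact: rmorphB. Qed.

Lemma pt_eval1 p : pt_eval p 1 = 1.
Proof. exact: rmorph1. Qed.

Lemma value_quad p i m j (Q : endpoint n) :
  (0 < ccw i m)%N -> (ccw i m < ccw i j)%N -> (ccw i j < height i Q)%N ->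
  value p (chord i j) * value p (arc_to m Q) =
  value p (chord i m) * value p (arc_to j Q) + value p (chord m j) * value p (arc_to i Q).
Proof.
move=> h1 h2 h3; rewrite /value -!pt_evalM -pt_evalD; congr pt_eval; apply: cav_eq.
exact: lam_quad.
Qed.

Lemma value_digon p i j s : i != j ->
  value p (radius i s) * value p (radius j (~~ s)) = value p (chord i j) + value p (chord j i).
Proof.
move=> ij; rewrite /value -!pt_evalM -pt_evalD; congr pt_eval; apply: cav_eq.
exact: lam_digon.
Qed.

Lemma value_radii p i j s : value p (radius i s) * value p (radius j (~~ s)) =
  value p (radius j s) * value p (radius i (~~ s)).
Proof. rewrite /value -!pt_evalM; congr pt_eval; apply: cav_eq; exact: lam_radii. Qed.

Lemma value_loop p i : value p (chord i i) = value p (radius i true) * value p (radius i false).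
Proof. rewrite /value -!pt_evalM; congr pt_eval; apply: cav_eq; exact: lam_loop. Qed.

Lemma value_binv p i : value p (chord i (ordS i)) * pt_eval p (binv i) = 1.
Proof.
rewrite -(pt_eval1 p) -pt_evalM; congr pt_eval; apply: cav_eq => /=.
rewrite -[LHS]/(lamvar (chord i (ordS i)) * (bvar i)^-1) lamvar_boundary mulfV //.
by rewrite -lamvar_boundary lamvar_neq0 //= ordS_neq.
Qed.

Lemma value_boundary_neq0 p i : value p (chord i (ordS i)) != 0.
Proof.
by apply: contra_eqN (value_binv p i) => /eqP ->; rewrite mul0r eq_sym oner_eq0.
Qed.

Lemma pt_eval_binv p i : pt_eval p (binv i) = (value p (chord i (ordS i)))^-1.
Proof.
by apply: (mulfI (value_boundary_neq0 p i)); rewrite value_binv mulfV // value_boundary_neq0.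
Qed.

Lemma points_ext p q : (forall a, is_tagged_arc a -> value p a = value q a) -> p = q.
Proof.
move=> pq; have E : forall f, pt_eval p f = pt_eval q f.
  apply: cluster_algebra_ind => [|f g|f g|//|i].
  - by rewrite !pt_eval1.
  - by rewrite !pt_evalB => -> ->.
  - by rewrite !pt_evalM => -> ->.
  - by rewrite !pt_eval_binv pq //= ordS_neq.
case: p q {pq} E => [f [[f1] [f2]]] [g [[g1] [g2]]] E.
have fg : f = g by apply: funext => x; exact: E.
by subst g; rewrite (Prop_irrelevance f1 g1) (Prop_irrelevance f2 g2).
Qed.

(** Every tagged triangulation is the set of arcs of some seed, so seeds can be replaced by
    triangulations. *)
Lemma deepP p : deep_locus p <->
  forall T : {set tarc n}, tagged_triangulation T -> exists2 a, a \in T & value p a = 0.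
Proof.
split=> [dp T triT|H S seedS].
  have [S [seedS TE varE]] := seed_with_arcs n_gt2 triT.
  have [d [x [xE px]]] := dp S seedS.
  exists (arc_of S d); first by rewrite -TE arc_of_in.
  by rewrite /value -px; congr pt_eval; apply: cav_eq; rewrite xE varE.
have ok := surface_seed_ok n_gt2 seedS.
have [a /imsetP[d _ ->] a0] := H _ (ok_tri ok).
exists d, (cav (arc_of S d)); split=> //.
by rewrite (ok_var ok).
Qed.

End ClusterAlgebra.

(* The lambda lengths in terms of vectors [(r i, z i)]: chords are given by
   determinants, and radii by the determinant with [(0, 1)], scaled by [s] or [t].
   The monodromy around the puncture adds [s * t * r i] to [z i]. *)
Definition param_value n (A : pzRingType) (s t : A) (r z : 'I_n -> A) (a : tarc n) : A :=
  match a with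
  | inl (i, j) => r i * z j - z i * r j + (if (j <= i)%N then s * t * r i * r j else 0)
  | inr (i, notched) => (if notched then t else s) * r i
  end.

Lemma param_value_morph n (A B : pzRingType) (f : {rmorphism A -> B}) s t (r z : 'I_n -> A) a :
  f (param_value s t r z a) = param_value (f s) (f t) (f \o r) (f \o z) a.
Proof.
case: a => [[i j]|[i b]] /=; last by rewrite rmorphM; case: b.
by rewrite rmorphD rmorphB !rmorphM; case: ifP; rewrite ?rmorph0 ?rmorphM.
Qed.

(** The partial lengths telescope: dividing the determinant of consecutive vectors by the two radii
    gives the increment of [z i / r i], up to [s ^+ 2]. The monodromy contributes the total length
    [t / s]. *)
Lemma lam_param n (K : fieldType) (s t : K) (r z : 'I_n -> K) (a : tarc n) :
  (1 < n)%N -> s != 0 -> (forall i, r i != 0) ->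
  lam (fun i => s * r i) (fun i => param_value s t r z (chord i (ordS i))) a =
  param_value s t r z a.
Proof.
move=> n1 s0 r0; pose o : 'I_n := Ordinal (ltnW n1).
set x := fun i => s * r i; set b := fun i => param_value s t r z (chord i (ordS i)).
have part (m : nat) : forall i : 'I_n, i = m :> nat ->
    partial_length x b i = (z i / r i - z o / r o) / s ^+ 2.
  elim: m => [|m IH] i im.
    have -> : i = o by apply: val_inj.
    by rewrite [nat_of_ord o]/= partial_length0 subrr mul0r.
  have [k km] : {k : 'I_n | k = m :> nat}.
    by exists (Ordinal (ltnW (leq_ltn_trans (eq_leq (esym im)) (ltn_ord i)))).
  have iE : i = ordS k.
    by apply: val_inj => /=; rewrite km modn_small -im // im.
  have -> : nat_of_ord i = k.+1 by rewrite im km.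
  have nle : (ordS k <= k)%N = false by rewrite -iE im km ltnn.
  rewrite partial_lengthS (IH k) // /b /param_value /chord nle addr0 -iE /x.
  by field; rewrite s0 !r0.
have tot : total_length x b = t / s.
  pose e := ord_pred o; have eo : ordS e = o by apply: ord_predK.
  have en : e.+1 = n by rewrite /= add0n modn_small prednK //; apply: ltnW.
  rewrite /total_length -[X in partial_length x b X]en partial_lengthS (part e) //.
  rewrite /b /param_value /chord eo leq0n /x.
  by field; rewrite s0 !r0.
case: a => [[i j]|[i []]] //=; last by rewrite tot /x; field.
rewrite /sector !(part _ _ erefl) tot /x.
by case: ifP => _; field; rewrite s0 !r0.
Qed.

(** * Points with prescribed vectors, including vanishing radii *)

Section PointExists.
Variables (n : nat) (K : fieldType).
Hypothesis n_gt2 : (2 < n)%N.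

(** [lam_param] divides by the scale and the radii, which may vanish here. Adding [X] to each makes
    them invertible in rational functions of [X]; setting [X = 0] afterwards only requires nonzero
    boundary values. *)
Lemma point_exists (s t : K) (r z : 'I_n -> K) :
  (forall i, param_value s t r z (chord i (ordS i)) != 0) ->
  exists p : points n K, forall a, value n_gt2 p a = param_value s t r z a.
Proof.
move=> bnd; have n1 : (1 < n)%N by apply: ltnW.
pose ps (c : K) : {poly K} := 'X + c%:P.
have ps0 c : ps c != 0 by rewrite -size_poly_eq0 size_XaddC.
pose pv : tarc n -> {poly K} := param_value (ps s) (ps t) (ps \o r) (polyC \o z).
have pv0 a : (pv a).[0] = param_value s t r z a.
  rewrite /pv -[LHS]/(horner_eval 0 _) param_value_morph /=.
  have E c : horner_eval 0 (ps c) = c by rewrite /horner_eval !hornerE.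
  rewrite !E; congr (param_value _ _ _ _ a); apply: funext => i /=; first exact: E.
  by rewrite /horner_eval hornerC.
have pvb0 i : pv (chord i (ordS i)) != 0.
  by apply: contraNneq (bnd i) => E; rewrite -pv0 E horner0.
pose fr : {rmorphism {poly K} -> {fraction {poly K}}} := @tofrac {poly K}.
pose r' i := fr (ps (r i)); pose z' i := fr (z i)%:P.
have pvE a : fr (pv a) = param_value (fr (ps s)) (fr (ps t)) r' z' a.
  exact: (param_value_morph fr).
have [h1 h1E] := mpoly_mmap_spec (fun d : 'I_(n + n) => match fintype.split d with
  | inl i => fr (ps s) * fr (ps (r i)) | inr i => fr (pv (chord i (ordS i))) end).
pose h2 : {rmorphism {poly K} -> K} := horner_eval 0.
have sx i : specializes h1 (xvar i) (fr (ps s) * r' i).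
  have := specializes_tofrac h1 'X_(unsplit (inl i)); rewrite h1E.
  by rewrite (unsplitK (inl i)).
have sb i : specializes h1 (bvar i) (fr (pv (chord i (ordS i)))).
  have := specializes_tofrac h1 'X_(unsplit (inr i)); rewrite h1E.
  by rewrite (unsplitK (inr i)).
have fr0 c : fr (ps c) != 0 by rewrite tofrac_eq0.
have slam a : specializes h1 (lamvar a) (fr (pv a)).
  rewrite pvE -lam_param //; last by move=> i; apply: fr0.
  apply: specializes_lam => // [i|i]; first by rewrite -pvE.
  by rewrite mulf_neq0 ?fr0.
(* Evaluation in two stages: initial variables go to rational functions of [X], then [X] goes to 0.
   Being unique where defined, and defined on the generators, it is a homomorphism on the whole
   algebra. *)
pose comp f v := exists2 g, specializes h1 f g & specializes h2 g v.
have comp_uniq f u v : comp f u -> comp f v -> u = v.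
  move=> [g fg gu] [g' fg' gv]; have E := specializes_uniq fg fg'.
  by rewrite -E in gv; apply: specializes_uniq gu gv.
have comp1 : comp 1 1 by exists 1; apply: specializes1.
have compB f f' u u' : comp f u -> comp f' u' -> comp (f - f') (u - u').
  by move=> [g A B] [g' A' B']; exists (g - g'); apply: specializesB.
have compM f f' u u' : comp f u -> comp f' u' -> comp (f * f') (u * u').
  by move=> [g A B] [g' A' B']; exists (g * g'); apply: specializesM.
have compa a : comp (lamvar a) (param_value s t r z a).
  by exists (fr (pv a)) => //; rewrite -pv0; apply: specializes_tofrac.
have ex (f : cluster_algebra n) : exists v, comp (ca_val f) v.
  elim/(@cluster_algebra_ind n n_gt2): f.
  - by exists 1.
  - by move=> f g [u fu] [v gv]; exists (u - v); apply: compB.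
  - by move=> f g [u fu] [v gv]; exists (u * v); apply: compM.
  - by move=> a _; exists (param_value s t r z a); apply: compa.
  - move=> i; exists (param_value s t r z (chord i (ordS i)))^-1.
    exists (fr (pv (chord i (ordS i))))^-1.
      by apply: specializesV => //; rewrite tofrac_eq0.
    apply: specializesV => //; rewrite -pv0; exact: specializes_tofrac.
have [f fE] := choice ex.
have [g gE] : exists g : {rmorphism cluster_algebra n -> K}, forall x, g x = f x.
  apply: rmorphism_of => [u v||u v].
  - by apply: comp_uniq (fE (u - v)) _; apply: compB (fE u) (fE v).
  - by apply: comp_uniq (fE 1) _; apply: comp1.
  - by apply: comp_uniq (fE (u * v)) _; apply: compM (fE u) (fE v).
exists g => a; rewrite /value /pt_eval gE.
by apply: comp_uniq (fE (cav n_gt2 a)) _; apply: compa.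
Qed.

End PointExists.

(** * Deep points *)

Section DeepPoints.
Variables (n : nat) (K : fieldType).
Hypothesis n_gt2 : (2 < n)%N.
Implicit Types (i j k l m q : 'I_n) (p : points n K).

Let n_gt1 : (1 < n)%N. Proof. exact: ltnW. Qed.

Section Point.
Variable p : points n K.
Notation c i j := (value n_gt2 p (chord i j)).
Notation rho i s := (value n_gt2 p (radius i s)).

Lemma c_boundary i : c i (ordS i) != 0.
Proof. exact: value_boundary_neq0. Qed.

Lemma c_quad i m j q : (0 < ccw i m)%N -> (ccw i m < ccw i j)%N ->
  (ccw i j < height i (inl q))%N ->
  c i j * c m q = c i m * c j q + c m j * c i q.
Proof. move=> h1 h2 h3; exact: (value_quad n_gt2 p h1 h2 h3). Qed.

Lemma rho_quad i m j s : (0 < ccw i m)%N -> (ccw i m < ccw i j)%N ->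
  c i j * rho m s = c i m * rho j s + c m j * rho i s.
Proof.
move=> h1 h2; have h3 : (ccw i j < height i (inr s : endpoint n))%N.
  by rewrite /=; have := ccw_lt i j; lia.
exact: (value_quad n_gt2 p h1 h2 h3).
Qed.

Lemma c_loop i s : c i i = rho i s * rho i (~~ s).
Proof. by rewrite value_loop; case: s => //; rewrite mulrC. Qed.

Definition nonzero_on (A : {set tarc n}) : Prop := forall a, a \in A -> value n_gt2 p a != 0.

Lemma ccw_region i m q : (0 < ccw i m)%N -> (ccw i m < height i (inl q))%N ->
  (ccw i m + ccw m q = height i (inl q))%N.
Proof.
move=> h1 h2; have im : i != m by rewrite -ccw_gt0.
have [iq|iq] := eqVneq i q; first by subst q; rewrite height_loop ccw_add_back.
by rewrite !height_chord // in h2 *; apply/ccw_add/ltnW.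
Qed.

Lemma height_region i m q : (0 < ccw i m)%N -> (ccw i m < height i (inl q))%N ->
  height m (inl q) = ccw m q.
Proof.
move=> h1 h2; have im : i != m by rewrite -ccw_gt0.
by apply: height_chord; apply: contraTneq h2 => <-; rewrite height_chord // ltnn.
Qed.

Lemma nonzero_join i q A B : c i q != 0 -> nonzero_on A -> nonzero_on B ->
  nonzero_on (join_regions i q A B).
Proof. by move=> ciq HA HB e /join_regionsP[/HA|/HB|[_ ->]]. Qed.

(* Nonadjacent vertices whose vectors are proportional cannot be joined; a third
   direction suffices to find a triangulation avoiding all such pairs. *)
Lemma nonzero_triangulation i q : c i q != 0 ->
  height i (inl q) = 1%N \/ (exists m, [/\ (0 < ccw i m)%N, (ccw i m < height i (inl q))%N,
    c i m != 0 & c m q != 0]) ->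
  exists2 A, triangulates i q A & nonzero_on A.
Proof.
move: {2}(height i (inl q)) (erefl (height i (inl q))) => d.
elim/ltn_ind: d i q => d IH i q hd ciq; rewrite hd.
have edge a b : height a (inl b) = 1%N -> exists2 A, triangulates a b A & nonzero_on A.
  move=> h; have ab : b = ordS a.
    apply/eqP; rewrite ordS_ccw //; move: h => /=; case: eqP => [_ n1|_ ->//].
    by have := n_gt1; move: n1; clear; lia.
  rewrite {h}ab; exists [set chord a (ordS a)]; first exact: triangulates_edge.
  by move=> e /set1P ->; apply: c_boundary.
case=> [d1|[m0 M0]]; first by apply: edge; rewrite hd.
(* For the first such [m], unless it is [ordS i], the chord from [ordS i] to [q] vanishes, and the
   Ptolemy relation makes the chord from [ordS i] to [m] nonzero. So the region (i, m) satisfies the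
   hypothesis again. *)
pose P m := [&& (0 < ccw i m)%N, (ccw i m < d)%N, c i m != 0 & c m q != 0].
have P0 : P m0 by apply/and4P.
have [m /and4P[m1 m2 cim cmq] mmin] := arg_minnP (fun m => ccw i m) P0.
have m2' : (ccw i m < height i (inl q))%N by rewrite hd.
have im : i != m by rewrite -ccw_gt0.
have Em := ccw_region m1 m2'; rewrite hd in Em.
have hm := height_region m1 m2'.
have [A tA zA] : exists2 A, triangulates i m A & nonzero_on A.
  apply: (IH _ m2) => //; first exact: height_chord.
  rewrite height_chord //; have [->|m1'] := eqVneq (ccw i m) 1%N; [by left|right].
  have s1 := ccw_ordS i n_gt1; have lt : (ccw i (ordS i) < ccw i m)%N by rewrite s1; lia.
  exists (ordS i); rewrite s1; split=> //; [by rewrite -s1|exact: c_boundary|].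
  have : c (ordS i) q = 0.
    apply/eqP; apply: contraTT lt => cSq; rewrite -leqNgt; apply: mmin.
    by rewrite /P s1 cSq c_boundary /=; lia.
  move=> cSq; have := @c_quad i (ordS i) m q; rewrite s1 cSq mulr0 => /(_ isT).
  rewrite -{1}s1 => /(_ lt m2') E; apply/eqP => E0; move/eqP: E.
  by rewrite E0 mul0r addr0 eq_sym mulf_eq0 (negbTE (c_boundary i)) (negbTE cmq).
have [/existsP[k /and4P[k1 k2 cmk ckq]]|N] :=
    boolP [exists k, [&& (0 < ccw m k)%N, (ccw m k < ccw m q)%N, c m k != 0 & c k q != 0]].
  have [B tB zB] : exists2 B, triangulates m q B & nonzero_on B.
    apply: (IH (ccw m q)) => //; first by move: Em m1; clear; lia.
    by right; exists k; rewrite hm.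
  exists (join_regions i q A B); [exact: triangulates_join tA tB|exact: nonzero_join].
have {}N k : (0 < ccw m k)%N -> (ccw m k < ccw m q)%N -> c m k = 0 \/ c k q = 0.
  move=> k1 k2; have /existsPn/(_ k) := N; rewrite k1 k2 /= negb_and !negbK.
  by case/orP => /eqP; [left|right].
have [mq1|mq1] := eqVneq (ccw m q) 1%N.
  have [|B tB zB] := edge m q; first by rewrite hm.
  exists (join_regions i q A B); [exact: triangulates_join tA tB|exact: nonzero_join].
(* Every vertex strictly between [m] and [q] now has a zero chord to one of them; for the last one,
   [e], it is the chord to [m], since (e, q) is an edge. The region is split at [e] instead, and
   [ordS m] serves as third vertex for the region (i, e). *)
pose e := ord_pred q; have eq : ordS e = q by apply: ord_predK.
have ceq : c e q != 0 by rewrite -[X in chord e X]eq c_boundary.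
have eq1 : ccw e q = 1%N by rewrite -[X in ccw e X]eq ccw_ordS.
have mq0 : (0 < ccw m q)%N by rewrite -hm; apply: leq_ltn_trans (_ : ccw m m < _)%N; rewrite ?ccwii // hm; move: Em m2; clear; lia.
have mqn := ccw_lt m q.
have meE : ccw m e = (ccw m q).-1.
  by have := ccwP m e q; rewrite eq1; move: mq0 mqn; clear; lia.
have me1 : (0 < ccw m e)%N by rewrite meE; move: mq0 mq1; clear; lia.
have me2 : (ccw m e < ccw m q)%N by rewrite meE; move: mq0; clear; lia.
have cme : c m e = 0 by have [//|E] := N e me1 me2; rewrite E eqxx in ceq.
have dn : (d <= n)%N by rewrite -hd height_le.
have shift k : (ccw m k <= ccw m q)%N -> k = q \/ ccw i k = (ccw i m + ccw m k)%N.
  move=> kq; have [->|kq'] := eqVneq k q; [by left|right].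
  have := ccwP i m k; have := ccw_lt m k; have := ccw_lt i k.
  have : ccw m k != ccw m q by rewrite -eq_ccw.
  by move: Em kq dn; clear; lia.
have ieE : ccw i e = (ccw i m + ccw m e)%N.
  by have [E|//] := shift e (ltnW me2); rewrite E in me2; rewrite ltnn in me2.
have ied : (ccw i e < height i (inl q))%N by rewrite hd ieE; move: Em me2; clear; lia.
have ime : (ccw i m < ccw i e)%N by rewrite ieE; move: me1; clear; lia.
have ie1 : (0 < ccw i e)%N by move: ime; clear; lia.
have cie : c i e != 0.
  have := c_quad m1 ime ied; rewrite cme mul0r addr0 => E.
  have : c i m * c e q != 0 by rewrite mulf_neq0.
  by rewrite -E mulf_eq0 negb_or => /andP[].
pose k := ordS m; have mk1 : ccw m k = 1%N by apply: ccw_ordS.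
have cmk : c m k != 0 by apply: c_boundary.
have kq : c k q = 0.
  by have [||E|//] := N k; rewrite ?mk1 //; [move: mq0 mq1; clear; lia|rewrite E eqxx in cmk].
have ke : (ccw m k < ccw m e)%N.
  rewrite ltn_neqAle -eq_ccw mk1 me1 andbT.
  by apply: contraTneq ceq => <-; rewrite kq eqxx.
have ikE : ccw i k = (ccw i m + ccw m k)%N.
  have kq' : (ccw m k < ccw m q)%N by apply: ltn_trans me2.
  by have [E|//] := shift k (ltnW kq'); rewrite E ltnn in kq'.
have imk : (ccw i m < ccw i k)%N by rewrite ikE mk1; clear; lia.
have ike : (ccw i k < ccw i e)%N by rewrite ikE ieE; move: ke; clear; lia.
have cik : c i k != 0.
  have := c_quad m1 imk (ltn_trans ike ied); rewrite kq mulr0 add0r => E.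
  have : c m k * c i q != 0 by rewrite mulf_neq0.
  by rewrite -E mulf_eq0 negb_or => /andP[].
have cke : c k e != 0.
  have ik1 : (0 < ccw i k)%N by apply: ltn_trans imk.
  have := c_quad ik1 ike ied; rewrite kq mulr0 => /esym/eqP.
  rewrite addrC addr_eq0 => /eqP E; have : c i k * c e q != 0 by rewrite mulf_neq0.
  by rewrite -[X in X != 0]opprK -E oppr_eq0 mulf_eq0 negb_or => /andP[].
have ie : i != e by rewrite -ccw_gt0.
have [C tC zC] : exists2 C, triangulates i e C & nonzero_on C.
  apply: (IH (ccw i e)) => //; first by rewrite -hd.
    exact: height_chord.
  right; exists k; rewrite height_chord //; split=> //; exact: ltn_trans imk.
have [|D tD zD] := edge e q; first by rewrite (height_region ie1 ied).
exists (join_regions i q C D); [exact: triangulates_join tC tD|exact: nonzero_join].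
Qed.

Hypothesis deep_p : deep_locus p.

Lemma deep_no_nonzero T : tagged_triangulation T -> ~ nonzero_on T.
Proof.
move=> triT zT; have /deepP dp := deep_p; have [a aT a0] := dp _ T triT.
by have := zT a aT; rewrite a0 eqxx.
Qed.

Lemma deep_star s : exists i, rho i s = 0.
Proof.
have [/existsP[i /eqP]|N] := boolP [exists i, rho i s == 0]; first by exists i.
case: (@deep_no_nonzero _ (star_triangulation n_gt2 s)) => a.
rewrite inE; case: a => [[i j]|[i t]] /eqP ->; first exact: c_boundary.
by move/existsPn: N; apply.
Qed.

(** If both radii at [i] were nonzero, so would be the loop, and its region cannot be triangulated
    by nonzero chords. Hence each vertex has a zero chord from or to [i]. At a vertex [m] whose
    radius of the opposite tag is zero, the digon relation makes both chords vanish, against the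
    Ptolemy relation with [ordS m]. *)
Lemma deep_loop i s : rho i s * rho i (~~ s) = 0.
Proof.
apply/eqP; apply: contraT => r0; have ci : c i i != 0 by rewrite (c_loop i s).
have [ri ri'] : rho i s != 0 /\ rho i (~~ s) != 0.
  by move: r0; rewrite mulf_eq0 negb_or => /andP[].
have [/existsP[m /and3P[m1 cim cmi]]|N] :=
    boolP [exists m, [&& (0 < ccw i m)%N, c i m != 0 & c m i != 0]].
  have [||A tA zA] := @nonzero_triangulation i i => //.
    by right; exists m; rewrite height_loop ccw_lt.
  case: (deep_no_nonzero (loop_triangulation tA)) => a.
  by case/setU1P => [->|/setU1P[->|/zA//]]; move: ri ri'; case: (s).
have [m rm] := deep_star (~~ s).
have im : i != m by apply: contraNneq ri' => ->; rewrite rm.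
have m1 : (0 < ccw i m)%N by rewrite ccw_gt0.
have := value_digon n_gt2 p s im; rewrite rm mulr0 => /esym/eqP; rewrite addr_eq0 => /eqP E.
have /existsPn/(_ m) := N; rewrite m1 /= E oppr_eq0 andbb negbK => /eqP cmi.
rewrite cmi oppr0 in E.
have [mi|mi] := eqVneq (ordS m) i.
  by have := c_boundary m; rewrite mi cmi eqxx.
have S1 : ccw m (ordS m) = 1%N by apply: ccw_ordS.
have lt : (ccw i m < ccw i (ordS m))%N.
  have := ccwP i m (ordS m); rewrite S1; move: mi; rewrite eq_sym -ccw_gt0.
  by have := ccw_lt i m; clear; lia.
have := @c_quad i m (ordS m) i m1 lt; rewrite height_loop ccw_lt cmi E => /(_ isT)/eqP.
by rewrite mulr0 mul0r add0r eq_sym mulf_eq0 (negbTE (c_boundary m)) (negbTE ci).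
Qed.

Section SomeRadius.
Variables (i0 : 'I_n) (s : bool).
Hypothesis rho_i0 : rho i0 s != 0.

Lemma deep_other j : rho j (~~ s) = 0.
Proof.
have r0 : rho i0 (~~ s) = 0.
  by apply/eqP; have /eqP := deep_loop i0 s; rewrite mulf_eq0 (negbTE rho_i0).
by apply/eqP; have /eqP := value_radii n_gt2 p i0 j s; rewrite r0 mulr0 mulf_eq0 (negbTE rho_i0).
Qed.

Lemma deep_antisym i j : i != j -> c j i = - c i j.
Proof.
move=> ij; have := value_digon n_gt2 p s ij; rewrite deep_other mulr0 => /esym/eqP.
by rewrite addrC addr_eq0 => /eqP.
Qed.

(** Since the edge from [j] is nonzero, two consecutive zero radii of tag [s] would force the radius
    at [i0] to vanish. *)
Lemma deep_not_both_zero j : ~ (rho j s = 0 /\ rho (ordS j) s = 0).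
Proof.
case=> r1 r2; have ji : j != i0 by apply: contraNneq rho_i0 => <-; rewrite r1.
have Sji : ordS j != i0 by apply: contraNneq rho_i0 => <-; rewrite r2.
have S1 := ccw_ordS j n_gt1.
have lt : (ccw j (ordS j) < ccw j i0)%N.
  by rewrite ltn_neqAle -eq_ccw Sji S1 ccw_gt0.
have := @rho_quad j (ordS j) i0 s; rewrite S1 r1 r2 => /(_ isT).
rewrite -{1}S1 => /(_ lt) /eqP.
by rewrite !mulr0 addr0 eq_sym mulf_eq0 (negbTE rho_i0) (negbTE (c_boundary j)).
Qed.

Lemma deep_two_radii i j A B : i != j -> rho i s != 0 -> rho j s != 0 ->
  triangulates i j A -> triangulates j i B -> nonzero_on A -> ~ nonzero_on B.
Proof.
move=> ij ri rj tA tB zA zB.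
case: (deep_no_nonzero (two_radii_triangulation s ij tA tB)) => a.
by case/setU1P => [->//|/setU1P[->//|/setUP[/zA|/zB]]].
Qed.

(** The digon formed by the edge and its complement must not be triangulable, so no third vertex has
    nonzero chords to both [i] and [ordS i]. At a vertex [m] with zero radius the radius relation
    then makes both chords vanish, against the Ptolemy relation with [ordS m]. *)
Lemma deep_not_both_nonzero i : ~ (rho i s != 0 /\ rho (ordS i) s != 0).
Proof.
case=> r1 r2; set j := ordS i in r2.
have ij : i != j := ordS_neq n_gt1 i; have ji : j != i by rewrite eq_sym.
have S1 : ccw i j = 1%N := ccw_ordS i n_gt1.
have cij : c i j != 0 := c_boundary i.
have cji : c j i != 0 by rewrite deep_antisym // oppr_eq0.
have jin : (ccw j i = n.-1)%N by have := ccw_add_back ij; rewrite S1; clear; lia.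
have [/existsP[m /and4P[m1 m2 cjm cmi]]|N] := boolP [exists m, [&& (0 < ccw j m)%N,
    (ccw j m < ccw j i)%N, c j m != 0 & c m i != 0]].
  have [||B tB zB] := @nonzero_triangulation j i => //.
    by right; exists m; rewrite height_chord.
  apply: (deep_two_radii ij r1 r2 (triangulates_edge i n_gt1) tB _ zB).
  by move=> e /set1P ->.
have [m rm] := deep_star s.
have im : i != m by apply: contraNneq r1 => ->; rewrite rm.
have jm : j != m by apply: contraNneq r2 => ->; rewrite rm.
have jm2 : (ccw j m < ccw j i)%N.
  have := ccw_lt j m; have : ccw j m != ccw j i by rewrite -eq_ccw eq_sym.
  by rewrite jin; move: n_gt2; clear; lia.
have lt : (ccw i j < ccw i m)%N by rewrite ltn_neqAle -eq_ccw jm S1 ccw_gt0.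
have ij1 : (0 < ccw i j)%N by rewrite S1.
have E := rho_quad s ij1 lt; rewrite rm mulr0 add0r in E.
have /existsPn/(_ m) := N; rewrite ccw_gt0 jm jm2 /= negb_and !negbK.
rewrite (@deep_antisym i m) // oppr_eq0 => Z.
have {Z} [cjm cim] : c j m = 0 /\ c i m = 0.
  case/orP: Z => /eqP Z; rewrite Z mul0r in E.
    by move/eqP: E; rewrite mulf_eq0 (negbTE r2) orbF => /eqP.
  by move/esym/eqP: E; rewrite mulf_eq0 (negbTE r1) orbF => /eqP.
have [mi|mi] := eqVneq (ordS m) i.
  have := c_boundary m; rewrite mi (@deep_antisym i m) // cim oppr0 eqxx //.
have mS : ccw m (ordS m) = 1%N by apply: ccw_ordS.
have lt2 : (ccw i m < ccw i (ordS m))%N.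
  have := ccwP i m (ordS m); rewrite mS; move: mi; rewrite eq_sym -ccw_gt0.
  by have := ccw_lt i m; clear; lia.
have := @c_quad i j m (ordS m) ij1 lt; rewrite height_chord 1?eq_sym // => /(_ lt2)/eqP.
rewrite cim cjm !mul0r addr0 eq_sym mulf_eq0.
by rewrite (negbTE cij) (negbTE (c_boundary m)).
Qed.

Lemma deep_alternate i : (rho (ordS i) s != 0) = (rho i s == 0).
Proof.
have := @deep_not_both_zero i; have := @deep_not_both_nonzero i.
case: (eqVneq (rho i s) 0) => A; case: (eqVneq (rho (ordS i) s) 0) => B //= C D.
- by case: D.
- by case: C.
Qed.

Hypothesis n_gt3 : (3 < n)%N.

Lemma deep_parity : ~~ odd n /\ exists e : bool, forall i, (rho i s != 0) = (odd i == e).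
Proof.
pose o : 'I_n := Ordinal (ltnW n_gt1); pose e := rho o s == 0.
have H (m : nat) : forall i : 'I_n, i = m :> nat -> (rho i s != 0) = (odd i == e).
  elim: m => [|m IH] i im.
    by have -> : i = o by [exact: val_inj]; rewrite /= /e; case: (rho o s == 0).
  have [k km] : {k : 'I_n | k = m :> nat}.
    by exists (Ordinal (ltnW (leq_ltn_trans (eq_leq (esym im)) (ltn_ord i)))).
  have iE : i = ordS k by apply: val_inj => /=; rewrite km modn_small -im // im.
  rewrite {1}iE deep_alternate -[_ == 0]negbK (IH k km) im km /=.
  by case: (odd m); case: (e).
split; last by exists e => i; apply: (H i).
pose l := ord_pred o; have lS : ordS l = o by apply: ord_predK.
have ln : l.+1 = n by rewrite /= add0n modn_small prednK //; apply: ltnW.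
have := deep_alternate l; rewrite lS -[_ == 0 in RHS]negbK !(H _ _ erefl) /= -[in odd n]ln /=.
by rewrite /l; case: (odd _); case: (e).
Qed.

(** If the radius at [i] is zero, the radius relation through [ordS i] suffices. Otherwise the radii
    at [i] and two steps further are nonzero, and a nonzero chord between them would give a
    triangulated digon: the middle vertex serves on one side, and the vertex three steps from [i] on
    the other, which is distinct from [i] since [n > 3]. *)
Lemma deep_skip i : c i (ordS (ordS i)) = 0.
Proof.
set j := ordS i; set k := ordS j.
have ij1 : ccw i j = 1%N := ccw_ordS i n_gt1; have jk1 : ccw j k = 1%N := ccw_ordS j n_gt1.
have ik2 : ccw i k = 2%N by have := ccwP i j k; rewrite ij1 jk1; move: n_gt3; clear; lia.
have ik : i != k by rewrite -ccw_gt0 ik2.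
have lt : (ccw i j < ccw i k)%N by rewrite ij1 ik2.
have ij0 : (0 < ccw i j)%N by rewrite ij1.
have [ri|ri] := eqVneq (rho i s) 0.
  have rj : rho j s != 0 by rewrite deep_alternate ri.
  have rk : rho k s = 0 by apply/eqP; apply: contraT; rewrite deep_alternate (negbTE rj).
  have /eqP := rho_quad s ij0 lt; rewrite ri rk !mulr0 addr0 mulf_eq0 (negbTE rj) orbF.
  by move/eqP.
have rj : rho j s = 0 by apply/eqP; apply: contraT; rewrite deep_alternate (negbTE ri).
have rk : rho k s != 0 by rewrite deep_alternate rj.
apply/eqP; apply: contraT => cik.
have cki : c k i != 0 by rewrite (@deep_antisym i k) // oppr_eq0.
have ki2 : (ccw k i + 2 = n)%N by rewrite -ik2 addnC ccw_add_back.
have [||A tA zA] := @nonzero_triangulation i k => //.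
  by right; exists j; rewrite height_chord // ij1 ik2 !c_boundary.
have [||B tB zB] := @nonzero_triangulation k i => //; last first.
  by case: (deep_two_radii ik ri rk tA tB zA zB).
right; pose l := ordS k; exists l; have kl1 : ccw k l = 1%N := ccw_ordS k n_gt1.
have ki : k != i by rewrite eq_sym.
rewrite height_chord // kl1; split=> //; first by move: ki2 n_gt3; clear; lia.
  exact: c_boundary.
have rl : rho l s = 0 by apply/eqP; apply: contraT; rewrite deep_alternate (negbTE rk).
have li : i != l.
  by apply/eqP => il; move: kl1 ki2; rewrite -il; move: n_gt3; clear; lia.
have lt2 : (ccw i k < ccw i l)%N.
  have := ccwP i k l; rewrite ik2 kl1; have : (0 < ccw i l)%N by rewrite ccw_gt0.
  by move: n_gt3; clear; lia.
have ik0 : (0 < ccw i k)%N by rewrite ik2.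
rewrite (@deep_antisym i l) // oppr_eq0; have := rho_quad s ik0 lt2.
rewrite rl mulr0 add0r => E; have : c k l * rho i s != 0 by rewrite mulf_neq0 // c_boundary.
by rewrite -E mulf_eq0 negb_or => /andP[].
Qed.

End SomeRadius.
End Point.
End DeepPoints.

Local Open Scope classical_set_scope.

(** * Zariski closed sets and dimension *)

Section Zariski.
Variables (n : nat) (K : fieldType).
Implicit Types (f g : points n K -> K) (p q : points n K) (X Y Z : set (points n K)).
Notation regular := (@regular_function n K).

Lemma regular_eval (a : cluster_algebra n) : regular (fun p => pt_eval p a).
Proof. by exists [:: (1, a)] => p; rewrite big_seq1 mul1r. Qed.

Lemma regular_const (c : K) : regular (fun=> c).
Proof. by exists [:: (c, 1)] => p; rewrite big_seq1 /pt_eval rmorph1 mulr1. Qed.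

Lemma regularD f g : regular f -> regular g -> regular (fun p => f p + g p).
Proof. by move=> [s fE] [t gE]; exists (s ++ t) => p; rewrite big_cat /= fE gE. Qed.

Lemma regularM f g : regular f -> regular g -> regular (fun p => f p * g p).
Proof. exact: regular_functionM. Qed.

Lemma regularB f g : regular f -> regular g -> regular (fun p => f p - g p).
Proof.
move=> rf rg; have := regularD rf (regularM (regular_const (-1)) rg).
by congr regular; apply: funext => p; rewrite mulN1r.
Qed.

Lemma regularX f e : regular f -> regular (fun p => f p ^+ e).
Proof.
move=> rf; elim: e => [|e IH]; first exact: regular_const.
by have := regularM rf IH; congr regular; apply: funext => p; rewrite exprS.
Qed.

Lemma regular_sum (I : Type) (r : seq I) (F : I -> points n K -> K) :
  (forall i, regular (F i)) -> regular (fun p => \sum_(i <- r) F i p).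
Proof.
move=> rF; elim: r => [|i r IH].
  by have := regular_const 0; congr regular; apply: funext => p; rewrite big_nil.
by have := regularD (rF i) IH; congr regular; apply: funext => p; rewrite big_cons.
Qed.

Lemma regular_prod (I : Type) (r : seq I) (F : I -> points n K -> K) :
  (forall i, regular (F i)) -> regular (fun p => \prod_(i <- r) F i p).
Proof.
move=> rF; elim: r => [|i r IH].
  by have := regular_const 1; congr regular; apply: funext => p; rewrite big_nil.
by have := regularM (rF i) IH; congr regular; apply: funext => p; rewrite big_cons.
Qed.

Lemma open_nonzero f : regular f -> open [set p | f p != 0].
Proof.
move=> rf; exists [set f]; first by move=> _ ->.
by apply/seteqP; split=> p /=; [exists f|case=> _ ->].
Qed.

Lemma zariski_closureP X p : closure X p <->
  (forall f, regular f -> f p != 0 -> exists2 q, X q & f q != 0).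
Proof.
split=> [clp f rf fp|H B].
  have [|q [Xq fq]] := clp [set q | f q != 0]; last by exists q.
  by apply: open_nbhs_nbhs; split=> //; apply: open_nonzero.
rewrite nbhsE => -[U [[E ER UE] Up] UB].
move: Up; rewrite UE => -[f Ef fp]; have [q Xq fq] := H f (ER _ Ef) fp.
by exists q; split=> //; apply: UB; rewrite UE; exists f.
Qed.

Lemma closed_zeros (E : set (points n K -> K)) : E `<=` regular ->
  closed [set p | forall f, E f -> f p = 0].
Proof.
move=> ER p /zariski_closureP H f Ef; apply/eqP; apply: contraT => fp.
by have [q /(_ f Ef) ->] := H f (ER _ Ef) fp; rewrite eqxx.
Qed.

Lemma closed_zeros_fam (I : Type) (F : I -> points n K -> K) :
  (forall i, regular (F i)) -> closed [set p | forall i, F i p = 0].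
Proof.
move=> RF; have -> : [set p | forall i, F i p = 0] = [set p | forall f, range F f -> f p = 0].
  apply/seteqP; split=> p /= H; first by move=> _ [i _ <-].
  by move=> i; apply: (H (F i)); exists i.
by apply: closed_zeros => _ [i _ <-].
Qed.

Lemma notin_closedP X p : closed X -> ~ X p ->
  exists f, [/\ regular f, f p != 0 & forall q, X q -> f q = 0].
Proof.
move=> clX nXp; apply: contrapT => N; apply/nXp/clX/zariski_closureP => f rf fp.
apply: contrapT => N'; apply: N; exists f; split=> // q Xq.
by apply/eqP; apply: contraT => fq; case: N'; exists q.
Qed.

Lemma irreducible_between X Y : irreducible_set X -> X `<=` Y -> Y `<=` closure X ->
  irreducible_set Y.
Proof.
move=> [[p Xp] irr] XY YcX; split; first by exists p; apply: XY.
have cl F : closed F -> X `<=` F -> Y `<=` F.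
  by move=> cF XF q /YcX cq; apply: cF; apply: closure_subset cq.
move=> F G cF cG YFG; have [] := irr F G cF cG; first exact: subset_trans YFG.
  by move/(cl _ cF); left.
by move/(cl _ cG); right.
Qed.

Lemma irreducible_mul X f g : irreducible_set X -> regular f -> regular g ->
  (forall p, X p -> f p * g p = 0) ->
  (forall p, X p -> f p = 0) \/ (forall p, X p -> g p = 0).
Proof.
move=> [_ irr] rf rg fg.
have cl h : regular h -> closed [set p | h p = 0].
  move=> rh; have := @closed_zeros_fam unit (fun=> h) (fun=> rh).
  by congr closed; apply/seteqP; split=> p /= H; [exact: H tt|].
have [||] := irr _ _ (cl f rf) (cl g rg); [|by left|by right].
by move=> p /fg/eqP; rewrite mulf_eq0 => /orP[] /eqP; [left|right].
Qed.

Lemma irreducible_setP X : X !=set0 ->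
  (forall f g p q, regular f -> regular g -> X p -> X q -> f p != 0 -> g q != 0 ->
    exists2 u, X u & f u * g u != 0) -> irreducible_set X.
Proof.
move=> X0 H; split=> // F G cF cG XFG.
apply: contrapT => /not_orP[/existsNP[p /not_implyP[Xp Fp]] /existsNP[q /not_implyP[Xq Gq]]].
have [f [rf fp fF]] := notin_closedP cF Fp; have [g [rg gq gG]] := notin_closedP cG Gq.
have [u Xu] := H f g p q rf rg Xp Xq fp gq.
by case: (XFG u Xu) => [/fF ->|/gG ->]; rewrite ?mul0r ?mulr0 eqxx.
Qed.

(** * Algebraic independence along chains of irreducible sets *)

Section Independence.
Variable m : nat.

(* The value of the polynomial in [gs], of degree less than [m] in each variable,
   whose coefficients are given by [c]. *)
Fixpoint peval (gs : seq (points n K -> K)) (c : seq nat -> K) p : K :=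
  if gs is g :: gs' then \sum_(e < m) peval gs' (fun l => c ((e : nat) :: l)) p * g p ^+ e
  else c [::].

Definition exponents d (l : seq nat) := (size l == d) && all (fun e => e < m)%N l.

Definition independent X gs := forall c, (forall p, X p -> peval gs c p = 0) ->
  forall l, exponents (size gs) l -> c l = 0.

Lemma peval_regular gs c : (forall g, g \in gs -> regular g) -> regular (peval gs c).
Proof.
elim: gs c => [|g gs IH] c rg /=; first exact: regular_const.
apply: regular_sum => e; apply: regularM.
  by apply: IH => h hgs; apply: rg; rewrite inE hgs orbT.
by apply/regularX/rg; rewrite inE eqxx.
Qed.

Lemma peval0 gs c p : (forall l, exponents (size gs) l -> c l = 0) -> peval gs c p = 0.
Proof.
elim: gs c => [|g gs IH] c c0 /=; first exact: c0.
by apply: big1 => e _; rewrite IH ?mul0r // => l /andP[sl al]; apply: c0; rewrite /exponents /= eqSS sl al ltn_ord.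
Qed.

(** Expand a relation on [Z'] in powers of [g]. On [Z], where [g] vanishes, only the constant
    coefficient survives, so it is zero by independence; irreducibility of [Z'] then allows division
    by [g]. *)
Lemma independent_cons Z Z' g gs : Z `<=` Z' -> irreducible_set Z' -> regular g ->
  (forall h, h \in gs -> regular h) -> (forall p, Z p -> g p = 0) ->
  (exists2 p, Z' p & g p != 0) -> independent Z gs -> independent Z' (g :: gs).
Proof.
move=> ZZ' irr rg rgs g0 [p0 Zp0 gp0] ind.
have key m' (c : nat -> seq nat -> K) :
    (forall p, Z' p -> \sum_(e < m') peval gs (c e) p * g p ^+ e = 0) ->
    forall e, (e < m')%N -> forall l, exponents (size gs) l -> c e l = 0.
  elim: m' c => [//|m' IH] c H.
  have c0 : forall l, exponents (size gs) l -> c 0%N l = 0.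
    apply: ind => p Zp; have := H p (ZZ' p Zp).
    rewrite big_ord_recl /= mulr1 big1 ?addr0 // => e _.
    by rewrite (g0 p Zp) expr0n mulr0.
  have H' p : Z' p -> g p * \sum_(e < m') peval gs (c e.+1) p * g p ^+ e = 0.
    move=> Zp; have := H p Zp; rewrite big_ord_recl /= (peval0 p c0) mul0r add0r => E.
    rewrite -[RHS]E mulr_sumr; apply: eq_bigr => e _.
    by rewrite /bump /= add1n exprS mulrCA.
  have [|E|E] := irreducible_mul irr rg _ H'.
  - apply: regular_sum => e; apply: regularM; last exact: regularX.
    exact: peval_regular.
  - by move: gp0; rewrite E // eqxx.
  - by move=> [//|e] em; apply: (IH (fun e => c e.+1)).
move=> c H [|e l] // /andP[/eqP[sl] /= /andP[em al]].
by apply: (key m (fun e l => c (e :: l))) => //; rewrite /exponents sl eqxx.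
Qed.

End Independence.

(** Each strict inclusion of the chain supplies a regular function that vanishes on the smaller set
    but not on the larger one. *)
Lemma chain_independent X d : irreducible_chain X d ->
  exists gs, [/\ size gs = d, forall g, g \in gs -> regular g & forall m, independent m X gs].
Proof.
move=> [Z [Zirr Zlt]].
have mono m Y Y' gs : Y `<=` Y' -> independent m Y gs -> independent m Y' gs.
  by move=> YY ind c H; apply: ind => p /YY; apply: H.
have key k (kd : (k < d.+1)%N) : exists gs, [/\ size gs = k,
    forall g, g \in gs -> regular g & forall m, independent m (Z (Ordinal kd)) gs].
  elim: k kd => [|k IH] kd.
    exists [::]; split=> // m c H l; rewrite /exponents /= => /andP[/nilP -> _].
    by have [_ [[p Zp] _] _] := Zirr (Ordinal kd); apply: (H p).
  have kd' : (k < d.+1)%N by apply: ltnW.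
  have [gs [sgs rgs ind]] := IH kd'.
  have [ZX irr _] := Zirr (Ordinal kd); have [_ _ ZC] := Zirr (Ordinal kd').
  have [sub nsub] := Zlt (Ordinal kd') (Ordinal kd) (ltnSn k).
  have [p [Zp nZp]] : exists p, Z (Ordinal kd) p /\ ~ Z (Ordinal kd') p.
    by apply: contrapT => N; apply: nsub => p Zp; apply: contrapT => nZ; apply: N; exists p.
  have [f [rf fp f0]] : exists f, [/\ regular f, f p != 0 &
      forall q, Z (Ordinal kd') q -> f q = 0].
    have ncl : ~ closure (Z (Ordinal kd')) p by move=> cl; apply: nZp; apply: ZC; split=> //; apply: ZX.
    have [f [rf fp f0]] := notin_closedP (@closed_closure _ _) ncl.
    by exists f; split=> // q Zq; apply: f0; apply: subset_closure.
  exists (f :: gs); split=> /=; first by rewrite sgs.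
    by move=> g; rewrite inE => /orP[/eqP ->|/rgs].
  by move=> m; apply: independent_cons (ind m) => //; exists p.
have [gs [sgs rgs ind]] := key d (ltnSn d).
exists gs; split=> // m; apply: mono (ind m).
by have [] := Zirr (Ordinal (ltnSn d)).
Qed.

End Zariski.

(** * Torus charts *)

Section InfiniteField.
Variable K : fieldType.
Hypothesis K_infinite : infinite_set [set: K].

Lemma infinite_uniq m : exists2 s : seq K, uniq s & size s = m.
Proof.
elim: m => [|m [s us sm]]; first by exists [::].
have [x xs] : exists x, x \notin s.
  apply: contrapT => N; apply: K_infinite.
  have -> : [set: K] = [set` s] by apply/seteqP; split=> x // _ /=; apply/negPn/negP => xs; apply: N; exists x.
  exact: finite_seq.
by exists (x :: s); rewrite /= ?xs ?sm.
Qed.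

Lemma infinite_poly_neq0 (P : {poly K}) : P != 0 -> exists t, P.[t] != 0.
Proof.
move=> P0; apply: contrapT => N; have [s us sP] := infinite_uniq (size P).
suff : (size s < size P)%N by rewrite sP ltnn.
apply: max_poly_roots => //; apply/allP => x _; apply: contrapT => Px; apply: N; exists x; exact/negP.
Qed.

End InfiniteField.

Section Laurent.
Variables (N : nat) (K : fieldType).
Implicit Types (t : 'I_N -> K) (f g : ('I_N -> K) -> K).

Definition laurent f : Prop := exists (P : {mpoly K[N]}) (D : nat),
  forall t, torus t -> f t * (\prod_i t i) ^+ D = P.@[t].

Lemma torus_prod_neq0 t : torus t -> \prod_i t i != 0.
Proof. by move=> Tt; apply/prodf_neq0 => i _; apply: Tt. Qed.

Let prodX : {mpoly K[N]} := \prod_i 'X_i.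

Let prodXE t : prodX.@[t] = \prod_i t i.
Proof. by rewrite rmorph_prod; apply: eq_bigr => i _; rewrite /= mevalXU. Qed.

Lemma laurent_const c : laurent (fun=> c).
Proof. by exists c%:MP, 0%N => t _; rewrite mulr1 mevalC. Qed.

Lemma laurent_coord i : laurent (fun t => t i).
Proof. by exists 'X_i, 0%N => t _; rewrite mulr1 mevalXU. Qed.

Lemma laurentV i : laurent (fun t => (t i)^-1).
Proof.
exists (\prod_(j | j != i) 'X_j), 1%N => t Tt.
rewrite rmorph_prod (bigD1 i) //= expr1 mulKf; last exact: Tt.
by apply: eq_bigr => j _; rewrite mevalXU.
Qed.

Lemma laurentD f g : laurent f -> laurent g -> laurent (fun t => f t + g t).
Proof.
move=> [P [D fP]] [Q [E gQ]]; exists (P * prodX ^+ E + Q * prodX ^+ D), (D + E)%N => t Tt.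
by rewrite mevalD !mevalM !rmorphXn /= !prodXE -fP // -gQ // exprD; ring.
Qed.

Lemma laurentM f g : laurent f -> laurent g -> laurent (fun t => f t * g t).
Proof.
move=> [P [D fP]] [Q [E gQ]]; exists (P * Q), (D + E)%N => t Tt.
by rewrite mevalM -fP // -gQ // exprD; ring.
Qed.

Lemma laurentN f : laurent f -> laurent (fun t => - f t).
Proof.
move=> lf; have := laurentM (laurent_const (-1)) lf.
by congr laurent; apply: funext => t; rewrite mulN1r.
Qed.

Lemma laurentB f g : laurent f -> laurent g -> laurent (fun t => f t - g t).
Proof. by move=> lf /laurentN; apply: laurentD. Qed.

Lemma laurent_sum (I : Type) (r : seq I) (F : I -> ('I_N -> K) -> K) :
  (forall i, laurent (F i)) -> laurent (fun t => \sum_(i <- r) F i t).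
Proof.
move=> lF; elim: r => [|i r IH].
  by have := laurent_const 0; congr laurent; apply: funext => t; rewrite big_nil.
by have := laurentD (lF i) IH; congr laurent; apply: funext => t; rewrite big_cons.
Qed.

Lemma meval_line (P : {mpoly K[N]}) (l : 'I_N -> {poly K}) :
  exists Q : {poly K}, forall c, P.@[fun i => (l i).[c]] = Q.[c].
Proof.
exists (\sum_(m <- msupp P) P@_m *: \prod_i l i ^+ m i) => c.
rewrite mevalE horner_sum; apply: eq_bigr => m _.
rewrite hornerZ horner_prod; congr (_ * _); apply: eq_bigr => i _.
by rewrite horner_exp.
Qed.

Hypothesis K_infinite : infinite_set [set: K].

(* Two points of a torus are joined by a line, on which the restrictions of
   Laurent polynomials are quotients of polynomials in one variable. *)
Lemma laurent_mul_neq0 f g a b : laurent f -> laurent g -> torus a -> torus b ->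
  f a != 0 -> g b != 0 ->
  exists t, [/\ torus t, forall i, a i = b i -> t i = a i, f t != 0 & g t != 0].
Proof.
move=> [P [D fP]] [Q [E gQ]] Ta Tb fa gb.
pose l i : {poly K} := (a i)%:P + (b i - a i) *: 'X.
have lE i c : (l i).[c] = a i + (b i - a i) * c by rewrite /l !hornerE.
have l0 : (fun i => (l i).[0]) = a by apply: funext => i; rewrite lE mulr0 addr0.
have l1 : (fun i => (l i).[1]) = b by apply: funext => i; rewrite lE mulr1 addrC subrK.
have [P' PE] := meval_line P l; have [Q' QE] := meval_line Q l.
have P'0 : P' != 0.
  apply: contraNneq fa => P'0; have := PE 0; rewrite P'0 horner0 l0 -fP // => /eqP.
  by rewrite mulf_eq0 expf_eq0 (negbTE (torus_prod_neq0 Ta)) andbF orbF.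
have Q'0 : Q' != 0.
  apply: contraNneq gb => Q'0; have := QE 1; rewrite Q'0 horner0 l1 -gQ // => /eqP.
  by rewrite mulf_eq0 expf_eq0 (negbTE (torus_prod_neq0 Tb)) andbF orbF.
have li0 i : l i != 0.
  by apply: contraTneq (Ta i) => li0; rewrite -l0 li0 horner0 eqxx.
have : P' * Q' * \prod_i l i != 0 by rewrite !mulf_neq0 //; apply/prodf_neq0 => i _.
case/(infinite_poly_neq0 K_infinite) => c; rewrite !hornerM !mulf_eq0 !negb_or.
rewrite horner_prod => /andP[/andP[Pc Qc] /prodf_neq0 lc].
have Tt : torus (fun i => (l i).[c]) by move=> i; apply: lc.
exists (fun i => (l i).[c]); split=> //.
- by move=> i ab; rewrite lE ab subrr mul0r addr0.
- by move: Pc; rewrite -PE -fP // mulf_eq0 negb_or => /andP[].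
- by move: Qc; rewrite -QE -gQ // mulf_eq0 negb_or => /andP[].
Qed.

End Laurent.

(** * Linear dependence by counting monomials *)

Section Dependence.
Variables (N : nat) (K : fieldType).

Definition degree_le (P : {mpoly K[N]}) d := (msize P <= d.+1)%N.

Lemma degree_leM P Q d e : degree_le P d -> degree_le Q e -> degree_le (P * Q) (d + e).
Proof.
rewrite /degree_le => Pd Qe; have [->|P0] := eqVneq P 0; first by rewrite mul0r msize0.
have [->|Q0] := eqVneq Q 0; first by rewrite mulr0 msize0.
by rewrite msizeM // -subn1 leq_subLR add1n -addSn -addnS; apply: leq_add.
Qed.

Lemma degree_leX P d e : degree_le P d -> degree_le (P ^+ e) (d * e).
Proof.
move=> Pd; elim: e => [|e IH]; first by rewrite muln0 expr0 /degree_le msize1.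
by rewrite exprS mulnS; apply: degree_leM.
Qed.

Lemma degree_leW P d e : (d <= e)%N -> degree_le P d -> degree_le P e.
Proof. by rewrite /degree_le; lia. Qed.

Lemma card_bmultinom (B : nat) : (#|{: 'X_{1..N < B}}| <= B ^ N)%N.
Proof.
case: B => [|B].
  apply: leq_trans (leq0n _); rewrite leqn0; apply/eqP/eq_card0 => -[m hm].
  by have := hm; rewrite ltn0.
pose h (m : 'X_{1..N < B.+1}) : {ffun 'I_N -> 'I_B.+1} := [ffun i => inord (bmnm m i)].
have le_mdeg (m : 'X_{1..N}) i : (m i <= mdeg m)%N.
  by rewrite mdegE (bigD1 i) //= leq_addr.
have : injective h.
  move=> m m' /ffunP hm; apply: val_inj; apply/mnmP => i; have := hm i; rewrite !ffunE.
  move/(congr1 val); rewrite /= !inordK //.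
    by apply: leq_ltn_trans (_ : mdeg m' < _)%N; [apply: le_mdeg | apply: bmdeg].
  by apply: leq_ltn_trans (_ : mdeg m < _)%N; [apply: le_mdeg | apply: bmdeg].
by move/leq_card; rewrite card_ffun !card_ord.
Qed.

(** There are more polynomials than monomials of the allowed degrees, so the coefficient matrix has
    a left kernel vector. *)
Lemma mpoly_dependence (I : finType) (R : I -> {mpoly K[N]}) (B : nat) :
  (forall u, msize (R u) <= B)%N -> (B ^ N < #|I|)%N ->
  exists2 c : I -> K, \sum_u c u *: R u = 0 & exists u, c u != 0.
Proof.
move=> RB lt; pose J := {: 'X_{1..N < B}} : finType.
pose M := \matrix_(u < #|I|, j < #|J|) (R (enum_val u))@_(bmnm (enum_val j)).
have rk : (\rank M < #|I|)%N.
  by apply: leq_ltn_trans (rank_leq_col M) _; apply: leq_ltn_trans (card_bmultinom B) lt.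
have : kermx M != 0 by rewrite -mxrank_eq0 mxrank_ker subn_eq0 -ltnNge.
case/rowV0Pn => v /sub_kermxP vM v0.
have [u0 vu0] : exists u, v 0 u != 0.
  apply/existsP; apply: contraNT v0 => /existsPn N0; apply/eqP/rowP => u.
  by rewrite mxE; apply/eqP; have := N0 u; rewrite negbK.
exists (fun u => v 0 (enum_rank u)); last by exists (enum_val u0); rewrite enum_valK.
apply/mpolyP => m; rewrite mcoeff0 raddf_sum /=.
have [mB|mB] := ltnP (mdeg m) B; last first.
  by apply: big1 => u _; rewrite mcoeffZ memN_msupp_eq0 ?mulr0 //; apply: msize_mdeg_ge; apply: leq_trans mB.
have /rowP/(_ (enum_rank (BMultinom mB))) := vM; rewrite !mxE => E.
rewrite -[RHS]E (reindex (@enum_rank I)); last first.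
  by exists (@enum_val I _) => x _; rewrite ?enum_valK ?enum_rankK.
by apply: eq_bigr => u _; rewrite mcoeffZ !mxE !enum_rankK.
Qed.

End Dependence.

Section MonomialIndex.
Variable m : nat.

Fixpoint expt_index (d : nat) : finType :=
  if d is d'.+1 then ('I_m * expt_index d')%type : finType else unit : finType.

Fixpoint expt_seq d : expt_index d -> seq nat :=
  if d is d'.+1 then fun u => (u.1 : nat) :: expt_seq u.2 else fun=> [::].

Lemma card_expt_index d : #|expt_index d| = (m ^ d)%N.
Proof. by elim: d => [|d IH]; rewrite ?card_unit // card_prod card_ord IH expnS. Qed.

Lemma expt_seq_inj d : injective (@expt_seq d).
Proof.
elim: d => [|d IH]; first by move=> [] [].
by move=> [e u] [e' u'] /= [/val_inj -> /IH ->].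
Qed.

Lemma expt_seqP d (u : expt_index d) : exponents m d (expt_seq u).
Proof.
elim: d u => [|d IH] //= [e u]; have /andP[sz al] := IH u.
by rewrite /exponents /= eqSS sz ltn_ord al.
Qed.

End MonomialIndex.

(** * Charts and the upper bound on dimension *)

Section Chart.
Variables (n N : nat) (K : fieldType).
Notation regular := (@regular_function n K).
Implicit Types (X Y : set (points n K)) (phi : ('I_N -> K) -> points n K).

(* A parametrization of a dense subset of [X] by a torus. *)
Record chart X phi : Prop := Chart {
  chart_in : forall t, torus t -> X (phi t);
  chart_dense : forall p f, X p -> regular f -> f p != 0 ->
    exists2 t, torus t & f (phi t) != 0;
  chart_coord : forall i, exists2 f, regular f & forall t, torus t -> f (phi t) = t i;
  chart_laurent : forall f, regular f -> laurent (fun t => f (phi t)) }.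

Notation marked := ((points n K -> K) * {mpoly K[N]})%type.

Fixpoint monomial m (gs : seq marked) : expt_index m (size gs) -> points n K -> K :=
  match gs with
  | [::] => fun _ _ => 1
  | g :: gs' => fun u p => g.1 p ^+ u.1 * monomial u.2 p
  end.

Let prodX : {mpoly K[N]} := \prod_i 'X_i.

(** Numerator of a monomial in the functions of [gs]. The power of [prodX] pads it so that all
    monomials share one denominator, whatever their exponents. *)
Fixpoint monomial_poly m D (gs : seq marked) : expt_index m (size gs) -> {mpoly K[N]} :=
  match gs with
  | [::] => fun _ => 1
  | g :: gs' => fun u => g.2 ^+ u.1 * prodX ^+ (D * (m - u.1)) * monomial_poly D u.2
  end.

Lemma peval_monomials m gs c p :
  peval m [seq g.1 | g <- gs] c p =
  \sum_(u : expt_index m (size gs)) c (expt_seq u) * monomial u p.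
Proof.
elim: gs c => [|g gs IH] c /=.
  by rewrite (big_pred1 tt) ?mulr1 // => -[]; rewrite eqxx.
under eq_bigr do rewrite IH mulr_suml.
by rewrite pair_bigA; apply: eq_bigr => u _ /=; ring.
Qed.

Lemma degree_le_prodX : degree_le prodX N.
Proof.
rewrite /prodX -[X in degree_le _ X]card_ord -sum1_card.
elim/big_rec2: _ => [|i d P _ IH]; first by rewrite /degree_le msize1.
by apply: degree_leM IH; rewrite /degree_le msizeX mdeg1.
Qed.

Lemma monomial_poly_degree m D d gs (u : expt_index m (size gs)) :
  (forall g, g \in gs -> degree_le g.2 d) ->
  degree_le (monomial_poly D u) (size gs * (m * (d + N * D))).
Proof.
elim: gs u => [|g gs IH] /= u dg; first by rewrite /degree_le msize1.
rewrite mulSn; apply: degree_leM; last first.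
  by apply: IH => h hgs; apply: dg; rewrite inE hgs orbT.
have le_u : (u.1 <= m)%N by apply/ltnW/ltn_ord.
apply: (@degree_leW _ _ _ (d * u.1 + N * (D * (m - u.1)))).
  rewrite mulnDr leq_add //; first by rewrite mulnC leq_mul2r le_u orbT.
  by rewrite mulnA [(m * _)%N]mulnC leq_mul2l leq_subr orbT.
apply: degree_leM; apply: degree_leX; last exact: degree_le_prodX.
by apply: dg; rewrite inE eqxx.
Qed.

Lemma monomial_polyE m D phi gs (u : expt_index m (size gs)) t :
  (forall g, g \in gs -> g.1 (phi t) * (\prod_i t i) ^+ D = g.2.@[t]) ->
  monomial u (phi t) * (\prod_i t i) ^+ (size gs * (D * m)) = (monomial_poly D u).@[t].
Proof.
have prodXE : prodX.@[t] = \prod_i t i.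
  by rewrite rmorph_prod; apply: eq_bigr => i _; rewrite /= mevalXU.
elim: gs u => [|g gs IH] /= u gE; first by rewrite mul0n mulr1 meval1.
have le_u : (u.1 <= m)%N by apply/ltnW/ltn_ord.
rewrite !mevalM !rmorphXn /= prodXE -gE ?inE ?eqxx // -IH; last first.
  by move=> h hgs; apply: gE; rewrite inE hgs orbT.
have -> : ((size gs).+1 * (D * m) = D * u.1 + D * (m - u.1) + size gs * (D * m))%N.
  by rewrite mulSn -mulnDr subnKC.
by rewrite !exprD exprMn -exprM mulrACA !mulrA.
Qed.

Lemma common_denominator phi gs : (forall f, regular f -> laurent (fun t => f (phi t))) ->
  (forall g, g \in gs -> regular g) ->
  exists (D : nat) (gPs : seq marked), [seq g.1 | g <- gPs] = gs /\
    forall g, g \in gPs -> forall t, torus t -> g.1 (phi t) * (\prod_i t i) ^+ D = g.2.@[t].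
Proof.
move=> L; have prodXE t : prodX.@[t] = \prod_i t i.
  by rewrite rmorph_prod; apply: eq_bigr => i _; rewrite /= mevalXU.
elim: gs => [|g gs IH] rg; first by exists 0%N, [::].
have [|D [gPs [gPsE H]]] := IH; first by move=> h hgs; apply: rg; rewrite inE hgs orbT.
have [|P [E gP]] := L g; first by apply: rg; rewrite inE eqxx.
exists (D + E)%N, ((g, P * prodX ^+ D) :: [seq (h.1, h.2 * prodX ^+ E) | h <- gPs]).
split; first by rewrite /= -map_comp -gPsE; congr (_ :: _); apply: eq_map.
move=> h; rewrite inE => /orP[/eqP ->|/mapP[h' hg ->]] t Tt /=;
  rewrite mevalM rmorphXn /= prodXE.
  by rewrite -gP // exprD; ring.
by rewrite -(H _ hg t Tt) exprD; ring.
Qed.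

Lemma chart_dependent X phi gs : chart X phi -> (forall g, g \in gs -> regular g) ->
  size gs = N.+1 -> exists m, ~ independent m X gs.
Proof.
move=> ch rg sz; have [D [gPs [gPsE gP]]] := common_denominator (chart_laurent ch) rg.
have [d dP] : exists d, forall g, g \in gPs -> degree_le g.2 d.
  elim: (gPs) => [|g l [d dP]]; first by exists 0%N.
  exists (d + msize g.2)%N => h; rewrite inE => /orP[/eqP ->|/dP]; last first.
    by apply: degree_leW; apply: leq_addr.
  by rewrite /degree_le; apply: leqW; apply: leq_addl.
have sz' : size gPs = N.+1 by rewrite -sz -gPsE size_map.
(* There are [m ^ N.+1] monomials, with numerators of degree at most [m * E]. As [m] exceeds
   [E.+1 ^ N], one gets [(m * E).+1 ^ N <= (m * E.+1) ^ N < m ^ N.+1]. *)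
pose E := (N.+1 * (d + N * D))%N; pose m := (E.+1 ^ N).+1.
exists m => ind.
have [||c c0 [u0 cu0]] := @mpoly_dependence N K _ (fun u : expt_index m (size gPs) => monomial_poly D u) (m * E).+1.
- move=> u; have := @monomial_poly_degree m D d gPs u dP; rewrite /degree_le sz'.
  by have -> : (N.+1 * (m * (d + N * D)) = m * E)%N by rewrite /E mulnCA.
- rewrite card_expt_index sz' expnS.
  apply: leq_ltn_trans (_ : (m * E.+1) ^ N < _)%N.
    have expM (a b e : nat) : (a <= b -> a ^ e <= b ^ e)%N.
      by move=> ab; elim: e => // e IH; rewrite !expnS leq_mul.
    by apply: expM; rewrite mulnS -add1n leq_add.
  by rewrite expnMn mulnC ltn_pmul2r // expn_gt0.
pose c' l := \sum_(u | expt_seq u == l) c u.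
have c'E u : c' (expt_seq u) = c u.
  rewrite /c' (big_pred1 u) // => v; apply/eqP/eqP => [|->//]; exact: expt_seq_inj.
have H : forall p, X p -> peval m gs c' p = 0.
  move=> p Xp; apply/eqP; apply: contraT => np.
  have [t Tt] := chart_dense ch Xp (peval_regular m c' rg) np.
  rewrite -gPsE peval_monomials; case/eqP.
  apply: (mulIf (expf_neq0 (size gPs * (D * m)) (torus_prod_neq0 Tt))).
  rewrite mul0r mulr_suml -[RHS](meval0 t) -c0 raddf_sum /=.
  apply: eq_bigr => u _; rewrite mevalZ -mulrA c'E; congr (_ * _).
  by apply: monomial_polyE => g /gP; apply.
have := ind c' H (expt_seq u0); rewrite sz -sz' expt_seqP c'E => /(_ isT) E0.
by rewrite E0 eqxx in cu0.
Qed.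

Lemma chain_truncate (Y : set (points n K)) d e : (e <= d)%N -> irreducible_chain Y d -> irreducible_chain Y e.
Proof.
move=> ed [Z [Z1 Z2]]; have ed' : (e.+1 <= d.+1)%N by [].
exists (fun i => Z (widen_ord ed' i)); split=> [i|i j ij]; first exact: Z1.
exact: Z2.
Qed.

Lemma chart_no_chain X Y phi d : chart X phi -> Y `<=` X -> (N < d)%N -> ~ irreducible_chain Y d.
Proof.
move=> ch YX Nd /(chain_truncate Nd) chain.
have [gs [sz rg ind]] := chain_independent chain.
have [m] := chart_dependent ch rg sz; apply=> c H.
by apply: ind => p /YX; apply: H.
Qed.

End Chart.

Section ChartDimension.
Variables (n N : nat) (K : fieldType).
Notation regular := (@regular_function n K).
Implicit Types (X : set (points n K)) (phi : ('I_N -> K) -> points n K).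

(** The inverse map is regular because a Laurent polynomial is a quotient by a power of the product
    of the coordinates, which has no zero on the torus. *)
Lemma chart_is_torus X phi (coord : points n K -> 'I_N -> K) : chart X phi ->
  locally_closed X -> (forall i, regular (fun p => coord p i)) ->
  (forall p, X p -> torus (coord p) /\ phi (coord p) = p) ->
  (forall t, torus t -> coord (phi t) = t) -> is_torus X N.
Proof.
move=> ch lc rc cX cphi; split=> //; exists coord, phi; split.
- split=> [p /cX[]//|f [P fP] p Xp].
  exists (fun q => f (coord q)), (fun=> 1); split; last by move=> q _ _; rewrite divr1.
  + have := regular_sum (msupp P) (fun m => regularM (@regular_const n K P@_m)
      (regular_prod (index_enum 'I_N) (fun i => regularX (m i) (rc i)))).
    by congr regular; apply: funext => q; rewrite fP mevalE.
  + exact: regular_const.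
  + exact: oner_neq0.
- split=> [t Tt|f rf t Tt]; first exact: (chart_in ch).
  have [P [D fP]] := chart_laurent ch rf.
  exists (fun t => P.@[t]), (fun t => (\prod_i t i) ^+ D); split.
  + by exists P.
  + exists ((\prod_i 'X_i) ^+ D) => u; rewrite rmorphXn rmorph_prod /=; congr (_ ^+ _).
    by apply: eq_bigr => i _; rewrite mevalXU.
  + by rewrite expf_neq0 // torus_prod_neq0.
  + by move=> u Tu h; rewrite -fP // mulfK.
- by move=> p /cX[].
- exact: cphi.
Qed.

(** A flag of coordinate subtori; the closures of their images under a chart form a chain of length
    [N]. *)
Definition face (j : nat) : set ('I_N -> K) :=
  [set t | torus t /\ forall i : 'I_N, (j <= i)%N -> t i = 1].

Lemma face_mono j j' : (j <= j')%N -> face j `<=` face j'.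
Proof. by move=> jj t [Tt t1]; split=> // i ji; apply/t1/(leq_trans jj). Qed.

Hypothesis K_infinite : infinite_set [set: K].

Lemma face_irreducible X phi j : chart X phi -> irreducible_set (phi @` face j).
Proof.
move=> ch; apply: irreducible_setP.
  exists (phi (fun=> 1)); exists (fun=> 1) => //; split=> // i; exact: oner_neq0.
move=> f g p q rf rg [a [Ta a1] <-] [b [Tb b1] <-] fa gb.
have [t [Tt tab ft gt]] := laurent_mul_neq0 K_infinite (chart_laurent ch rf)
  (chart_laurent ch rg) Ta Tb fa gb.
exists (phi t); last by rewrite mulf_neq0.
by exists t => //; split=> // i ji; rewrite tab a1 // b1.
Qed.

Lemma chart_closure X phi : chart X phi -> X `<=` closure (phi @` face N).
Proof.
move=> ch p Xp; apply/zariski_closureP => f rf fp.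
have [t Tt ft] := chart_dense ch Xp rf fp; exists (phi t) => //; exists t => //.
by split=> // i; rewrite leqNgt ltn_ord.
Qed.

Lemma chart_face_sub X phi j : chart X phi -> phi @` face j `<=` X.
Proof. by move=> ch _ [t [Tt _] <-]; apply: (chart_in ch). Qed.

Lemma chart_irreducible X phi : chart X phi -> irreducible_set X.
Proof.
move=> ch; apply: (irreducible_between (face_irreducible N ch)).
  exact: chart_face_sub.
exact: chart_closure.
Qed.

Lemma infinite_not01 : exists2 c : K, c != 0 & c != 1.
Proof.
have [[|x [|y [|z s]]] us // _] := infinite_uniq K_infinite 3.
move: us; rewrite /= !inE !negb_or => /andP[/and3P[xy xz _] /andP[/andP[yz _] _]].
have [x0|x0] := eqVneq x 0; last first.
  have [x1|x1] := eqVneq x 1; last by exists x.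
  have [y0|y0] := eqVneq y 0; last by exists y; rewrite // -x1 eq_sym.
  by exists z; [rewrite -y0 eq_sym | rewrite -x1 eq_sym].
have y0 : y != 0 by rewrite -x0 eq_sym.
have [y1|y1] := eqVneq y 1; last by exists y.
by exists z; [rewrite -x0 eq_sym | rewrite -y1 eq_sym].
Qed.

Lemma chart_chain X phi : chart X phi -> irreducible_chain X N.
Proof.
move=> ch; pose Z (i : 'I_N.+1) := closure (phi @` face i) `&` X.
exists Z; split=> [i|i j ij].
  split; first by move=> p [].
  - apply: (irreducible_between (face_irreducible i ch)); last by move=> p [].
    by move=> p pf; split; [apply: subset_closure|apply: chart_face_sub pf].
  - move=> p [clp Xp]; split=> //.
    by apply: closed_closure; apply: closure_subset clp => q [].
split.
  move=> p [clp Xp]; split=> //; apply: closure_subset clp.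
  by move=> _ [t ft <-]; exists t => //; apply: face_mono ft; apply: ltnW.
have iN : (i < N)%N by apply: leq_trans ij _; rewrite -ltnS ltn_ord.
have [g rg gE] := chart_coord ch (Ordinal iN).
have [c c0 c1] := infinite_not01.
(* This point of the larger face has its coordinate of index [i] different from 1, while that
   coordinate is identically 1 on the smaller face. *)
pose t (k : 'I_N) : K := if k == Ordinal iN then c else 1.
have Tt : torus t by move=> k; rewrite /t; case: ifP => _; rewrite ?oner_neq0.
have tf : face j t.
  split=> // k jk; rewrite /t ifN //; apply: contraTneq jk => ->.
  by rewrite -ltnNge.
have Zt : Z j (phi t).
  by split; [apply: subset_closure; exists t | apply: (chart_in ch)].
move=> sub; have [/zariski_closureP cl _] := sub _ Zt.
have [||q [u [Tu u1] <-]] := cl (fun p => g p - 1).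
- by apply: regularB => //; apply: regular_const.
- by rewrite gE // /t eqxx subr_eq0.
- by rewrite gE // u1 // subrr eqxx.
Qed.

Lemma chart_dimension X phi : chart X phi -> has_dimension X N.
Proof.
move=> ch; split; first exact: chart_chain ch.
by apply: (chart_no_chain ch).
Qed.

End ChartDimension.

(** * Points with vanishing radii *)

Section Families.
Variables (n : nat) (K : fieldType).
Hypothesis n_gt2 : (2 < n)%N.
Implicit Types (i j k l m : 'I_n) (p q : points n K).
Notation regular := (@regular_function n K).

Lemma regular_value a : regular (fun p => value n_gt2 p a).
Proof. exact: regular_eval. Qed.

Lemma laurent_ext N (f g : ('I_N -> K) -> K) : (forall t, torus t -> f t = g t) ->
  laurent f -> laurent g.
Proof. by move=> fg [P [D fP]]; exists P, D => t Tt; rewrite -fg // fP. Qed.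

Lemma point_family N (v : ('I_N -> K) -> tarc n -> K) :
  (forall t, torus t -> exists p : points n K, forall a, value n_gt2 p a = v t a) ->
  exists phi, forall t, torus t -> forall a, value n_gt2 (phi t) a = v t a.
Proof.
move=> H; have [p0 _] := H (fun=> 1) (fun=> oner_neq0 _).
have ex t : exists p, torus t -> forall a, value n_gt2 p a = v t a.
  have [Tt|nT] := pselect (torus t); last by exists p0.
  by have [p pE] := H t Tt; exists p.
by have [phi phiP] := choice ex; exists phi.
Qed.

Lemma laurent_family N (v : ('I_N -> K) -> tarc n -> K) (phi : ('I_N -> K) -> points n K) f :
  (forall t, torus t -> forall a, value n_gt2 (phi t) a = v t a) ->
  (forall a, laurent (v^~ a)) -> (forall i, laurent (fun t => (v t (chord i (ordS i)))^-1)) ->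
  regular f -> laurent (fun t => f (phi t)).
Proof.
move=> phiE lv lb [s fE].
suff H (x : cluster_algebra n) : laurent (fun t => pt_eval (phi t) x).
  have := laurent_sum s (fun cx => laurentM (@laurent_const N K cx.1) (H cx.2)).
  by congr laurent; apply: funext => t; rewrite fE.
elim/(@cluster_algebra_ind n n_gt2): x => [|x y lx ly|x y lx ly|a _|i].
- have := @laurent_const N K 1.
  by congr laurent; apply: funext => t; rewrite pt_eval1.
- have := laurentB lx ly; congr laurent; apply: funext => t; by rewrite pt_evalB.
- have := laurentM lx ly; congr laurent; apply: funext => t; by rewrite pt_evalM.
- by apply: laurent_ext (lv a) => t Tt; rewrite -phiE.
- by apply: laurent_ext (lb i) => t Tt; rewrite pt_eval_binv phiE.
Qed.

Hypothesis K_infinite : infinite_set [set: K].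

(* The value at 0 of a line of vectors lies in the closure of its generic values. *)
Lemma deform (s t : {poly K}) (r z : 'I_n -> {poly K}) p f (h : {poly K}) :
  (forall a, is_tagged_arc a -> value n_gt2 p a = (param_value s t r z a).[0]) ->
  regular f -> f p != 0 -> h != 0 ->
  exists c q, [/\ h.[c] != 0, f q != 0 &
    forall a, value n_gt2 q a = (param_value s t r z a).[c]].
Proof.
move=> pE rf fp h0; pose pv : tarc n -> {poly K} := param_value s t r z.
pose good c q := forall a, is_tagged_arc a -> value n_gt2 q a = (pv a).[c].
(* Along the deformation a regular function is a quotient of polynomials in the parameter. The
   denominators come from boundary chords only, and so are nonzero at 0. *)
pose quot (g : points n K -> K) := exists P Q : {poly K}, Q.[0] != 0 /\
  forall c q, good c q -> g q * Q.[c] = P.[c].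
have quotM g g' : quot g -> quot g' -> quot (fun q => g q * g' q).
  move=> [P [Q [Q0 H]]] [P' [Q' [Q0' H']]]; exists (P * P'), (Q * Q').
  split=> [|c q G]; first by rewrite hornerM mulf_neq0.
  by rewrite !hornerM mulrACA H // H'.
have quotD g g' : quot g -> quot g' -> quot (fun q => g q + g' q).
  move=> [P [Q [Q0 H]]] [P' [Q' [Q0' H']]]; exists (P * Q' + P' * Q), (Q * Q').
  split=> [|c q G]; first by rewrite hornerM mulf_neq0.
  by rewrite hornerD !hornerM -(H c q G) -(H' c q G); ring.
have quotC e : quot (fun=> e).
  by exists e%:P, 1; rewrite !hornerE oner_neq0; split=> // c q _; rewrite !hornerE.
have quotx (x : cluster_algebra n) : quot (fun q => pt_eval q x).
  elim/(@cluster_algebra_ind n n_gt2): x => [|x y lx ly|x y lx ly|a ta|i].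
  - by have := quotC 1; congr quot; apply: funext => q; rewrite pt_eval1.
  - have := quotD _ _ lx (quotM _ _ (quotC (-1)) ly).
    by congr quot; apply: funext => q; rewrite pt_evalB mulN1r.
  - by have := quotM _ _ lx ly; congr quot; apply: funext => q; rewrite pt_evalM.
  - by exists (pv a), 1%:P; rewrite hornerC oner_neq0; split=> // c q G; rewrite hornerC mulr1; apply: G.
  - have tb : is_tagged_arc (chord i (ordS i)) by rewrite /= ordS_neq // ltnW.
    exists 1%:P, (pv (chord i (ordS i))); rewrite -pE // value_boundary_neq0.
    split=> // c q G; rewrite hornerC (pt_eval_binv n_gt2) -(G _ tb) mulVf //.
    exact: value_boundary_neq0.
have [P [Q [Q0 fQ]]] : quot f.
  case: rf => l fE; rewrite (_ : f = fun q => \sum_(ca <- l) ca.1 * pt_eval q ca.2); last exact: funext.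
  elim: l {fE} => [|cx l IH]; last first.
    have := quotD _ _ (quotM _ _ (quotC cx.1) (quotx cx.2)) IH.
    by congr quot; apply: funext => q; rewrite big_cons.
  by have := quotC 0; congr quot; apply: funext => q; rewrite big_nil.
have P0 : P != 0.
  apply: contraNneq fp => P0; have := fQ 0 p pE; rewrite P0 horner0 => /eqP.
  by rewrite mulf_eq0 (negbTE Q0) orbF.
have b0 i : pv (chord i (ordS i)) != 0.
  apply: contraNneq (value_boundary_neq0 n_gt2 p i) => b0.
  have tb : is_tagged_arc (chord i (ordS i)) by rewrite /= ordS_neq // ltnW.
  by rewrite (pE _ tb) -[param_value _ _ _ _ _]/(pv (chord i (ordS i))) b0 horner0.
have : P * h * \prod_i pv (chord i (ordS i)) != 0.
  by rewrite !mulf_neq0 //; apply/prodf_neq0 => i _.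
case/(infinite_poly_neq0 K_infinite) => c; rewrite !hornerM !mulf_eq0 !negb_or.
rewrite horner_prod => /andP[/andP[Pc hc] /prodf_neq0 bc].
have pvc a : (pv a).[c] = param_value s.[c] t.[c] (fun i => (r i).[c]) (fun i => (z i).[c]) a.
  by rewrite -[LHS]/(horner_eval c _) /pv param_value_morph.
have [i|q qE] := @point_exists n K n_gt2 s.[c] t.[c] (fun i => (r i).[c]) (fun i => (z i).[c]).
  by rewrite -pvc; apply: bc.
have G : good c q by move=> a _; rewrite qE -pvc.
exists c, q; split=> //; last by move=> a; rewrite qE -pvc.
by move: Pc; rewrite -(fQ c q G) mulf_eq0 negb_or => /andP[].
Qed.

End Families.

(** * The deep points all of whose radii vanish *)

Section Components.
Variables (n : nat) (K : fieldType).
Hypothesis n_gt2 : (2 < n)%N.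
Implicit Types (i j k l m : 'I_n) (p q : points n K).
Notation vl := (value n_gt2).

Let n_gt1 : (1 < n)%N. Proof. exact: ltnW. Qed.

Definition radii_zero : set (points n K) := [set p | forall i s, vl p (radius i s) = 0].

Lemma closed_radii_zero : closed radii_zero.
Proof.
have := @closed_zeros_fam n K ('I_n * bool)%type (fun x p => vl p (radius x.1 x.2))
  (fun x => @regular_value n K n_gt2 _).
congr closed; apply/seteqP; split=> p /= H; last by move=> [i s]; apply: H.
by move=> i s; apply: (H (i, s)).
Qed.

Lemma radii_zero_deep : radii_zero `<=` @deep_locus n K.
Proof.
move=> p p0; apply/(deepP n_gt2) => T triT; have [i [s iT]] := radius_exists n_gt1 triT.
by exists (radius i s).
Qed.

Lemma chord_antisym p (s : bool) i j : (forall k, vl p (radius k (~~ s)) = 0) -> i != j ->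
  vl p (chord j i) = - vl p (chord i j).
Proof.
move=> p0 ij; have := value_digon n_gt2 p s ij; rewrite p0 mulr0 => /esym/eqP.
by rewrite addrC addr_eq0 => /eqP.
Qed.

Lemma chord_quad p i j k l : (i < j)%N -> (j < k)%N -> (k < l)%N ->
  vl p (chord i k) * vl p (chord j l) =
  vl p (chord i j) * vl p (chord k l) + vl p (chord j k) * vl p (chord i l).
Proof.
move=> ij jk kl; have E (x y : 'I_n) : (x <= y)%N -> ccw x y = (y - x)%N by rewrite ccwE => ->.
have il : i != l by rewrite -val_eqE /=; lia.
by apply: c_quad; rewrite ?height_chord // !E; lia.
Qed.

Lemma ordS_val i : (i.+1 < n)%N -> ordS i = i.+1 :> nat.
Proof. by move=> h; rewrite /= modn_small. Qed.

Lemma ordS_last i : i.+1 = n -> ordS i = 0%N :> nat.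
Proof. by move=> h; rewrite /= h modnn. Qed.

Let o : 'I_n := Ordinal (ltnW n_gt1).
Let o1 : 'I_n := Ordinal n_gt1.

(** In the Ptolemy relation for 0, i, j - 1, j the chord (i, j) is multiplied by the nonzero (0, j -
    1), so it is recovered from the edge (j - 1, j), the shorter chord (i, j - 1) and chords at
    0. *)
Lemma radii_zero_ext p q : radii_zero p -> radii_zero q ->
  (forall j, (0 < j)%N -> vl p (chord o j) != 0) ->
  (forall j, (0 < j)%N -> vl p (chord o j) = vl q (chord o j)) ->
  (forall j, (0 < j)%N -> (j.+1 < n)%N -> vl p (chord j (ordS j)) = vl q (chord j (ordS j))) ->
  p = q.
Proof.
move=> p0 q0 nz E0 E1; apply: (points_ext (n_gt2 := n_gt2)).
have lt (d : nat) : forall i j, (0 < i)%N -> (j = i + d.+1 :> nat)%N -> vl p (chord i j) = vl q (chord i j).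
  elim: d => [|d IH] i j i0 jE.
    have iS : (i.+1 < n)%N by have := ltn_ord j; move: jE; clear; lia.
    have -> : j = ordS i by apply: val_inj; rewrite [RHS](ordS_val iS) /= jE addn1.
    exact: E1.
  have [k kE] : {k : 'I_n | k = (i + d.+1)%N :> nat}.
    have kn : (i + d.+1 < n)%N by have := ltn_ord j; lia.
    by exists (Ordinal kn).
  have kn : (k.+1 < n)%N by have := ltn_ord j; move: jE kE; clear; lia.
  have jS : j = ordS k by apply: val_inj; rewrite [RHS](ordS_val kn) /= jE kE addnS.
  have k0 : (0 < k)%N by lia.
  have ik : (i < k)%N by lia.
  have kj : (k < j)%N by lia.
  have oi : (o < i)%N by [].
  have Ekj : vl p (chord k j) = vl q (chord k j) by rewrite jS; apply: E1.
  have j0 : (0 < j)%N by apply: ltn_trans kj.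
  have := chord_quad p oi ik kj; rewrite (IH i k i0 kE) Ekj (E0 k k0) (E0 i i0) (E0 j j0).
  by rewrite -(chord_quad q oi ik kj) => /mulfI; apply; rewrite -E0 // nz.
move=> [[i j]|[i s]] ij; last by rewrite p0 q0.
rewrite -/(chord i j); have {}ij : i != j := ij.
have key i' j' : (i' < j')%N -> vl p (chord i' j') = vl q (chord i' j').
  move=> ij'; have [i0|i0] := posnP i'.
    by have -> : i' = o by [apply: val_inj]; apply: E0; lia.
  by apply: (lt (j' - i').-1) => //; lia.
case: (ltngtP i j) => [lt'|lt'|E]; first exact: key.
  have ji : j != i by rewrite eq_sym.
  rewrite (@chord_antisym p true j i) // (@chord_antisym q true j i) //.
  by rewrite key.
by move: ij; rewrite (val_inj E) eqxx.
Qed.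

(** The default value 1 keeps all entries nonzero on a torus and lets the recursions run over
    [nat]. *)
Definition coord_at N (u : 'I_N -> K) (k : nat) : K :=
  if insub k is Some i then u i else 1.

Lemma coord_atE N (u : 'I_N -> K) (i : 'I_N) : coord_at u i = u i.
Proof. by rewrite /coord_at valK. Qed.

Lemma coord_at_neq0 N (u : 'I_N -> K) (k : nat) : torus u -> coord_at u k != 0.
Proof. by move=> Tu; rewrite /coord_at; case: insub => [i|]; [apply: Tu|apply: oner_neq0]. Qed.

Lemma laurent_coord_at N (k : nat) : laurent (fun u : 'I_N -> K => coord_at u k).
Proof.
by rewrite /coord_at; case: insub => [i|]; [apply: laurent_coord|apply: laurent_const].
Qed.

Lemma laurent_coord_atV N (k : nat) : laurent (fun u : 'I_N -> K => (coord_at u k)^-1).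
Proof.
rewrite /coord_at; case: insub => [i|]; first exact: laurentV.
by rewrite invr1; apply: laurent_const.
Qed.

Section GenericChart.
Variable N : nat.
Implicit Types u : 'I_N -> K.

(* Vectors [(r, z)] with [det(0, j) = u_(j-1)] and [det(j, j+1) = u_(n-1+j-1)]. *)
Fixpoint generic_height u (k : nat) : K :=
  if k is k'.+1 then
    (coord_at u (n.-1 + k') + generic_height u k' * coord_at u k) / coord_at u k'
  else 0.

Definition generic_r u (j : 'I_n) : K := if (j : nat) is k.+1 then coord_at u k else 0.
Definition generic_z u (j : 'I_n) : K := if (j : nat) is k.+1 then generic_height u k else -1.

Definition generic_value u a : K := param_value 0 0 (generic_r u) (generic_z u) a.

Lemma generic_chord0 u j : (0 < j)%N -> generic_value u (chord o j) = coord_at u j.-1.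
Proof.
move=> j0; rewrite /generic_value /= /generic_r /generic_z /= leqNgt j0 /=.
by case: (nat_of_ord j) j0 => // k _; ring.
Qed.

Lemma generic_edge u j : torus u -> (0 < j)%N -> (j.+1 < n)%N ->
  generic_value u (chord j (ordS j)) = coord_at u (n.-1 + j.-1).
Proof.
move=> Tu j0 jn; rewrite /generic_value /param_value /chord.
have Sj := ordS_val jn; rewrite /generic_r /generic_z Sj ltnn.
case: (nat_of_ord j) j0 => // k _; rewrite [k.+1.-1]/= [generic_height u k.+1]/=.
by field; apply: coord_at_neq0.
Qed.

Lemma generic_last u j : j.+1 = n -> generic_value u (chord j (ordS j)) = - coord_at u n.-2.
Proof.
move=> jn; rewrite /generic_value /param_value /chord.
have Sj := ordS_last jn; rewrite /generic_r /generic_z Sj leq0n.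
have -> : n.-2 = j.-1 by move: jn; clear; lia.
have : (0 < j)%N by lia.
by case: (nat_of_ord j) => // k _; rewrite [k.+1.-1]/=; ring.
Qed.

Lemma generic_boundary_neq0 u j : torus u -> generic_value u (chord j (ordS j)) != 0.
Proof.
move=> Tu; have [jn|jn] := eqVneq j.+1 n.
  by rewrite generic_last // oppr_eq0 coord_at_neq0.
have {}jn : (j.+1 < n)%N by have := ltn_ord j; lia.
have [j0|j0] := posnP j; last by rewrite generic_edge // coord_at_neq0.
have -> : j = o by apply: val_inj.
by rewrite generic_chord0 ?coord_at_neq0 // ordS_val.
Qed.

Lemma generic_point u : torus u -> exists p : points n K, forall a, vl p a = generic_value u a.
Proof. by move=> Tu; apply: point_exists => i; apply: generic_boundary_neq0. Qed.

Lemma laurent_generic a : laurent (fun u => generic_value u a).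
Proof.
have lh (k : nat) : laurent (generic_height ^~ k).
  elim: k => [|k IH]; first exact: laurent_const.
  apply: laurentM; last exact: laurent_coord_atV.
  by apply: laurentD; [|apply: laurentM]; try exact: laurent_coord_at.
have lr j : laurent (generic_r ^~ j).
  rewrite /generic_r; case: (nat_of_ord j) => [|k]; first exact: laurent_const.
  exact: laurent_coord_at.
have lz j : laurent (generic_z ^~ j).
  by rewrite /generic_z; case: (nat_of_ord j) => [|k]; first exact: laurent_const.
case: a => [[i j]|[i s]]; rewrite /generic_value /=.
  apply: laurentD; first by apply: laurentB; apply: laurentM.
  case: (j <= i)%N; last exact: laurent_const.
  by have := @laurent_const N K 0; congr laurent; apply: funext => u; rewrite !mul0r.
by have := @laurent_const N K 0; congr laurent; apply: funext => u; case: s; rewrite mul0r.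
Qed.

Lemma laurent_genericV i : laurent (fun u => (generic_value u (chord i (ordS i)))^-1).
Proof.
have [jn|jn] := eqVneq i.+1 n.
  have := laurentN (laurent_coord_atV N n.-2).
  by congr laurent; apply: funext => u; rewrite generic_last // invrN.
have {}jn : (i.+1 < n)%N by have := ltn_ord i; lia.
have [j0|j0] := posnP i; last first.
  by apply: laurent_ext (laurent_coord_atV N (n.-1 + i.-1)) => u Tu; rewrite generic_edge.
have -> : i = o by apply: val_inj.
have := laurent_coord_atV N 0.
by congr laurent; apply: funext => u; rewrite generic_chord0 // ordS_val.
Qed.
End GenericChart.

(* The vectors of a point of [radii_zero], in the basis given by the first two. *)
Definition vec_r p j : K := if (j : nat) is _.+1 then vl p (chord o j) else 0.
Definition vec_z p j : K :=
  match (j : nat) with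
  | 0%N => -1 | 1%N => 0 | _ => vl p (chord o1 j) / vl p (chord o o1) end.

Lemma radii_zero_param p a : radii_zero p -> is_tagged_arc a ->
  vl p a = param_value 0 0 (vec_r p) (vec_z p) a.
Proof.
move=> p0; case: a => [[i j]|[i s]] ta; last by rewrite p0 /=; case: (s); rewrite mul0r.
have {ta}ij : i != j := ta.
have b0 : vl p (chord o o1) != 0.
  have -> : o1 = ordS o by apply: val_inj; rewrite [RHS]ordS_val.
  exact: value_boundary_neq0.
have lt i' j' : (i' < j')%N -> vl p (chord i' j') =
    vec_r p i' * vec_z p j' - vec_z p i' * vec_r p j'.
  move=> ltij; have j0 : (0 < j')%N by lia.
  have rj : vec_r p j' = vl p (chord o j') by rewrite /vec_r; case: (nat_of_ord j') j0.
  have [i0|i0] := posnP i'.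
    have -> : i' = o by apply: val_inj.
    by rewrite rj /vec_r /vec_z /= mul0r sub0r mulN1r opprK.
  have ri : vec_r p i' = vl p (chord o i') by rewrite /vec_r; case: (nat_of_ord i') i0.
  have zj : vec_z p j' = vl p (chord o1 j') / vl p (chord o o1).
    by rewrite /vec_z; case: (nat_of_ord j') (leq_trans i0 (ltnW ltij)) (leq_ltn_trans i0 ltij) => [|[|k]] //; lia.
  have [i1|i1] := eqVneq (i' : nat) 1%N.
    have -> : i' = o1 by apply: val_inj.
    rewrite zj rj /vec_r /vec_z /= mul0r subr0; by field.
  have zi : vec_z p i' = vl p (chord o1 i') / vl p (chord o o1).
    by rewrite /vec_z; case: (nat_of_ord i') i0 i1 => [|[|k]].
  have oo1 : (o < o1)%N by []. have o1i : (o1 < i')%N by rewrite /=; lia.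
  have E := chord_quad p oo1 o1i ltij.
  rewrite ri rj zi zj; apply: (mulfI b0).
  have -> : vl p (chord o o1) * vl p (chord i' j') =
    vl p (chord o i') * vl p (chord o1 j') - vl p (chord o1 i') * vl p (chord o j').
    by rewrite E addrK.
  by field.
rewrite -[inl _]/(chord i j) /param_value /chord -/(chord i j).
case: (ltngtP j i) => [ji|ji|E].
- have ji' : j != i by rewrite eq_sym.
  rewrite (@chord_antisym p true j i) // lt // !mul0r addr0; ring.
- by rewrite lt // addr0.
- by move: ij; rewrite (val_inj E) eqxx.
Qed.

Hypothesis K_infinite : infinite_set [set: K].

(** The coordinates are the [n - 1] chords from 0 and the [n - 2] edges (j, j + 1) with
    [0 < j < n - 1]; the last edge is minus the chord (0, n - 1). *)
Let N := (2 * n - 3)%N.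

Lemma radii_zero_chart : exists phi, chart (N := N) radii_zero phi.
Proof.
have [phi phiE] := point_family (@generic_point N).
have phi0 t : torus t -> radii_zero (phi t).
  by move=> Tt i s; rewrite phiE // /generic_value /=; case: s; rewrite mul0r.
exists phi; split=> //.
- move=> p f Cp rf fp.
  (* Some chords (0, j) may vanish at [p]. Their values are the entries [vec_r p j], so adding [X]
     to all of them leads to nearby points at which the coordinates are nonzero. *)
  pose r j : {poly K} := if (j : nat) is _.+1 then 'X + (vec_r p j)%:P else 0.
  pose z j : {poly K} := (vec_z p j)%:P.
  have r0 j : (0 < j)%N -> r j != 0.
    rewrite /r; case: (nat_of_ord j) => // k _.
    by rewrite -size_poly_eq0 size_XaddC.
  have rE j : (r j).[0] = vec_r p j.
    by rewrite /r /vec_r; case: (nat_of_ord j) => [|k]; rewrite ?horner0 // !hornerE.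
  have [||c [q [hc fq qE]]] := @deform n K n_gt2 K_infinite 0 0 r z p f
      (\prod_(j : 'I_n | (0 < j)%N) r j) _ rf fp.
  - move=> a ta; rewrite (radii_zero_param Cp ta) -[RHS]/(horner_eval 0 _) param_value_morph.
    rewrite !rmorph0; congr (param_value _ _ _ _ a); apply: funext => j /=.
      by rewrite /horner_eval rE.
    by rewrite /horner_eval hornerC.
  - by apply/prodf_neq0 => j; apply: r0.
  have Cq : radii_zero q.
    by move=> i s; rewrite qE /=; case: s; rewrite mul0r horner0.
  have q0 j : (0 < j)%N -> vl q (chord o j) != 0.
    move=> j0; rewrite qE; move: hc; rewrite horner_prod => /prodf_neq0/(_ j j0).
    rewrite /param_value /chord leqNgt j0 /= addr0 {1}/r mul0r sub0r /z /vec_z /=.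
    by rewrite hornerN hornerM hornerC mulN1r opprK.
  pose u (k : 'I_N) : K := if (k < n.-1)%N then vl q (chord o (insubd o k.+1))
    else vl q (chord (insubd o (k - n.-1).+1) (ordS (insubd o (k - n.-1).+1))).
  have u0 j : (0 < j)%N -> coord_at u j.-1 = vl q (chord o j).
    move=> j0; have jn := ltn_ord j.
    have jN : (j.-1 < N)%N by rewrite /N; lia.
    rewrite -[j.-1]/(nat_of_ord (Ordinal jN)) coord_atE /u /=.
    have -> : (j.-1 < n.-1)%N by lia.
    by rewrite prednK // valKd.
  have u1 j : (0 < j)%N -> (j.+1 < n)%N ->
      coord_at u (n.-1 + j.-1) = vl q (chord j (ordS j)).
    move=> j0 jn; have jN : (n.-1 + j.-1 < N)%N by rewrite /N; lia.
    rewrite -[(n.-1 + j.-1)%N]/(nat_of_ord (Ordinal jN)) coord_atE /u /=.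
    by rewrite ltnNge leq_addr /= addKn prednK // valKd.
  have Tu : torus u.
    move=> k; rewrite /u; case: ifP => kn; last exact: value_boundary_neq0.
    by apply: q0; rewrite val_insubd; case: ifP => //; have := ltn_ord k; lia.
  exists u => //; suff -> : phi u = q by [].
  apply: radii_zero_ext => // [|j j0|j j0|j j0 jn]; first exact: phi0.
  + by rewrite phiE // generic_chord0 // u0 // q0.
  + by rewrite phiE // generic_chord0 // u0.
  + by rewrite phiE // generic_edge // u1.
- move=> k; have [kn|kn] := ltnP k n.-1.
    exists (fun p => vl p (chord o (insubd o k.+1))); first exact: regular_value.
    move=> t Tt; have kE : insubd o k.+1 = k.+1 :> nat by rewrite val_insubd; case: ifP => //; lia.
    by rewrite phiE // generic_chord0 kE // coord_atE.
  pose j : 'I_n := insubd o (k - n.-1).+1.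
  have kN : (k < 2 * n - 3)%N by exact: ltn_ord.
  have jE : j = (k - n.-1).+1 :> nat by rewrite val_insubd; case: ifP => //; lia.
  exists (fun p => vl p (chord j (ordS j))); first exact: regular_value.
  move=> t Tt; rewrite phiE // generic_edge // ?jE //; last by lia.
  by rewrite [_.+1.-1]/= subnKC // coord_atE.
- move=> f rf; apply: (laurent_family phiE) => //; first exact: laurent_generic.
  exact: laurent_genericV.
Qed.

(** All chords (i, i + 2) vanish on the alternating sets, so this point keeps [radii_zero] from
    lying in their union. *)
Lemma radii_zero_nonalternating :
  exists p i, radii_zero p /\ vl p (chord i (ordS (ordS i))) != 0.
Proof.
have [p pE] := @generic_point N (fun=> 1) (fun=> oner_neq0 _).
exists p, o; split; first by move=> i s; rewrite pE /generic_value /=; case: s; rewrite mul0r.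
have S1 : ordS o = 1%N :> nat by rewrite ordS_val.
have S2 : ordS (ordS o) = 2%N :> nat by rewrite ordS_val S1.
rewrite pE generic_chord0 S2 // coord_at_neq0 // => i; exact: oner_neq0.
Qed.
End Components.

(** * Alternating points *)

Section Alternating.
Variables (n : nat) (K : fieldType).
Hypothesis n_gt2 : (2 < n)%N.
Hypothesis n_even : ~~ odd n.
Implicit Types (i j l m : 'I_n) (p q : points n K).
Notation regular := (@regular_function n K).
Notation vl := (value n_gt2).

Let n_gt1 : (1 < n)%N. Proof. exact: ltnW. Qed.
Let o : 'I_n := Ordinal (ltnW n_gt1).
Let o1 : 'I_n := Ordinal n_gt1.

Let ordS_o : ordS o = o1. Proof. by apply: val_inj; rewrite [LHS]ordS_val. Qed.

Lemma odd_ordS i : odd (ordS i) = ~~ odd i.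
Proof.
have [jn|jn] := eqVneq i.+1 n; last by rewrite ordS_val //; have := ltn_ord i; move: jn; clear; lia.
by rewrite ordS_last // -[~~ odd i]/(odd i.+1) (congr1 odd jn) (negbTE n_even).
Qed.

Lemma ordS_eq i j : j = i.+1 :> nat -> j = ordS i.
Proof. by move=> E; apply: val_inj; rewrite [RHS]ordS_val -E. Qed.

Section OneComponent.
Variables s e : bool.

Definition alternating : set (points n K) := [set p |
  [/\ forall i, vl p (radius i (~~ s)) = 0,
      forall i, odd i != e -> vl p (radius i s) = 0 &
      forall i, vl p (chord i (ordS (ordS i))) = 0]].

Lemma closed_alternating : closed alternating.
Proof.
pose F (x : 'I_n + ({i : 'I_n | odd i != e} + 'I_n)) p := match x with
  | inl i => vl p (radius i (~~ s))
  | inr (inl i) => vl p (radius (val i) s)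
  | inr (inr i) => vl p (chord i (ordS (ordS i))) end.
have := @closed_zeros_fam n K _ F.
have H x : regular (F x) by case: x => [i|[i|i]]; apply: regular_value.
move=> /(_ H); congr closed; apply/seteqP; split=> p /= Hp.
  split=> [i|i ie|i]; first exact: (Hp (inl i)).
    exact: (Hp (inr (inl (exist _ i ie)))).
  exact: (Hp (inr (inr i))).
by case: Hp => H1 H2 H3 [i|[[i ie]|i]]; [apply: H1|apply: H2|apply: H3].
Qed.

(* The common ratio of the radii at the vertices of parity [e] and of the heights
   of an alternating point; [binv o] is the inverse of the chord [(0, 1)]. *)
Definition slope p : K :=
  if e then - vl p (radius o1 s) * pt_eval p (binv o) else vl p (radius o s).

Lemma regular_slope : regular slope.
Proof.
rewrite /slope; case: (e); last exact: regular_value.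
have := regularM (regularB (@regular_const n K 0) (@regular_value n K n_gt2 (radius o1 s)))
  (@regular_eval n K (binv o)).
by congr regular; apply: funext => p; rewrite sub0r.
Qed.

(** Since (j - 2, j) vanishes, the Ptolemy relation for i, j - 2, j - 1, j recovers (i, j) from (i,
    j - 2) and edges. In the same way a radius determines the one two steps further, and the slope
    fixes the first one of parity [e]. *)
Lemma alternating_ext p q : alternating p -> alternating q -> slope p = slope q ->
  (forall i, (i.+1 < n)%N -> vl p (chord i (ordS i)) = vl q (chord i (ordS i))) -> p = q.
Proof.
move=> [p0 p1 p2] [q0 q1 q2] Eslope E; apply: (points_ext (n_gt2 := n_gt2)).
have vertex (m : nat) : (m < n)%N -> {k : 'I_n | k = m :> nat} by move=> mn; exists (Ordinal mn).
have chordE (d : nat) : forall i j, (j = i + d.+1 :> nat)%N -> vl p (chord i j) = vl q (chord i j).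
  elim/ltn_ind: d => d IH i j jE; have jn := ltn_ord j.
  have [k kE] : {k : 'I_n | k = (i + d)%N :> nat} by apply: vertex; lia.
  have kS : j = ordS k by apply: ordS_eq; rewrite jE kE addnS.
  case: d => [|[|d]] in IH jE kE *.
  - have -> : i = k by apply: val_inj; rewrite /= kE addn0.
    by rewrite kS E // kE; move: jE jn; clear; lia.
  - have -> : j = ordS (ordS i).
      by rewrite kS; congr ordS; apply: ordS_eq; rewrite kE addn1.
    by rewrite p2 q2.
  have [l lE] : {l : 'I_n | l = (i + d.+1)%N :> nat} by apply: vertex; move: jE jn; clear; lia.
  have lS : k = ordS l by apply: ordS_eq; rewrite kE lE addnS.
  have il : (i < l)%N by rewrite lE; clear; lia.
  have lk : (l < k)%N by rewrite lE kE; clear; lia.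
  have kj : (k < j)%N by rewrite jE kE; clear; lia.
  have plj : vl p (chord l j) = 0 by rewrite kS lS.
  have qlj : vl q (chord l j) = 0 by rewrite kS lS.
  have Elk : vl p (chord l k) = vl q (chord l k).
    by rewrite lS E //; move: lk kj jn; clear; lia.
  have Ekj : vl p (chord k j) = vl q (chord k j).
    by rewrite kS E //; move: kj jn; clear; lia.
  have := chord_quad n_gt2 q il lk kj; have := chord_quad n_gt2 p il lk kj.
  rewrite plj qlj !mulr0 (IH d (ltnW (ltnSn _)) i l lE) Elk Ekj => Ep Eq.
  have : vl q (chord l k) != 0 by rewrite lS value_boundary_neq0.
  by move/mulfI; apply; apply: (addrI (vl q (chord i l) * vl q (chord k j))); rewrite -Ep.
have radE (m : nat) : forall i, i = m :> nat -> vl p (radius i s) = vl q (radius i s).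
  elim/ltn_ind: m => m IH i iE; have [ie|ie] := eqVneq (odd i) e; last by rewrite p1 ?q1.
  have Ebinv : pt_eval p (binv o) = pt_eval q (binv o).
    by rewrite !pt_eval_binv E.
  case: m => [|[|m]] in IH iE *.
  - have -> : i = o by apply: val_inj.
    by move: Eslope; rewrite /slope -ie iE.
  - have -> : i = o1 by apply: val_inj.
    move: Eslope; rewrite /slope -ie iE /= Ebinv => /mulIf/oppr_inj -> //.
    by rewrite pt_eval_binv invr_eq0 value_boundary_neq0.
  have lt := ltn_ord i.
  have [k kE] : {k : 'I_n | k = m :> nat} by apply: vertex; move: iE lt; clear; lia.
  have [l lE] : {l : 'I_n | l = m.+1 :> nat} by apply: vertex; move: iE lt; clear; lia.
  have lS : l = ordS k by apply: ordS_eq; rewrite lE kE.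
  have iS : i = ordS l by apply: ordS_eq; rewrite iE lE.
  have S1 := ccw_ordS k n_gt1.
  have c1 : (0 < ccw k l)%N by rewrite lS S1.
  have c2 : (ccw k l < ccw k i)%N by rewrite lS S1 ccwE iE kE leqW //; clear; lia.
  have := rho_quad n_gt2 q s c1 c2; have := rho_quad n_gt2 p s c1 c2.
  have pki : vl p (chord k i) = 0 by rewrite iS lS.
  have qki : vl q (chord k i) = 0 by rewrite iS lS.
  have El : vl p (chord l i) = vl q (chord l i).
    by rewrite iS E //; move: iE lE lt; clear; lia.
  have Ek : vl p (chord k l) = vl q (chord k l).
    by rewrite lS E //; move: iE kE lt; clear; lia.
  rewrite pki qki !mul0r El Ek (IH m (ltnW (ltnSn _)) k kE) => Ep Eq.
  have : vl q (chord k l) != 0 by rewrite lS value_boundary_neq0.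
  by move/mulfI; apply; apply: (addIr (vl q (chord l i) * vl q (radius k s))); rewrite -Ep.
have key i j : (i < j)%N -> vl p (chord i j) = vl q (chord i j).
  by move=> ij; apply: (chordE (j - i).-1); move: ij; clear; lia.
move=> [[i j]|[i t]] ta; last first.
  have [->|ts] := eqVneq t s; first exact: (radE i).
  have -> : t = ~~ s by move: ts; case: (t); case: (s).
  by rewrite p0 q0.
have {ta}ij : i != j := ta; rewrite -/(chord i j).
case: (ltngtP i j) => [lt|lt|E']; first exact: key.
  have ji : j != i by rewrite eq_sym.
  by rewrite (@chord_antisym _ _ _ p s j i) // (@chord_antisym _ _ _ q s j i) // key.
by move: ij; rewrite (val_inj E') eqxx.
Qed.


Section Vectors.
Variables (b : nat -> K) (lambda : K).
Hypothesis b_neq0 : forall m : nat, b m != 0.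

(** The nonzero coordinate of the vector at [m]; vectors of parity [e] lie on one axis, the others
    on the other. The recursion makes the determinant of consecutive vectors equal to [b m], with a
    sign according to which axis comes first. The initial 1 normalises by a diagonal matrix of
    determinant 1. *)
Fixpoint alt_entry (m : nat) : K :=
  if m is m'.+1 then (-1) ^+ (odd m' != e) * b m' / alt_entry m' else 1.

Definition alt_r i : K := if odd i == e then alt_entry i else 0.
Definition alt_z i : K := if odd i == e then 0 else alt_entry i.
Definition alt_value a : K :=
  param_value (if s then 0 else lambda) (if s then lambda else 0) alt_r alt_z a.

Lemma alt_entry_neq0 (m : nat) : alt_entry m != 0.
Proof. by elim: m => [|m IH] /=; rewrite ?oner_neq0 // !mulf_neq0 ?invr_eq0 // signr_eq0. Qed.

Lemma alt_chord i j : alt_value (chord i j) =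
  if odd i == odd j then 0 else (-1) ^+ (odd i != e) * alt_entry i * alt_entry j.
Proof.
have st0 : (if s then 0 else lambda) * (if s then lambda else 0) = 0.
  by case: (s); rewrite ?mul0r ?mulr0.
rewrite /alt_value /param_value /chord /alt_r /alt_z st0 !mul0r if_same addr0.
by case: (odd i); case: (odd j); case: (e) => /=; rewrite ?mul0r ?mulr0 ?subrr // ?expr1 ?expr0; ring.
Qed.

Lemma alt_boundary i : alt_value (chord i (ordS i)) =
  if (i.+1 < n)%N then b i else (-1) ^+ (odd i != e) * alt_entry i.
Proof.
rewrite alt_chord odd_ordS; have -> : (odd i == ~~ odd i) = false by case: (odd i).
case: ltnP => ni; last first.
  have -> : ordS i = 0%N :> nat by apply: ordS_last; have := ltn_ord i; move: ni; clear; lia.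
  by rewrite mulr1.
rewrite ordS_val // [alt_entry i.+1]/=.
by case: (odd i != e); rewrite ?expr1 ?expr0; field; apply: alt_entry_neq0.
Qed.

Lemma alt_point : exists p : points n K, forall a, vl p a = alt_value a.
Proof.
apply: point_exists => i; rewrite -[param_value _ _ _ _ _]/(alt_value _) alt_boundary.
by case: ifP => // _; rewrite mulf_neq0 ?signr_eq0 ?alt_entry_neq0.
Qed.

Lemma alt_alternating p : (forall a, is_tagged_arc a -> vl p a = alt_value a) -> alternating p.
Proof.
move=> pE; split=> [i|i ie|i].
- by rewrite pE // /alt_value /=; case: (s); rewrite mul0r.
- by rewrite pE // /alt_value /= /alt_r (negbTE ie) mulr0.
rewrite pE; first by rewrite alt_chord !odd_ordS negbK eqxx.
apply: contraTneq n_gt2 => /= iSS; have iS := ordS_neq n_gt1 i.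
by rewrite -(ccw_add_back iS) ccw_ordS // {2}iSS ccw_ordS.
Qed.

Lemma alt_slope p : (forall a, is_tagged_arc a -> vl p a = alt_value a) -> slope p = lambda.
Proof.
move=> pE; rewrite /slope pt_eval_binv ordS_o.
have so : alt_value (radius o s) = lambda * alt_r o by rewrite /alt_value /=; case: (s).
have s1 : alt_value (radius o1 s) = lambda * alt_r o1 by rewrite /alt_value /=; case: (s).
rewrite !pE ?so ?s1; try by rewrite //= -val_eqE.
rewrite -ordS_o alt_boundary n_gt1 /alt_r ordS_o /=; have := b_neq0 0; case: (e) => /= b0; last by rewrite mulr1.
by rewrite divr1; field.
Qed.

End Vectors.

Lemma alternating_param p a : alternating p -> is_tagged_arc a ->
  vl p a = alt_value (coord_at (fun i => vl p (chord i (ordS i)))) (slope p) a.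
Proof.
move=> alt_p ta; set b := coord_at _.
have b0 (m : nat) : b m != 0 by apply: coord_at_neq0 => i; apply: value_boundary_neq0.
have [q qE] := alt_point (slope p) b0.
suff pq : p = q by rewrite {1}pq qE.
apply: alternating_ext => //; first by apply: alt_alternating => a' _; apply: qE.
  by rewrite (alt_slope b0 (fun a _ => qE a)).
by move=> i iS; rewrite qE alt_boundary // iS /b coord_atE.
Qed.

Lemma alternating_same_parity p i j : alternating p -> i != j -> odd i = odd j ->
  vl p (chord i j) = 0.
Proof. by move=> alt_p ij oij; rewrite alternating_param // alt_chord oij eqxx. Qed.

(** Two consecutive radii of a triangulation are joined by a chord. If neither radius vanishes,
    their vertices have the same parity and the chord vanishes. *)
Lemma alternating_deep : alternating `<=` @deep_locus n K.
Proof.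
move=> p alt_p; apply/(deepP n_gt2) => T triT; have [p0 p1 _] := alt_p.
have [i [t iT]] := radius_exists n_gt1 triT.
have [ts|ts] := eqVneq t (~~ s); first by exists (radius i t) => //; rewrite ts.
have {ts} ts : t = s by move: ts; case: (t); case: (s).
subst t; have [ie|ie] := eqVneq (odd i) e; last by exists (radius i s) => //; rewrite p1.
have [nT|[j [ij ijT jT]]] := next_radius n_gt1 triT iT.
  by exists (radius i (~~ s)).
have [je|je] := eqVneq (odd j) e; last by exists (radius j s) => //; rewrite p1.
by exists (chord i j) => //; apply: alternating_same_parity; rewrite ?ie.
Qed.

Definition alternating_torus : set (points n K) := alternating `&` [set p | slope p != 0].

Section Family.
Variables (N : nat) (L : ('I_N -> K) -> K).
Hypothesis laurent_L : laurent L.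
Implicit Types u : 'I_N -> K.

Let v u a := alt_value (coord_at u) (L u) a.

Let laurent_entry (m : nat) : laurent (fun u => alt_entry (coord_at u) m) /\
  laurent (fun u => (alt_entry (coord_at u) m)^-1).
Proof.
elim: m => [|m [IH IHV]] /=.
  by split; first exact: laurent_const; rewrite invr1; apply: laurent_const.
split.
  apply: laurentM => //; apply: laurentM; first exact: laurent_const.
  exact: laurent_coord_at.
have := laurentM (laurentM (@laurent_const N K ((-1) ^+ (odd m != e))) (laurent_coord_atV K N m)) IH.
by congr laurent; apply: funext => u; rewrite !invfM invrK invr_sign.
Qed.

(** [L] is the scale of the radii: the last coordinate for the torus, and 0 for the intersection
    with [radii_zero]. *)
Lemma alt_family : exists phi : ('I_N -> K) -> points n K,
  (forall u, torus u -> forall a, vl (phi u) a = v u a) /\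
  (forall f, regular f -> laurent (fun u => f (phi u))).
Proof.
have [phi phiE] : exists phi : ('I_N -> K) -> points n K,
    forall u, torus u -> forall a, vl (phi u) a = v u a.
  apply: point_family => u Tu; apply: alt_point => m; exact: coord_at_neq0.
exists phi; split=> // f; apply: (laurent_family phiE) => [a|i].
  have lr i : laurent (fun u => alt_r (coord_at u) i).
    by rewrite /alt_r; case: (odd i == e); [apply: (laurent_entry i).1|apply: laurent_const].
  have lz i : laurent (fun u => alt_z (coord_at u) i).
    by rewrite /alt_z; case: (odd i == e); [apply: laurent_const|apply: (laurent_entry i).1].
  have l0 := @laurent_const N K 0.
  case: a => [[i j]|[i t]]; rewrite /v /alt_value /param_value; last first.
    by case: (t); case: (s); apply: laurentM.
  apply: laurentD; first by apply: laurentB; apply: laurentM.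
  case: (j <= i)%N => //; apply: laurentM => //; apply: laurentM => //; apply: laurentM.
    by case: (s).
  by case: (s).
have [ni|ni] := boolP (i.+1 < n)%N.
  apply: laurent_ext (laurent_coord_atV K N i) => u Tu.
  by rewrite /v alt_boundary ?ni // => m; apply: coord_at_neq0.
apply: laurent_ext (laurentM (@laurent_const N K ((-1) ^+ (odd i != e))) (laurent_entry i).2) => u Tu.
rewrite /v alt_boundary ?(negbTE ni) ?invfM ?invr_sign // => m; exact: coord_at_neq0.
Qed.

End Family.

Lemma alternating_torus_chart : exists phi, [/\ chart (N := n) alternating_torus phi &
  is_torus alternating_torus n].
Proof.
pose L (u : 'I_n -> K) := coord_at u n.-1.
have [phi [phiE phiL]] := alt_family (laurent_coord_at K n n.-1 : laurent L).
have cn u (m : nat) : torus u -> coord_at (u : 'I_n -> K) m != 0 by apply: coord_at_neq0.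
have phi_slope u : torus u -> slope (phi u) = L u.
  move=> Tu; apply: (@alt_slope (coord_at u) (L u)) => [m|a _]; [exact: cn|exact: phiE].
have phi_edge u i : torus u -> (i.+1 < n)%N -> vl (phi u) (chord i (ordS i)) = u i.
  by move=> Tu ni; rewrite phiE // alt_boundary ?ni ?coord_atE // => m; apply: cn.
have phi_in u : torus u -> alternating_torus (phi u).
  move=> Tu; split; last by rewrite /= phi_slope // /L cn.
  by apply: alt_alternating => a _; apply: phiE.
pose x p i := if (i.+1 < n)%N then vl p (chord i (ordS i)) else slope p.
have x_torus p : alternating_torus p -> torus (x p).
  by case=> _ sp i; rewrite /x; case: ifP => _; [apply: value_boundary_neq0|].
have last_i i : (i.+1 < n)%N = false -> n.-1 = i by have := ltn_ord i; lia.
have phi_x p : alternating_torus p -> phi (x p) = p.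
  move=> Tp; have Tx := x_torus p Tp; apply: alternating_ext.
  - exact: (phi_in _ Tx).1.
  - exact: Tp.1.
  - pose e1 := ord_pred o; have e1n : e1.+1 = n.
      by rewrite /e1 /= add0n modn_small prednK //; apply: ltnW.
    rewrite phi_slope // /L.
    have -> : n.-1 = e1 by rewrite -[in LHS]e1n.
    by rewrite coord_atE /x e1n ltnn.
  - by move=> i ni; rewrite phi_edge // /x ni.
have x_phi u : torus u -> x (phi u) = u.
  move=> Tu; apply: funext => i; rewrite /x; case: ifP => ni; first exact: phi_edge.
  by rewrite phi_slope // /L (last_i i ni) coord_atE.
have rx i : regular (fun p => x p i).
  by rewrite /x; case: (i.+1 < n)%N; [apply: regular_value|apply: regular_slope].
have ch : chart alternating_torus phi.
  split=> //.
  - by move=> p f Tp rf fp; exists (x p); [apply: x_torus|rewrite phi_x].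
  - by move=> i; exists (fun p => x p i) => // u Tu; rewrite x_phi.
exists phi; split=> //; apply: (chart_is_torus ch) => [|//|p Tp|//].
  exists [set p | slope p != 0], alternating; split; last by rewrite setIC.
    exact/open_nonzero/regular_slope.
  exact: closed_alternating.
by split; [apply: x_torus|apply: phi_x].
Qed.

Hypothesis K_infinite : infinite_set [set: K].

(** Keeping the edges fixed, the slope of a point is deformed to [slope p + c], which is nonzero for
    all [c] but one. *)
Lemma closure_alternating_torus : closure alternating_torus = alternating.
Proof.
apply/seteqP; split.
  by move=> p cp; apply: closed_alternating; apply: closure_subset cp => q [].
move=> p alt_p; apply/zariski_closureP => f rf fp.
set b := coord_at (fun i => vl p (chord i (ordS i))).
have b0 (m : nat) : b m != 0 by apply: coord_at_neq0 => i; apply: value_boundary_neq0.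
pose lam : {poly K} := 'X + (slope p)%:P.
have lamE c : lam.[c] = c + slope p by rewrite /lam !hornerE.
have [||c [q [cl fq qE]]] := @deform n K n_gt2 K_infinite (if s then 0 else lam)
  (if s then lam else 0) (fun i => (alt_r b i)%:P) (fun i => (alt_z b i)%:P) p f lam _ rf fp.
- move=> a ta; rewrite (alternating_param alt_p ta) -[RHS]/(horner_eval 0 _) param_value_morph.
  rewrite /alt_value; congr (param_value _ _ _ _ a).
  + by case: (s); [rewrite rmorph0|rewrite -[RHS]/(lam.[0]) lamE add0r].
  + by case: (s); [rewrite -[RHS]/(lam.[0]) lamE add0r|rewrite rmorph0].
  + by apply: funext => i; apply/esym/hornerC.
  + by apply: funext => i; apply/esym/hornerC.
- by rewrite -size_poly_eq0 size_XaddC.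
have {}qE a : is_tagged_arc a -> vl q a = alt_value b lam.[c] a.
  move=> _; rewrite qE -[LHS]/(horner_eval c _) param_value_morph.
  rewrite /alt_value; congr (param_value _ _ _ _ a).
  + by case: (s); rewrite ?rmorph0.
  + by case: (s); rewrite ?rmorph0.
  + by apply: funext => i; apply: hornerC.
  + by apply: funext => i; apply: hornerC.
exists q => //; split; first exact: (alt_alternating qE).
by rewrite /= (alt_slope b0 qE).
Qed.

Lemma alternating_chart : exists phi, chart (N := n) alternating phi.
Proof.
have [phi [[phi_in phi_d phi_c phi_l] _]] := alternating_torus_chart.
exists phi; split=> //; first by move=> t Tt; have [] := phi_in t Tt.
move=> p f; rewrite -closure_alternating_torus => /zariski_closureP cl rf fp.
by have [q Tq fq] := cl f rf fp; apply: phi_d Tq rf fq.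
Qed.

Lemma alternating_meet_chart :
  exists phi, chart (N := n.-1) (radii_zero n_gt2 `&` alternating) phi.
Proof.
have [phi [phiE phiL]] := alt_family (@laurent_const n.-1 K 0).
have cn u (m : nat) : torus u -> coord_at (u : 'I_n.-1 -> K) m != 0 by apply: coord_at_neq0.
have widen i : (i < n.-1)%N -> (i.+1 < n)%N by lia.
have phi_edge u (i : 'I_n) (m : 'I_n.-1) : torus u -> i = m :> nat ->
    vl (phi u) (chord i (ordS i)) = u m.
  move=> Tu im; have ni : (i.+1 < n)%N by apply: widen; rewrite im.
  by rewrite phiE // alt_boundary ?ni ?im ?coord_atE // => m'; apply: cn.
have phi_in u : torus u -> (radii_zero n_gt2 `&` alternating) (phi u).
  move=> Tu; split; last by apply: alt_alternating => a _; apply: phiE.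
  by move=> i t; rewrite phiE // /alt_value /param_value /radius !if_same mul0r.
have vertex (m : 'I_n.-1) : exists i : 'I_n, i = m :> nat.
  have mn : (m < n)%N by have := ltn_ord m; move: n_gt2; clear; lia.
  by exists (Ordinal mn).
exists phi; split=> //; last first.
  move=> m; have [i im] := vertex m.
  exists (fun p => vl p (chord i (ordS i))); first exact: regular_value.
  by move=> u Tu; apply: phi_edge.
move=> p f [p0 alt_p] rf fp.
pose x (m : 'I_n.-1) := coord_at (fun i => vl p (chord i (ordS i))) m.
have Tx : torus x by move=> m; apply: coord_at_neq0 => i; apply: value_boundary_neq0.
exists x => //; suff -> : phi x = p by [].
apply: alternating_ext => //; first exact: (phi_in x Tx).2.
  have zero q : radii_zero n_gt2 q -> slope q = 0.
    by move=> q0; rewrite /slope !q0 oppr0 mul0r if_same.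
  by rewrite !zero //; apply: (phi_in x Tx).1.
move=> i ni; have im : (i < n.-1)%N by move: ni; clear; lia.
by rewrite (@phi_edge _ _ (Ordinal im)) // /x coord_atE.
Qed.

End OneComponent.
End Alternating.

(** * The deep locus *)

Section DeepLocus.
Variables (n : nat) (K : fieldType).
Hypothesis n_gt3 : (3 < n)%N.
Implicit Types (i j l : 'I_n) (p q : points n K).

Let n_gt2 : (2 < n)%N := ltnW n_gt3.

Notation vl := (value n_gt2).
Notation deep := (@deep_locus n K).
Notation radii0 := (radii_zero n_gt2 : set (points n K)).
Notation alt := (@alternating n K n_gt2).
Notation alt_torus := (@alternating_torus n K n_gt2).

Lemma deep_cases p : deep p -> radii0 p \/ ~~ odd n /\ exists s e, alt s e p.
Proof.
move=> deep_p; have [|N] := pselect (radii0 p); [by left|right].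
have [i [s ris]] : exists i s, vl p (radius i s) != 0.
  apply: contrapT => N'; apply: N => i s; apply/eqP; apply: contraT => ris.
  by case: N'; exists i, s.
have [n_even [e eP]] := deep_parity deep_p ris.
split=> //; exists s, e; split=> [j|j je|j].
- exact: deep_other deep_p _ _ ris _.
- by apply/eqP; rewrite -[_ == 0]negbK eP.
- exact: deep_skip deep_p _ _ ris n_gt3 _.
Qed.

Lemma deep_odd : odd n -> deep = radii0.
Proof.
move=> n_odd; apply/seteqP; split=> p; last exact: radii_zero_deep.
by case/deep_cases => // -[]; rewrite n_odd.
Qed.

Section Even.
Hypothesis n_even : ~~ odd n.

Let some_alternating : set (points n K) :=
  (alt false false `|` alt false true) `|` (alt true false `|` alt true true).

Lemma deep_even : deep = radii0 `|` some_alternating.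
Proof.
apply/seteqP; split=> p.
  case/deep_cases => [|[_ [[] [[] alt_p]]]]; [by left|right..].
  - by right; right.
  - by right; left.
  - by left; right.
  - by left; left.
case=> [|[[]|[]]]; first exact: radii_zero_deep.
all: exact: alternating_deep.
Qed.

Lemma closed_some_alternating : closed some_alternating.
Proof. by do 2!apply: closedU; apply: closed_alternating. Qed.

Lemma irreducible_some_alternating X : irreducible_set X -> X `<=` some_alternating ->
  exists s e, X `<=` alt s e.
Proof.
move=> [_ irr] /irr[||/irr[]|/irr[]].
all: try (by apply: closedU; apply: closed_alternating).
all: try exact: closed_alternating.
- by exists false, false.
- by exists false, true.
- by exists true, false.
- by exists true, true.
Qed.

Lemma slope_radius s e p : slope n_gt2 s e p != 0 ->
  exists2 i : 'I_n, odd i = e & vl p (radius i s) != 0.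
Proof.
rewrite /slope; case: e => [|h]; last by eexists; last exact: h.
by rewrite mulf_eq0 oppr_eq0 negb_or => /andP[h _]; eexists; last exact: h.
Qed.

Lemma alternating_torus_inj s e s' e' : alt_torus s e = alt_torus s' e' -> s = s' /\ e = e'.
Proof.
move=> E; have [phi [ch _]] := alternating_torus_chart K n_gt2 n_even s e.
have [alt1 s1] := chart_in ch (fun=> oner_neq0 K); set p := phi _ in alt1 s1.
have [[p0 p1 _] _] : alt_torus s' e' p by rewrite -E; split.
have [i ie ri] := slope_radius s1.
have ss : s = s'.
  apply/eqP; apply: contraNT ri => ss.
  have -> : s = ~~ s' by move: ss; case: (s); case: (s').
  by rewrite p0.
split=> //; apply/eqP; apply: contraNT ri => ee.
by rewrite ss p1 // ie.
Qed.

Lemma alternating_torus_not_radii_zero s e : ~ (alt_torus s e `<=` radii0).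
Proof.
have [phi [ch _]] := alternating_torus_chart K n_gt2 n_even s e.
have in_t := chart_in ch (fun=> oner_neq0 K).
move=> /(_ _ in_t) r0; have [i _] := slope_radius in_t.2.
by rewrite r0 eqxx.
Qed.

Hypothesis K_infinite : infinite_set [set: K].

Lemma irreducible_radii_zero : irreducible_set radii0.
Proof.
have [phi ch] := radii_zero_chart n_gt2 K_infinite.
exact (chart_irreducible K_infinite ch).
Qed.

Lemma component_radii_zero : irreducible_component deep radii0.
Proof.
split; [exact: radii_zero_deep|exact: irreducible_radii_zero|move=> Z Zdeep irrZ CZ].
have ZU : Z `<=` radii0 `|` some_alternating by rewrite -deep_even.
have [ZC|ZY] := irrZ.2 _ _ (@closed_radii_zero _ _ _) closed_some_alternating ZU.
  by apply/seteqP.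
have [p [i [p0 pi]]] := radii_zero_nonalternating K n_gt2.
by have [[]|[]] := ZY p (CZ p p0) => -[_ _ E]; rewrite E eqxx in pi.
Qed.

Lemma component_unique C' : irreducible_component deep C' ->
  has_dimension C' (2 * n - 3)%N -> C' = radii0.
Proof.
move=> [C'deep irr maxC'] [chain _].
have C'U : C' `<=` radii0 `|` some_alternating by rewrite -deep_even.
have [C'C|C'Y] := irr.2 _ _ (@closed_radii_zero _ _ _) closed_some_alternating C'U.
  by rewrite (maxC' radii0 (@radii_zero_deep _ _ _) irreducible_radii_zero C'C).
have [s [e sub]] := irreducible_some_alternating irr C'Y.
have [phi ch] := alternating_chart n_gt2 n_even s e K_infinite.
(* An alternating set has dimension [n], and [n < 2 * n - 3] because [n > 3]. *)
by case: (chart_no_chain ch sub _ chain); move: n_gt3; clear; lia.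
Qed.

(** Once all radii vanish, tag and parity make no difference: what remains of each alternating
    condition is the vanishing of the chords (i, i + 2). *)
Lemma alternating_cap : \bigcap_(i in [set: 'I_4]) alt (1 < i)%N (odd i) `&` radii0 =
  radii0 `&` alt false false.
Proof.
apply/seteqP; split=> p.
  by case=> /(_ ord0 I) H p0; split.
by case=> p0 [_ _ p2]; split=> [i _|]; first split=> [j|j _|j]; [exact: p0|exact: p0|exact: p2|].
Qed.

End Even.
End DeepLocus.

Theorem theorem5p24 (k : fieldType) (n : nat) (hn : (4 <= n)%N) :
  (odd n -> infinite_set [set: k] ->
     (forall C : set (points n k),
        irreducible_component (@deep_locus n k) C <-> C = @deep_locus n k) /\
     has_dimension (@deep_locus n k) (2 * n - 3)%N) /\
  (~~ odd n ->
     exists T : 'I_4 -> set (points n k),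
       [/\ injective T,
           forall i, T i `<=` @deep_locus n k,
           forall i, is_torus (T i) n &
           infinite_set [set: k] ->
           exists C : set (points n k),
             [/\ irreducible_component (@deep_locus n k) C,
                 has_dimension C (2 * n - 3)%N,
                 forall C' : set (points n k),
                   irreducible_component (@deep_locus n k) C' ->
                   has_dimension C' (2 * n - 3)%N -> C' = C,
                 forall i, ~ (T i `<=` C) &
                 let W := closure C `&` \bigcap_i closure (T i) in
                 irreducible_set W /\ has_dimension W (n - 1)%N]]).
Proof.
pose n_gt2 : (2 < n)%N := ltnW hn.
split=> [n_odd K_inf|n_even].
  have irr := irreducible_radii_zero hn K_inf.
  have [phi ch] := radii_zero_chart n_gt2 K_inf.
  rewrite (deep_odd k hn n_odd); split; last exact (chart_dimension K_inf ch).
  move=> C; split=> [[Cd irrC maxC]|->]; first by rewrite (maxC _ _ irr Cd).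
  by split=> // Z Zd _ CZ; apply/seteqP.
(* The two binary digits of [i] encode the tag and the parity. *)
exists (fun i => alternating_torus n_gt2 (1 < i)%N (odd i)); split.
- move=> i j /(alternating_torus_inj n_even)[].
  by case: i j => [[|[|[|[|?]]]] ?] [[|[|[|[|?]]]] ?] //= _ _; apply: val_inj.
- by move=> i p [alt_p _]; apply: alternating_deep alt_p.
- by move=> i; have [phi []] := alternating_torus_chart k n_gt2 n_even (1 < i)%N (odd i).
move=> K_inf; have [phi ch] := radii_zero_chart n_gt2 K_inf.
exists (radii_zero n_gt2); split.
- exact: component_radii_zero.
- exact (chart_dimension K_inf ch).
- exact: component_unique.
- by move=> i; apply: alternating_torus_not_radii_zero.
have [psi chW] := alternating_meet_chart k n_gt2 n_even false false.
move=> W; have -> : W = radii_zero n_gt2 `&` alternating n_gt2 false false.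
  rewrite /W -(alternating_cap k hn) setIC -(closure_id _).1; last exact: closed_radii_zero.
  by congr (_ `&` _); apply: eq_bigcapr => i _; rewrite closure_alternating_torus.
by rewrite subn1; split; [exact (chart_irreducible K_inf chW)|exact (chart_dimension K_inf chW)].
Qed.
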